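(* Let $d\ge 3$, $V\in L_{1,loc}(\mathbf{R}^d)$, $V\ge 0$. Suppose that for some $r_0>0$ and some function $\gamma:(0,r_0]\to(0,1)$ with $\limsup_{r\downarrow 0} r^{-2}\gamma(r)=\infty$ the condition $$\lim_{|y|\to\infty} V^\star\big(\gamma(r)\,\mathrm{mes}_d(Q_r(y));\,Q_r(y)\big)=\infty$$ is satisfied for every $r\in(0,r_0]$. Then the spectrum of the operator $H=-\Delta+V(x)$ in $L_2(\mathbf{R}^d)$ is discrete.
   Context: $H=-\Delta+V$ is the Schrödinger operator in $L_2(\mathbf{R}^d)$, i.e. the nonnegative self-adjoint operator associated with the closed quadratic form $\int_{\mathbf{R}^d}(|\nabla u|^2+V|u|^2)\,dx$. Its spectrum is discrete if it consists only of isolated eigenvalues of finite multiplicity. $\mathrm{mes}_d$ is Lebesgue measure on $\mathbf{R}^d$. $Q=[0,1]^d$, $Q_r(y)=rQ+y$ for $r>0$, $y\in\mathbf{R}^d$. For a measurable set $E\subseteq\mathbf{R}^d$, a nonnegative measurable function $W$ on $E$ and $t>0$, the non-increasing rearrangement is $W^\star(t;E)=\sup\{s>0:\ \mathrm{mes}_d(\{x\in E: W(x)\ge s\})\ge t\}$ (with $\sup\emptyset=0$). *)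

(* Defs.v *)
From HB Require Import structures.
From mathcomp Require Import all_boot all_order all_algebra.
From mathcomp Require Import complex.
From mathcomp Require Import all_classical all_reals all_analysis.

Set Implicit Arguments.
Unset Strict Implicit.
Unset Printing Implicit Defensive.

Import Order.TTheory GRing.Theory Num.Theory.
Import numFieldNormedType.Exports.

Local Open Scope classical_set_scope.
Local Open Scope ring_scope.

Definition rV_display : measure_display -> measure_display.
Proof. exact. Qed.

Section measurable_rV.
Context (R : realType) (n : nat).

Let coord (i : 'I_n) (x : 'rV[R]_n) : measurableTypeR R := x ord0 i.

Let rV_set0 : g_sigma_preimage coord set0.
Proof. exact: sigma_algebra0. Qed.

Let rV_setC A : g_sigma_preimage coord A -> g_sigma_preimage coord (~` A).
Proof. exact: sigma_algebraC. Qed.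

Let rV_bigcup (F : (set 'rV[R]_n)^nat) :
  (forall i, g_sigma_preimage coord (F i)) ->
  g_sigma_preimage coord (\bigcup_i F i).
Proof. exact: sigma_algebra_bigcup. Qed.

(* The sigma-algebra generated by the coordinates, i.e. the Borel one. *)
HB.instance Definition _ :=
  @isMeasurable.Build (rV_display R.-ocitv.-measurable.-sigma)
    'rV[R]_n (g_sigma_preimage coord) rV_set0 rV_setC rV_bigcup.

End measurable_rV.

Section lebesgue_rV.
Context (R : realType).

Definition rV_cons n (p : measurableTypeR R * 'rV[R]_n) : 'rV[R]_n.+1 :=
  \row_i oapp (p.2 ord0) p.1 (unlift ord0 i).

Definition rV_uncons n (x : 'rV[R]_n.+1) : measurableTypeR R * 'rV[R]_n :=
  (x ord0 ord0, \row_i x ord0 (lift ord0 i)).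

Lemma rV_consK n : cancel (@rV_cons n) (@rV_uncons n).
Proof.
move=> [a v]; rewrite /rV_uncons mxE unlift_none /=; congr pair.
by apply/rowP => i; rewrite !mxE liftK.
Qed.

Lemma rV_unconsK n : cancel (@rV_uncons n) (@rV_cons n).
Proof.
move=> x; apply/rowP => i; rewrite mxE.
by case: unliftP => [j ->|->] //=; rewrite mxE.
Qed.

Lemma measurable_coord n (i : 'I_n) :
  measurable_fun setT (fun x : 'rV[R]_n => x ord0 i : measurableTypeR R).
Proof.
move=> _ Y mY; rewrite setTI; apply: sub_sigma_algebra => /=.
rewrite -bigcup_seq/=; exists i => /=; first by rewrite mem_index_enum.
by exists Y => //; rewrite setTI.
Qed.

Lemma measurable_fun_rV d (T : measurableType d) n (f : T -> 'rV[R]_n) :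
  (forall i, measurable_fun setT (fun t => f t ord0 i : measurableTypeR R)) ->
  measurable_fun setT f.
Proof.
move=> mf _ A mA; rewrite setTI.
suff : g_sigma_preimage (fun i t => f t ord0 i : measurableTypeR R)
    `<=` measurable.
  rewrite (g_sigma_preimage_comp
    (fun i (x : 'rV[R]_n) => x ord0 i : measurableTypeR R)) => h.
  by apply: h; exists A => //; rewrite setTI.
apply: smallest_sub; first exact: sigma_algebra_measurable.
rewrite -bigcup_seq; apply: bigcup_sub => i _ B [C mC <-].
exact: mf.
Qed.

Lemma measurable_rV_cons n : measurable_fun setT (@rV_cons n).
Proof.
apply: measurable_fun_rV => i.
under eq_fun do rewrite mxE.
case: (unliftP ord0 i) => [j _|_] /=; last exact: measurable_fst.
exact: (measurableT_comp (@measurable_coord n j) measurable_snd).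
Qed.

Lemma measurable_rV_uncons n : measurable_fun setT (@rV_uncons n).
Proof.
apply: measurable_fun_pair; first exact: measurable_coord.
apply: measurable_fun_rV => i.
under eq_fun do rewrite mxE.
exact: measurable_coord.
Qed.


Section lebesgue_step.
Context n (m : {sigma_finite_measure set 'rV[R]_n -> \bar R}).

Definition lebesgue_step : set 'rV[R]_n.+1 -> \bar R :=
  pushforward (@lebesgue_measure R \x m)%E (@rV_cons n).

Let step0 : lebesgue_step set0 = 0%E.
Proof. by rewrite /lebesgue_step /pushforward preimage_set0 measure0. Qed.

Let step_ge0 A : (0 <= lebesgue_step A)%E.
Proof. by rewrite /lebesgue_step /pushforward; exact: measure_ge0. Qed.

Let step_sigma_additive : semi_sigma_additive lebesgue_step.
Proof.
exact: (@measure_semi_sigma_additive _ _ _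
  (@measure_function_pushforward__canonical__measure_function_Measure _ _ _ _ _ _ _
    (@measurable_rV_cons n))).
Qed.

HB.instance Definition _ := isMeasure.Build _ _ _
  lebesgue_step step0 step_ge0 step_sigma_additive.

Let step_sigma_finite : sigma_finite setT lebesgue_step.
Proof.
have /sigma_finiteP[F [TF ndF Foo]] := sigma_finiteT (@lebesgue_measure R).
have /sigma_finiteP[G [TG ndG Goo]] := sigma_finiteT m.
exists (fun k => @rV_uncons n @^-1` (F k `*` G k)).
  rewrite -preimage_bigcup (_ : \bigcup_k _ = setT) ?preimage_setT//.
  rewrite -subTset => -[a v] _.
  have [[i _ Fi] [j _ Gj]] : (\bigcup_k F k) a /\ (\bigcup_k G k) v.
    by rewrite -TF -TG.
  exists (maxn i j) => //; split => /=.
  - by move: a Fi; exact/subsetPset/ndF/leq_maxl.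
  - by move: v Gj; exact/subsetPset/ndG/leq_maxr.
move=> k; have [mF Fk] := Foo k; have [mG Gk] := Goo k; split.
  rewrite -[X in measurable X]setTI.
  by apply: measurable_rV_uncons => //; exact: measurableX.
rewrite /lebesgue_step /pushforward -comp_preimage.
rewrite (_ : _ \o _ = id); last by apply/funext => p /=; rewrite rV_consK.
by rewrite preimage_id product_measure1E// lte_mul_pinfty// ge0_fin_numE.
Qed.

HB.instance Definition _ := Measure_isSigmaFinite.Build _ _ _
  lebesgue_step step_sigma_finite.

End lebesgue_step.

(* d-dimensional Lebesgue measure, as the d-fold product measure. *)
Fixpoint mes n : {sigma_finite_measure set 'rV[R]_n -> \bar R} :=
  match n with
  | 0 => \d_(0 : 'rV[R]_0)
  | n'.+1 => lebesgue_step (mes n')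
  end.

End lebesgue_rV.

Arguments mes {R n}.

Section geometry.
Context (R : realType) (d : nat).

Definition enorm (y : 'rV[R]_d) : R := Num.sqrt (\sum_i y ord0 i ^+ 2).

Definition unit_cube : set 'rV[R]_d := [set x | forall i, 0 <= x ord0 i <= 1].

Definition cube (r : R) (y : 'rV[R]_d) : set 'rV[R]_d :=
  [set r *: q + y | q in unit_cube].

(* The max with 0 encodes sup of the empty set being 0. *)
Definition rearrangement (W : 'rV[R]_d -> R) (E : set 'rV[R]_d) (t : \bar R)
    : \bar R :=
  Order.max 0%E (ereal_sup [set s%:E | s in
    [set s : R | 0 < s /\ (t <= mes (E `&` [set x | (s <= W x)%R]))%E]]).

Definition tends_to_pinfty_at_infinity (F : 'rV[R]_d -> \bar R) : Prop :=
  forall M : R, exists N : R, forall y, N <= enorm y -> (M%:E <= F y)%E.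

(* Elements of L_1loc are classes modulo null sets; each class has a
   Borel measurable representative. *)
Definition L1loc (V : 'rV[R]_d -> R) : Prop :=
  measurable_fun setT V /\
  forall K : set 'rV[R]_d, compact K -> mes.-integrable K (EFin \o V).

End geometry.

Section complex_L2.
Context (R : realType) (d : nat).
Implicit Types (u v f : 'rV[R]_d -> R[i]) (l : R[i]).

Definition sqmod (z : R[i]) : R := complex.Re z ^+ 2 + complex.Im z ^+ 2.

Definition ae_equal u v : Prop := {ae @mes R d, forall x, u x = v x}.

Definition L2 u : Prop :=
  [/\ measurable_fun setT (@complex.Re R \o u), measurable_fun setT (@complex.Im R \o u) &
      (\int[mes]_x (sqmod (u x))%:E < +oo)%E].

Definition cintegral u : R[i] :=
  Complex (\int[mes]_x complex.Re (u x)) (\int[mes]_x complex.Im (u x)).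

Definition inner u v : R[i] := cintegral (fun x => u x * conjc (v x)).

Definition L2norm u : R := Num.sqrt (\int[mes]_x sqmod (u x)).

(* An operator in L_2 is given by its graph: T u f reads
   "u belongs to the domain of T and T u = f". *)
Definition L2operator := ('rV[R]_d -> R[i]) -> ('rV[R]_d -> R[i]) -> Prop.

(* The self-adjoint operator given by Kato's first representation theorem
   when h is a densely defined closed nonnegative form with domain dom. *)
Definition associated_operator (dom : ('rV[R]_d -> R[i]) -> Prop)
    (h : ('rV[R]_d -> R[i]) -> ('rV[R]_d -> R[i]) -> R[i]) : L2operator :=
  fun u f => [/\ dom u, L2 f & forall v, dom v -> h u v = inner f v].

(* Graph of T - l. *)
Definition shifted (T : L2operator) l : L2operator :=
  fun u f => T u (fun x => f x + l * u x).

Definition resolvent_set (T : L2operator) : set R[i] :=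
  [set l | exists C : R, forall f, L2 f ->
     exists u, [/\ shifted T l u f, L2norm u <= C * L2norm f &
       forall u', shifted T l u' f -> ae_equal u' u]].

Definition spectrum (T : L2operator) : set R[i] := ~` resolvent_set T.

Definition eigenfunction (T : L2operator) l u : Prop :=
  T u (fun x => l * u x).

Definition eigenvalue (T : L2operator) l : Prop :=
  exists u, eigenfunction T l u /\ ~ ae_equal u (fun=> 0).

Definition finite_multiplicity (T : L2operator) l : Prop :=
  exists (n : nat) (e : 'I_n -> 'rV[R]_d -> R[i]),
    (forall k, eigenfunction T l (e k)) /\
    forall u, eigenfunction T l u ->
      exists c : 'I_n -> R[i], ae_equal u (fun x => \sum_k c k * e k x).

Definition isolated_in (S : set R[i]) l : Prop :=
  exists2 eps : R, 0 < eps &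
    forall m, S m -> sqmod (m - l) < eps ^+ 2 -> m = l.

Definition discrete_spectrum (T : L2operator) : Prop :=
  forall l, spectrum T l ->
    [/\ isolated_in (spectrum T) l, eigenvalue T l & finite_multiplicity T l].

End complex_L2.

Section schrodinger.
Context (R : realType) (d : nat).
Implicit Types (u v : 'rV[R]_d -> R[i]) (phi : 'rV[R]_d -> R).

Definition basis_vec (j : 'I_d) : 'rV[R]_d := delta_mx ord0 j.

Fixpoint Ck (k : nat) phi : Prop :=
  match k with
  | 0 => continuous phi
  | k'.+1 => continuous phi /\
      forall j, (forall x, derivable phi x (basis_vec j)) /\
                Ck k' (fun x => 'D_(basis_vec j) phi x)
  end.

Definition test_function phi : Prop :=
  (forall k, Ck k phi) /\ compact (closure [set x | phi x != 0]).

(* Real-valued test functions are enough: the identity is linear in phi. *)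
Definition weak_partial (j : 'I_d) u (g : 'rV[R]_d -> R[i]) : Prop :=
  forall phi, test_function phi ->
    cintegral (fun x => u x * ('D_(basis_vec j) phi x)%:C%C) =
    - cintegral (fun x => g x * (phi x)%:C%C).

Definition weak_gradient u (g : 'I_d -> 'rV[R]_d -> R[i]) : Prop :=
  forall j, L2 (g j) /\ weak_partial j u (g j).

Definition H1 u : Prop := L2 u /\ exists g, weak_gradient u g.

(* A representative of the gradient, unique up to null sets on H1. *)
Definition grad u : 'I_d -> 'rV[R]_d -> R[i] :=
  xget (fun _ _ => 0) [set g | weak_gradient u g].

Definition form_domain (V : 'rV[R]_d -> R) u : Prop :=
  H1 u /\ (\int[mes]_x (V x * sqmod (u x))%:E < +oo)%E.

Definition energy_form (V : 'rV[R]_d -> R) u v : R[i] :=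
  \sum_j inner (grad u j) (grad v j) +
  cintegral (fun x => (V x)%:C%C * (u x * conjc (v x))).

Definition schrodinger (V : 'rV[R]_d -> R) : L2operator R d :=
  associated_operator (form_domain V) (energy_form V).

End schrodinger.

(* Main.v *)
(* The form domain embeds into L2 compactly, in the following form: for every
   e > 0 there are finitely many bounded functionals phi_k such that
   |u|^2 <= e a(u,u) + \sum_k phi_k(u)^2, where a is the energy form.

   Choose r with gamma(r) / r^2 large.  Far from the origin, V >= s on a
   proportion gamma(r) of each cube Q_r(x); averaging
   |u(x)|^2 <= 2 |u(x+z) - u(x)|^2 + 2 |u(x+z)|^2 over the x + z in that set, and
   bounding translation differences by the gradient, gives
     \int_far |u|^2 <= C r^2/gamma(r) |grad u|^2 + 2/(gamma(r) s) \int V |u|^2,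
   and s can be taken as large as needed.  On the remaining bounded region the
   Poincare inequality on small cells leaves only the cell means, which are the
   functionals phi_k.

   Completeness of the form domain and the Riesz representation theorem then
   yield the Fredholm alternative for H - l: either l is in the resolvent set or
   it is an eigenvalue of finite multiplicity.  Evaluating the estimate on a
   linear combination of eigenvectors killed by all phi_k shows that there are
   only finitely many eigenvalues below any bound.  Complex L2 is treated as a
   real space with an isometry J = multiplication by i. *)
Require Import Defs.
From HB Require Import structures.
From mathcomp Require Import all_boot all_order all_algebra.
From mathcomp Require Import complex.
From mathcomp Require Import all_classical all_reals all_analysis.
From mathcomp Require Import measurable_realfun.
From mathcomp Require Import ring lra.

Set Implicit Arguments.
Unset Strict Implicit.
Unset Printing Implicit Defensive.

Import Order.TTheory GRing.Theory Num.Theory.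
Import numFieldNormedType.Exports.

Local Open Scope classical_set_scope.
Local Open Scope ring_scope.

(** * Bilinear forms on a real vector space *)

(** Square integrable functions are handled as representatives, not as classes, so the forms are
    only semidefinite on them. The abstract part therefore works in a bare real vector space:
    completeness is assumed for sequences with fast decaying increments, and equality of vectors is
    replaced by the vanishing of a form on their difference.

    The compactness estimate takes the place of compact operators. Adding the finitely many
    functionals to the form makes it coercive, and the Fredholm alternative becomes linear algebra
    with one finite matrix. A non-real spectral parameter adds a skew term to the real form, which
    is why a representation theorem for non-symmetric forms is needed.

    The gradient bound for translations is obtained by duality, without approximating [u] by smooth
    functions: tested against products of one-variable functions, u(x + t e) - u(x) and the integral
    of the weak derivative along the segment agree, and the fundamental lemma then identifies them
    almost everywhere. *)

Section forms.
Context (R : realType) (D : lmodType R).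
Implicit Types (u v w : D) (F : D -> R) (s : D -> D -> R).

Definition lin_form F := forall (k : R) u v, F (k *: u + v) = k * F u + F v.

Definition sym_form s := (forall u v, s u v = s v u) /\
  forall w, lin_form (s^~ w).

Definition skew_form s := (forall u v, s u v = - s v u) /\
  forall w, lin_form (s^~ w).

Lemma lin_formD F u v : lin_form F -> F (u + v) = F u + F v.
Proof. by move=> lF; have := lF 1 u v; rewrite scale1r mul1r. Qed.

Lemma lin_form0 F : lin_form F -> F 0 = 0.
Proof.
by move=> lF; have := lF 1 0 0; rewrite scaler0 addr0 mul1r => h; lra.
Qed.

Lemma lin_formZ F k u : lin_form F -> F (k *: u) = k * F u.
Proof. by move=> lF; have := lF k u 0; rewrite addr0 lin_form0// addr0. Qed.

Lemma lin_formB F u v : lin_form F -> F (u - v) = F u - F v.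
Proof. by move=> lF; rewrite lin_formD// -scaleN1r lin_formZ// mulN1r. Qed.

Lemma lin_form_sum F n (c : 'I_n -> R) (z : 'I_n -> D) : lin_form F ->
  F (\sum_i c i *: z i) = \sum_i c i * F (z i).
Proof.
move=> lF; elim/big_ind2 : _ => [|x1 x2 y1 y2 <- <-|i _].
- exact: lin_form0.
- exact: lin_formD.
- exact: lin_formZ.
Qed.

Lemma sym_form_lin s u : sym_form s -> lin_form (s u).
Proof. by move=> [sC sl] k v w; rewrite !(sC u) sl. Qed.

Lemma skew_form_lin s u : skew_form s -> lin_form (s u).
Proof. by move=> [sC sl] k v w; rewrite !(sC u) sl; ring. Qed.

Lemma skew_form_diag s u : skew_form s -> s u u = 0.
Proof. by move=> [sC _]; have := sC u u; lra. Qed.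

Lemma sym_form_expand s u v k : sym_form s ->
  s (k *: v + u) (k *: v + u) = s u u + 2 * k * s u v + k ^+ 2 * s v v.
Proof.
move=> ss; have [sC sl] := ss.
rewrite sl !(sym_form_lin _ ss) (sC v u); ring.
Qed.

Lemma form_expandD s u v : sym_form s ->
  s (u + v) (u + v) = s u u + 2 * s u v + s v v.
Proof.
move=> ss; rewrite -[X in s (_ + X) (_ + X)]scale1r addrC sym_form_expand//; ring.
Qed.

Lemma form_expandB s u v : sym_form s ->
  s (u - v) (u - v) = s u u - 2 * s u v + s v v.
Proof.
move=> ss; rewrite -[X in s (_ + X) (_ + X)]scaleN1r addrC sym_form_expand//; ring.
Qed.

(** The core of every Cauchy-Schwarz inequality below, and of the approximate Euler equation in
    [riesz]. The minimiser [- b / c] gives the claim; for [c = 0] an affine function bounded below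
    has slope 0. *)
Lemma quadratic_ge0_disc (a b c : R) : 0 <= c ->
  (forall k, 0 <= a + 2 * k * b + k ^+ 2 * c) -> b ^+ 2 <= a * c.
Proof.
rewrite le_eqVlt => /predU1P[<- h|c0 h].
  have [->|b0] := eqVneq b 0; first by rewrite expr0n mulr0.
  have := h (- (a + 1) / (2 * b)).
  have -> : a + 2 * (- (a + 1) / (2 * b)) * b + (- (a + 1) / (2 * b)) ^+ 2 * 0
    = - 1 by field.
  by rewrite oppr_ge0 ler10.
have := h (- b / c).
have -> : a + 2 * (- b / c) * b + (- b / c) ^+ 2 * c = (a * c - b ^+ 2) / c.
  by field; rewrite gt_eqF.
by rewrite pmulr_lge0 ?invr_gt0// subr_ge0.
Qed.

Lemma form_CS s u v : sym_form s -> (forall w, 0 <= s w w) ->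
  s u v ^+ 2 <= s u u * s v v.
Proof.
move=> ss s0; apply: quadratic_ge0_disc => // k.
by rewrite -sym_form_expand.
Qed.

Lemma form_leD s u v : sym_form s -> (forall w, 0 <= s w w) ->
  s (u + v) (u + v) <= 2 * s u u + 2 * s v v.
Proof.
move=> ss s0; have := s0 (u - v).
rewrite form_expandB// form_expandD//; lra.
Qed.

(** Iterated [form_leD]. The crude factor is harmless: it only enters the bound on the inverse in
    [finite_rank_alternative]. *)
Lemma form_le_sum s n (y : 'I_n -> D) : sym_form s -> (forall w, 0 <= s w w) ->
  s (\sum_i y i) (\sum_i y i) <= 2 ^+ n * \sum_i s (y i) (y i).
Proof.
move=> ss s0; elim: n y => [|n IH] y.
  by rewrite !big_ord0 mulr0 (lin_form0 (sym_form_lin _ ss)).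
rewrite !big_ord_recl (le_trans (form_leD _ _ ss s0))// mulrDr lerD//.
  by rewrite ler_wpM2r// exprS ler_peMr// exprn_ege1// ler1n.
by rewrite exprS -mulrA ler_wpM2l.
Qed.

End forms.

(** * Riesz representation, with skew and finite-rank perturbations *)

Section riesz.
Context (R : realType) (D : lmodType R).
Variable n1 : D -> R.

(* [n1] is the square of a norm. *)
Definition fast_complete := forall u : nat -> D,
  (forall n, n1 (u n.+1 - u n) <= 8^-1 ^+ n) ->
  exists v, forall e, 0 < e ->
    exists N, forall n, (N <= n)%N -> n1 (u n - v) <= e.

Hypothesis n1_complete : fast_complete.
Hypothesis n1_ge0 : forall u, 0 <= n1 u.

Section one_form.
Variables (s : D -> D -> R) (c M : R).
Hypotheses (c0 : 0 < c) (M0 : 0 < M) (ss : sym_form s).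
Hypothesis s_ge : forall u, c * n1 u <= s u u.
Hypothesis s_le : forall u, s u u <= M * n1 u.

Lemma coercive_ge0 u : 0 <= s u u.
Proof. by apply: le_trans (s_ge u); rewrite mulr_ge0// ltW. Qed.
Let s0 := coercive_ge0.

(** Direct method: [J] is bounded below by [- B], convexity makes a fast minimising sequence Cauchy,
    and its limit satisfies the Euler equation. As [s] is only compared with [n1], one completeness
    hypothesis serves several forms. *)
Lemma riesz (F : D -> R) (B : R) : lin_form F -> 0 <= B ->
  (forall v, F v ^+ 2 <= B * s v v) -> exists u, forall v, s u v = F v.
Proof.
move=> lF B0 FB.
pose J v := s v v - 2 * F v.
have JB v : - B <= J v.
  rewrite /J; have := FB v; have := s0 v => h1 h2.
  have h3 : (2 * F v) ^+ 2 <= (B + s v v) ^+ 2.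
    by have := sqr_ge0 (B - s v v); nra.
  suff : 2 * F v <= B + s v v by lra.
  by rewrite leNgt; apply/negP => h4; nra.
have Jinf : has_inf (range J).
  split; first by exists (J 0), 0.
  by exists (- B) => _ [v _ <-].
pose m := inf (range J).
have Jm v : m <= J v by apply: ge_inf; [exists (- B) => _ [w _ <-]|exists v].
(* Chosen so that [4 * delta n] is [c * 8^-1 ^+ n], which after division by the coercivity constant
   is the decay required by [fast_complete]. *)
pose delta n : R := c / 4 * 8^-1 ^+ n.
have delta0 n : 0 < delta n by rewrite /delta mulr_gt0 ?divr_gt0 ?exprn_gt0 ?invr_gt0.
have /choice[u uJ] n : exists v, J v < m + delta n.
  by have [_ [v _ <-]] := inf_adherent (delta0 n) Jinf; exists v.
have JD w v k : J (k *: v + w) = J w + 2 * k * (s w v - F v) + k ^+ 2 * s v v.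
  by rewrite /J sym_form_expand// lF; ring.
have [v0 v0u] : exists v, forall e, 0 < e ->
    exists N, forall n, (N <= n)%N -> n1 (u n - v) <= e.
  apply: n1_complete => n.
  (* At the midpoint of [u n] and [u n.+1], [J] is the mean of its two values minus a quarter of the
     square of the increment, and it is still at least [m]. *)
  have := JD (u n) (u n.+1 - u n) (2^-1); have := JD (u n) (u n.+1 - u n) 1.
  rewrite scale1r subrK => h1 h2.
  have := Jm (2^-1 *: (u n.+1 - u n) + u n).
  have := uJ n; have := uJ n.+1 => h3 h4 h5.
  have d8 : delta n.+1 = delta n / 8 by rewrite /delta exprS; field.
  have h6 : s (u n.+1 - u n) (u n.+1 - u n) <= 4 * delta n.
    rewrite h2 in h5; rewrite h1 d8 in h3; have := delta0 n; nra.
  have := le_trans (s_ge (u n.+1 - u n)) h6.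
  rewrite /delta (_ : 4 * _ = c * 8^-1 ^+ n); last by field.
  by rewrite ler_pM2l.
(* Approximate Euler equation: moving from [u n] along [v] cannot lower [J] by more than [delta n],
   so a quadratic polynomial in [k] is nonnegative. *)
have eB n v : (s (u n) v - F v) ^+ 2 <= delta n * s v v.
  apply: quadratic_ge0_disc => // k.
  by have := Jm (k *: v + u n); have := uJ n; rewrite JD; lra.
exists v0 => v; apply/eqP; rewrite -subr_eq0 -sqrf_eq0 eq_le sqr_ge0 andbT.
apply/ler_addgt0Pr => e e0; rewrite add0r.
have sv := s0 v.
(* The error splits into the defect of [u n] in the Euler equation and [s (u n - v0) v]. Their
   squares are at most q s(v,v) and M q s(v,v); this factor makes twice the sum at most [e]. *)
have K0 : 0 < 2 * (1 + M) * (1 + s v v).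
  by rewrite !mulr_gt0 ?ltr_wpDr ?(ltW M0).
have [N1 N1P] := v0u _ (divr_gt0 e0 K0).
have [N2 N2P] : exists N, forall n, (N <= n)%N ->
    delta n <= e / (2 * (1 + M) * (1 + s v v)).
  have : delta @ \oo --> 0.
    rewrite /delta -(mulr0 (c / 4)); apply: cvgMr; apply: cvg_expr.
    by rewrite ger0_norm ?invr_ge0// invf_lt1 ?ltr1n.
  move=> /cvgrPdist_le /(_ _ (divr_gt0 e0 K0))[N _ NP].
  exists N => n /NP; rewrite sub0r normrN ger0_norm//; exact: ltW.
pose n := maxn N1 N2.
have := N1P n (leq_maxl _ _); have := N2P n (leq_maxr _ _).
set q := e / _ => h1 h2.
have qK : 2 * (1 + M) * (1 + s v v) * q = e.
  by rewrite /q mulrC divfK// gt_eqF.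
have q0 : 0 < q by rewrite divr_gt0.
have -> : s v0 v - F v = (s (u n) v - F v) - s (u n - v0) v.
  by rewrite (lin_formB _ _ (ss.2 v)); ring.
have h3 := form_CS (u n - v0) v ss s0.
have h4 := eB n v.
have h5 : s (u n - v0) (u n - v0) <= M * q.
  by apply: le_trans (s_le _) _; rewrite ler_pM2l.
have h6 : delta n * s v v <= q * s v v by rewrite ler_wpM2r.
have h7 : s (u n - v0) (u n - v0) * s v v <= M * q * s v v by rewrite ler_wpM2r.
have := sqr_ge0 ((s (u n) v - F v) + s (u n - v0) v).
have : 0 <= s v v * q by rewrite mulr_ge0// ltW.
have : 0 <= M * q by rewrite mulr_ge0// ltW.
nra.
Qed.

End one_form.

Section skew_perturbation.
Variables (s w : D -> D -> R) (c M W : R).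
Hypotheses (c0 : 0 < c) (M0 : 0 < M) (W0 : 0 <= W).
Hypotheses (ss : sym_form s) (sw : skew_form w).
Hypothesis s_ge : forall u, c * n1 u <= s u u.
Hypothesis s_le : forall u, s u u <= M * n1 u.
Hypothesis w_le : forall u v, w u v ^+ 2 <= W * s u u * s v v.
Let s0 := coercive_ge0 c0 s_ge.

(* [s - w] is not symmetric; with [S] the (skew) operator representing [w],
   [1 - S] has inverse [(1 + S) (1 - S^2)^-1], and [1 - S^2] is symmetric and
   coercive again. *)
Lemma riesz_skew (F : D -> R) (B : R) : lin_form F -> 0 <= B ->
  (forall v, F v ^+ 2 <= B * s v v) -> exists u, forall v, s u v - w u v = F v.
Proof.
move=> lF B0 FB.
have /choice[S SP] u : exists v, forall x, s v x = w u x.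
  apply: (riesz c0 M0 ss s_ge s_le (skew_form_lin _ sw) (mulr_ge0 W0 (s0 u))).
  by move=> v; exact: w_le.
have SS u : s (S u) (S u) <= W * s u u.
  have := w_le u (S u); rewrite -SP expr2.
  have := s0 (S u); rewrite le_eqVlt => /predU1P[<- _|h1].
    by rewrite mulr_ge0.
  by rewrite ler_pM2r.
(* By skewness [s (S u) (S v)] equals [- s (S (S u)) v], so this is the form of 1 - S^2. *)
pose s' u v := s u v + s (S u) (S v).
have SD k u v x : s (S (k *: u + v)) x = k * s (S u) x + s (S v) x.
  by rewrite !SP sw.2.
have ss' : sym_form s'.
  split=> [u v|x k u v]; first by rewrite /s' ss.1 (ss.1 (S u)).
  by rewrite /s' ss.2 SD; ring.
have M'0 : 0 < M * (1 + W) by rewrite mulr_gt0// ltr_pwDl.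
have [x xP] : exists u, forall v, s' u v = F v.
  apply: (riesz c0 M'0 ss' _ _ lF B0) => v; rewrite /s'.
  - by have := s_ge v; have := s0 (S v); lra.
  - have h : W * s v v <= W * (M * n1 v) by rewrite ler_wpM2l.
    by have := s_le v; have := SS v; lra.
  - have : 0 <= B * s (S v) (S v) by rewrite mulr_ge0.
    by have := FB v; lra.
exists (x + S x) => v.
have h : s (S x) (S v) = - w (S x) v by rewrite ss.1 SP (sw.1 (S x)) opprK.
rewrite (lin_formD _ _ (ss.2 v)) (lin_formD _ _ (sw.2 v)) SP -xP /s' h; ring.
Qed.

Section finite_rank.
Variables (n : nat) (phi : 'I_n -> D -> R) (C : R).
Hypotheses (phi_lin : forall k, lin_form (phi k)) (C0 : 0 <= C).
Hypothesis phi_le : forall k u, phi k u ^+ 2 <= C * s u u.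

Let t u v := s u v - w u v.
Let A u v := t u v - \sum_k phi k u * phi k v.

Let t_lin v : lin_form (t^~ v).
Proof. by move=> k x y; rewrite /t ss.2 sw.2; ring. Qed.

Let tt u : t u u = s u u.
Proof. by rewrite /t (skew_form_diag u sw) subr0. Qed.

(** Let [z k] represent [phi k] with respect to the invertible form [t]. A solution of A u = F is u
    = x + sum of q_k z_k, where x solves the equation for [t] and q_k = phi_k(u). Applying the
    [phi i] leaves q P = (phi_k(x))_k with P the identity minus the matrix of the phi_i(z_k). So the
    left kernel of P describes the kernel of A, and an invertible P gives bounded solvability. The
    kernel is described only up to vectors on which [s] vanishes. *)
Lemma finite_rank_alternative : exists (P : 'M[R]_n) (z : 'I_n -> D),
  (forall q : 'rV_n, q *m P = 0 -> let u := \sum_k q ord0 k *: z k in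
     (forall k, phi k u = q ord0 k) /\ (forall v, A u v = 0)) /\
  (forall u, (forall v, A u v = 0) -> let q := \row_k phi k u in
     q *m P = 0 /\
     s (u - \sum_k q ord0 k *: z k) (u - \sum_k q ord0 k *: z k) = 0) /\
  (P \in unitmx -> exists2 K, 0 <= K & forall (F : D -> R) (B : R),
     lin_form F -> 0 <= B -> (forall v, F v ^+ 2 <= B * s v v) ->
     exists u, (forall v, A u v = F v) /\ s u u <= K * B).
Proof.
have /choice[z zP] k : exists u, forall v, t u v = phi k v.
  exact: (riesz_skew (phi_lin k) C0 (phi_le k)).
pose Mx : 'M[R]_n := \matrix_(k, i) phi i (z k).
have cM (q : 'rV_n) i : (q *m (1%:M - Mx)) ord0 i =
    q ord0 i - phi i (\sum_k q ord0 k *: z k).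
  rewrite mulmxBr mulmx1 !mxE (lin_form_sum _ _ (phi_lin i)).
  by congr (_ - _); apply: eq_bigr => k _; rewrite mxE.
have AE (q : 'rV_n) v : t (\sum_k q ord0 k *: z k) v = \sum_k q ord0 k * phi k v.
  rewrite (lin_form_sum _ _ (t_lin v)).
  by apply: eq_bigr => k _; rewrite zP.
exists (1%:M - Mx), z; split; [|split].
- move=> q cP u.
  have uE k : phi k u = q ord0 k.
    have := cM q k; rewrite cP mxE => /esym/eqP; rewrite subr_eq0.
    by move=> /eqP ->.
  split=> // v; rewrite /A AE; apply/eqP; rewrite subr_eq0; apply/eqP.
  by apply: eq_bigr => k _; rewrite uE.
- move=> u Au q.
  have h : s (u - \sum_k q ord0 k *: z k) (u - \sum_k q ord0 k *: z k) = 0.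
    rewrite -tt; set x := (X in t _ X) ; rewrite (lin_formB _ _ (t_lin x)) AE.
    have := Au x; rewrite /A => /eqP; rewrite subr_eq0 => /eqP ->.
    apply/eqP; rewrite subr_eq0; apply/eqP; apply: eq_bigr => k _.
    by rewrite /q mxE.
  split=> //; apply/rowP => i; rewrite cM [in RHS]mxE /q mxE -lin_formB//.
  apply/eqP; rewrite -sqrf_eq0 eq_le sqr_ge0 andbT.
  by have := phi_le i (u - \sum_k q ord0 k *: z k); rewrite h mulr0 /q.
- move=> Pu; pose N := invmx (1%:M - Mx).
  (* [L k * B] will bound the square of the k-th coordinate of the solution of the linear system,
     whose right-hand side has coordinates with squares at most [C * B]. *)
  pose L k := 2 ^+ n * \sum_i C * N i k ^+ 2.
  have L0 k : 0 <= L k.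
    by rewrite mulr_ge0 ?exprn_ge0// sumr_ge0// => i _; rewrite mulr_ge0// sqr_ge0.
  exists (2 + 2 * (2 ^+ n * \sum_k L k * s (z k) (z k))).
    rewrite addr_ge0// !mulr_ge0 ?exprn_ge0// sumr_ge0// => k _.
    by rewrite mulr_ge0.
  move=> F B lF B0 FB.
  have [x xP] := riesz_skew lF B0 FB.
  pose b : 'rV[R]_n := \row_k phi k x; pose q := b *m N.
  have cE : q *m (1%:M - Mx) = b by rewrite /q -mulmxA mulVmx// mulmx1.
  exists (x + \sum_k q ord0 k *: z k); split.
    move=> v; rewrite /A (lin_formD _ _ (t_lin v)) AE {1}/t xP.
    have -> : \sum_k phi k (x + \sum_k0 q ord0 k0 *: z k0) * phi k v =
              \sum_k q ord0 k * phi k v.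
      apply: eq_bigr => k _; congr (_ * _); rewrite lin_formD//.
      have := cM q k; rewrite cE /b mxE => ->; ring.
    by rewrite addrK.
  have xB : s x x <= B.
    have := FB x; rewrite -xP (_ : s x x - w x x = s x x); last exact: tt.
    have := s0 x; rewrite le_eqVlt => /predU1P[<- //|h1].
    by rewrite expr2 ler_pM2r.
  have bB k : b ord0 k ^+ 2 <= C * B.
    by rewrite /b mxE (le_trans (phi_le _ _))// ler_wpM2l.
  have cB k : q ord0 k ^+ 2 <= L k * B.
    rewrite /q mxE.
    have mm : sym_form (fun x y : R^o => x * y : R).
      by split=> [y1 y2|y1 k1 y2 y3]; [rewrite mulrC|rewrite mulrDl -mulrA].
    have mm0 (y : R^o) : 0 <= (y * y : R) by rewrite -expr2 sqr_ge0.
    have := form_le_sum (fun i => b ord0 i * N i k : R^o) mm mm0.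
    rewrite -expr2 => /le_trans; apply.
    rewrite /L -mulrA ler_wpM2l ?exprn_ge0// mulr_suml ler_sum// => i _.
    have := ler_wpM2r (sqr_ge0 (N i k)) (bB i); rewrite -exprMn expr2 => h.
    by apply: (le_trans h); rewrite le_eqVlt; apply/orP; left; apply/eqP; ring.
  have h1 := form_leD x (\sum_k q ord0 k *: z k) ss s0.
  have h2 := form_le_sum (fun k => q ord0 k *: z k) ss s0.
  have h3 : \sum_k s (q ord0 k *: z k) (q ord0 k *: z k) <=
      (\sum_k L k * s (z k) (z k)) * B.
    rewrite mulr_suml ler_sum// => k _.
    rewrite (lin_formZ _ _ (ss.2 _)) (lin_formZ _ _ (sym_form_lin _ ss)) mulrA.
    by rewrite -expr2 -mulrA (mulrC (s _ _)) mulrA ler_wpM2r.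
  have h4 : 2 ^+ n * \sum_k s (q ord0 k *: z k) (q ord0 k *: z k) <=
     2 ^+ n * ((\sum_k L k * s (z k) (z k)) * B) by rewrite ler_wpM2l// exprn_ge0.
  nra.
Qed.

End finite_rank.
End skew_perturbation.
End riesz.

(** * Fredholm alternative *)

(* For large [K], [a - l b + K \sum_k phi_k^2] is coercive, so that inverting
   the pencil reduces to a linear system in the finitely many unknowns
   [phi_k u]. *)
Section compact_form.
Context (R : realType) (D : lmodType R).
Variables (a b : D -> D -> R) (J : D -> D).
Hypotheses (sa : sym_form a) (sb : sym_form b).
Hypotheses (a0 : forall u, 0 <= a u u) (b0 : forall u, 0 <= b u u).
Hypothesis J_lin : forall k u v, J (k *: u + v) = k *: J u + J v.
Hypothesis J_isom : forall u, b (J u) (J u) = b u u.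
Hypothesis J_skewb : forall u v, b (J u) v = - b (J v) u.
Hypothesis J_skewa : forall u v, a (J u) v = - a (J v) u.
Hypothesis ab_complete : fast_complete (fun u => a u u + b u u).
Hypothesis compact_ab : forall e : R, 0 < e ->
  exists (n : nat) (phi : 'I_n -> D -> R),
    [/\ forall k, lin_form (phi k),
        exists2 C, 0 <= C & forall k u, phi k u ^+ 2 <= C * b u u &
        forall u, b u u <= e * a u u + \sum_k phi k u ^+ 2].

(* [J] is multiplication by the imaginary unit and [a], [b] are the real parts
   of sesquilinear forms, so this is the real part of
   [a u v - (l + i m) b u v]. *)
Definition pencil (l m : R) u v := a u v - (l * b u v + m * b (J u) v).

Definition eigvec (l m : R) u := forall v, pencil l m u v = 0.

(** Test the equation with [J u]: both forms vanish on the pair [J u], [u] by skewness, and only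
    [m * b (J u) (J u)] is left. *)
Lemma eigvec_real l m u : eigvec l m u -> b u u != 0 -> m = 0.
Proof.
move=> /(_ (J u)); rewrite /pencil (sb.1 u) J_isom (sa.1 u).
have := J_skewa u u; have := J_skewb u u.
move=> h1 h2; have -> : a (J u) u = 0 by lra.
have -> : b (J u) u = 0 by lra.
rewrite mulr0 !add0r => /eqP + bu.
by rewrite oppr_eq0 mulf_eq0 (negbTE bu) orbF => /eqP.
Qed.

Lemma eigvec_orth l m u v : eigvec l 0 u -> eigvec m 0 v -> l != m -> b u v = 0.
Proof.
move=> /(_ v) + /(_ u); rewrite /pencil (sa.1 v) (sb.1 v) => h1 h2 lm.
have /eqP : (l - m) * b u v = 0 by lra.
by rewrite mulf_eq0 subr_eq0 (negbTE lm) => /eqP.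
Qed.

Lemma fredholm l m :
  (exists (n : nat) (e : 'I_n -> D), (forall k, eigvec l m (e k)) /\
     forall u, eigvec l m u -> exists c : 'I_n -> R,
       b (u - \sum_k c k *: e k) (u - \sum_k c k *: e k) = 0) /\
  ((exists u, eigvec l m u /\ b u u != 0) \/
   exists2 K, 0 <= K & forall (F : D -> R) (B : R), lin_form F -> 0 <= B ->
     (forall v, F v ^+ 2 <= B * b v v) ->
     exists u, (forall v, pencil l m u v = F v) /\ b u u <= K * B).
Proof.
(* The compactness estimate with e = 1 / (2 La), multiplied by [La], bounds La b(u,u) by half of
   a(u,u) plus La times the sum of squares. Hence [s] below dominates half of [a] plus [b], the 1 in
   [La] paying for [b]. The factor [La] is absorbed in [psi]. *)
pose La := `|l| + 1; have La0 : 0 < La by rewrite ltr_pwDr.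
have e0 : 0 < (2 * La)^-1 by rewrite invr_gt0 mulr_gt0.
have [n [phi [phil [C C0 phiC] bphi]]] := compact_ab e0.
pose psi k u := Num.sqrt La * phi k u.
have psiE k u v : psi k u * psi k v = La * (phi k u * phi k v).
  rewrite /psi mulrACA -expr2 sqr_sqrtr//; exact: ltW.
pose s u v := a u v - l * b u v + \sum_k psi k u * psi k v.
pose w u v := m * b (J u) v.
have psil k : lin_form (psi k).
  by move=> x u v; rewrite /psi phil; ring.
have ss : sym_form s.
  split=> [u v|v k x y].
    rewrite /s (sa.1 u) (sb.1 u); congr (_ + _).
    by apply: eq_bigr => k _; rewrite mulrC.
  rewrite /s sa.2 sb.2.
  have -> : \sum_i psi i (k *: x + y) * psi i v =
      k * (\sum_i psi i x * psi i v) + \sum_i psi i y * psi i v.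
    rewrite mulr_sumr -big_split/=; apply: eq_bigr => i _.
    by rewrite psil; ring.
  by ring.
have sw : skew_form w.
  split=> [u v|v k x y]; first by rewrite /w J_skewb; ring.
  by rewrite /w J_lin sb.2; ring.
have sE u : s u u = a u u - l * b u u + La * \sum_k phi k u ^+ 2.
  rewrite /s mulr_sumr; congr (_ + _); apply: eq_bigr => k _.
  by rewrite psiE expr2.
have s_geb u : 2^-1 * a u u + b u u <= s u u.
  have h : La * b u u <= 2^-1 * a u u + La * \sum_k phi k u ^+ 2.
    have := bphi u; rewrite -(ler_pM2l La0) mulrDr.
    rewrite (_ : La * ((2 * La)^-1 * a u u) = 2^-1 * a u u)//.
    by field; rewrite gt_eqF.
  have h2 : l * b u u <= `|l| * b u u by rewrite ler_wpM2r// ler_norm.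
  by rewrite sE; rewrite {1}/La in h; lra.
have s_ge u : 2^-1 * (a u u + b u u) <= s u u.
  by have := s_geb u; have := b0 u; lra.
have s0 u : 0 <= s u u by have := s_geb u; have := b0 u; have := a0 u; lra.
have psi_le k u : psi k u ^+ 2 <= La * C * b u u.
  by rewrite expr2 psiE -expr2 -mulrA ler_pM2l.
have M0 : 0 < 1 + `|l| + La * (n%:R * C).
  by rewrite ltr_pwDl ?ltr_pwDl// !mulr_ge0// ltW.
have s_le u : s u u <= (1 + `|l| + La * (n%:R * C)) * (a u u + b u u).
  have h : \sum_k phi k u ^+ 2 <= n%:R * C * b u u.
    rewrite -mulrA -[n in X in _ <= X]card_ord -sumr_const mulr_suml.
    by apply: ler_sum => k _; rewrite mul1r.
  have h1 : La * \sum_k phi k u ^+ 2 <= La * (n%:R * C * b u u).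
    by rewrite ler_pM2l.
  have h2 : - l * b u u <= `|l| * b u u by rewrite ler_wpM2r// ler_normr lexx orbT.
  have h3 : 0 <= `|l| * a u u by rewrite mulr_ge0.
  have h4 : 0 <= La * (n%:R * C) * a u u by rewrite !mulr_ge0// ltW.
  by have := a0 u; have := b0 u; rewrite sE; lra.
have w_le u v : w u v ^+ 2 <= m ^+ 2 * s u u * s v v.
  rewrite /w exprMn -mulrA ler_wpM2l ?sqr_ge0//.
  rewrite (le_trans (form_CS _ _ sb b0))// J_isom ler_pM//.
  - by have := s_geb u; have := a0 u; lra.
  - by have := s_geb v; have := a0 v; lra.
have AE u v : s u v - w u v - \sum_k psi k u * psi k v = pencil l m u v.
  by rewrite /s /w /pencil; ring.
have ab0 u : 0 <= a u u + b u u by rewrite addr_ge0.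
have i20 : 0 < 2^-1 :> R by rewrite invr_gt0.
have b_s u : s u u = 0 -> b u u = 0.
  by have := s_geb u; have := a0 u; have := b0 u => *; lra.
have LaC : 0 <= La * C by rewrite mulr_ge0// ltW.
have psi_s k u : psi k u ^+ 2 <= La * C * s u u.
  rewrite (le_trans (psi_le _ _))// ler_wpM2l//.
  by have := s_geb u; have := a0 u; lra.
have [P [z [kerP [eigP unitP]]]] := @finite_rank_alternative _ _ _ ab_complete
  ab0 s w _ _ _ i20 M0 (sqr_ge0 m) ss sw s_ge s_le w_le n psi _ psil LaC psi_s.
split.
  (* The rows of [kermx P] span the left kernel of [P], so these vectors span the eigenspace. They
     need not be independent. *)
  exists n, (fun j => \sum_k (kermx P) j k *: z k); split.
    move=> j v; rewrite -AE.
    have rP : row j (kermx P) *m P = 0 by rewrite -row_mul mulmx_ker row0.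
    have [_] := kerP _ rP.
    by under eq_bigr do rewrite mxE; move/(_ v).
  move=> u eu; have [|rP us] := eigP u; first by move=> v; rewrite AE.
  have /submxP[d dE] : (\row_k psi k u <= kermx P)%MS by apply/sub_kermxP.
  exists (fun j => d ord0 j); apply: b_s; rewrite -[RHS]us.
  suff -> : \sum_k d ord0 k *: (\sum_k0 kermx P k k0 *: z k0) =
     \sum_k (\row_k0 psi k0 u) ord0 k *: z k by [].
  under eq_bigr do rewrite scaler_sumr.
  rewrite exchange_big/=; apply: eq_bigr => k _; rewrite dE mxE scaler_suml.
  by apply: eq_bigr => j _; rewrite scalerA.
have [ex|nex] := pselect (exists u, eigvec l m u /\ b u u != 0); first by left.
(* A left kernel vector of [P] gives an eigenvector [u], so [b u u = 0] by assumption. Then every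
   [psi k] vanishes at [u], and these values are the coordinates of the kernel vector. *)
right; have /unitP[K K0 KP] : P \in unitmx.
  rewrite -row_free_unit -kermx_eq0; apply/eqP/row_matrixP => j.
  have rP : row j (kermx P) *m P = 0 by rewrite -row_mul mulmx_ker row0.
  have [uE uA] := kerP _ rP.
  set u := \sum_k _ in uE uA.
  have [bu|bu] := eqVneq (b u u) 0; last first.
    by exfalso; apply: nex; exists u; split=> // v; rewrite -AE.
  rewrite row0; apply/rowP => k; rewrite -uE [RHS]mxE; apply/eqP.
  by rewrite -sqrf_eq0 eq_le sqr_ge0 andbT (le_trans (psi_le _ _))// bu mulr0.
exists K => // F B lF B0 FB.
have [v|u [uF uK]] := KP F B lF B0.
  rewrite (le_trans (FB v))// ler_wpM2l//.
  by have := s_geb v; have := a0 v; lra.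
exists u; split=> [v|]; first by rewrite -AE uF.
by apply: le_trans uK; have := s_geb u; have := a0 u; lra.
Qed.

(* On a span of more eigenvectors than there are functionals [phi_k], some
   nonzero [u] kills all of them, whence [b u u <= e * a u u] with
   [a u u <= La * b u u]. *)
Lemma eigenvalues_locally_finite (La : R) : exists N : nat,
  forall (n : nat) (l : 'I_n -> R) (v : 'I_n -> D), injective l ->
    (forall i, [/\ eigvec (l i) 0 (v i), b (v i) (v i) != 0 & l i <= La]) ->
    (n <= N)%N.
Proof.
(* With e = 1 / La' the estimate will read La' b(u,u) <= a(u,u) <= |La| b(u,u), which the added 1
   makes incompatible with b(u,u) > 0. *)
pose La' := `|La| + 1; have La0 : 0 < La' by rewrite ltr_pwDr.
have e0 : 0 < La'^-1 by rewrite invr_gt0.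
have [N [phi [phil _ bphi]]] := compact_ab e0.
exists N => n l v linj lv; rewrite leqNgt; apply/negP => Nn.
pose Q : 'M[R]_(n, N) := \matrix_(i, k) phi k (v i).
have : kermx Q != 0.
  rewrite kermx_eq0 /row_free; apply/eqP => rQ.
  by have := rank_leq_col Q; rewrite rQ leqNgt Nn.
move=> /rowV0Pn[c /sub_kermxP cQ c0].
pose u := \sum_i c ord0 i *: v i.
have phiu k : phi k u = 0.
  rewrite /u (lin_form_sum _ _ (phil k)).
  have := congr1 (fun M : 'rV_N => M ord0 k) cQ; rewrite !mxE => h; rewrite -[RHS]h.
  by apply: eq_bigr => i _; rewrite mxE.
have bij i j : b (v i) (v j) = (i == j)%:R * b (v i) (v i).
  have [<-|ij] := eqVneq i j; first by rewrite mul1r.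
  rewrite mul0r; have [ei _ _] := lv i; have [ej _ _] := lv j.
  by apply: eigvec_orth ei ej _; apply: contra ij => /eqP /linj ->.
have buv j : b u (v j) = c ord0 j * b (v j) (v j).
  rewrite /u (lin_form_sum _ _ (sb.2 _)) (bigD1 j)//= big1 ?addr0// => i ij.
  by rewrite bij (negbTE ij) mul0r mulr0.
have buu : b u u = \sum_i c ord0 i ^+ 2 * b (v i) (v i).
  rewrite {2}/u (lin_form_sum _ _ (sym_form_lin _ sb)).
  by apply: eq_bigr => i _; rewrite buv mulrA expr2.
have auu : a u u = \sum_i c ord0 i ^+ 2 * (l i * b (v i) (v i)).
  rewrite {2}/u (lin_form_sum _ _ (sym_form_lin _ sa)); apply: eq_bigr => i _.
  rewrite sa.1; have [/(_ u) + _ _] := lv i.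
  rewrite /pencil mul0r addr0 => /eqP; rewrite subr_eq0 => /eqP ->.
  by rewrite sb.1 buv; ring.
have ab_le : a u u <= `|La| * b u u.
  rewrite auu buu mulr_sumr; apply: ler_sum => i _.
  have [_ _ li] := lv i.
  rewrite [leRHS]mulrCA ler_wpM2l ?sqr_ge0// ler_wpM2r//.
  by rewrite (le_trans li)// ler_norm.
have bu : 0 < b u u.
  have [i ci] : exists i, c ord0 i != 0.
    apply/existsP; rewrite -negb_forall; apply: contra c0 => /forallP h.
    by apply/eqP/rowP => i; rewrite mxE; apply/eqP.
  rewrite buu (bigD1 i)//= ltr_pwDl//.
    have [_ bi _] := lv i.
    by rewrite mulr_gt0 ?exprn_even_gt0//= lt_def bi b0.
  by rewrite sumr_ge0// => j _; rewrite mulr_ge0 ?sqr_ge0.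
have := bphi u; rewrite big1 => [|k _]; last by rewrite phiu expr0n.
rewrite addr0 -(ler_pM2l La0) mulrA divff ?gt_eqF// mul1r.
by rewrite /La'; nra.
Qed.

End compact_form.

(** * Square integrable functions *)

Section square_integrable.
Context d (T : measurableType d) (R : realType).
Variable mu : {measure set T -> \bar R}.
Implicit Types (f g h : T -> R) (k : R).

Definition sqint f :=
  measurable_fun setT f /\ (\int[mu]_x (f x ^+ 2)%:E < +oo)%E.

Definition dot f g : R := \int[mu]_x (f x * g x).

Lemma measurable_sqrE f : measurable_fun setT f ->
  measurable_fun setT (fun x => (f x ^+ 2)%:E : \bar R).
Proof. by move=> mf; apply/measurable_EFinP; exact: measurable_funX. Qed.

Lemma le_integral_EFin f g : measurable_fun setT f -> measurable_fun setT g ->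
  (forall x, 0 <= f x) -> (forall x, f x <= g x) ->
  (\int[mu]_x (f x)%:E <= \int[mu]_x (g x)%:E)%E.
Proof.
move=> mf mg f0 fg; apply: ge0_le_integral => //.
- by move=> x _; rewrite lee_fin.
- exact/measurable_EFinP.
- exact/measurable_EFinP.
- by move=> x _; rewrite lee_fin.
Qed.

Lemma integral_EFinD f g : measurable_fun setT f -> measurable_fun setT g ->
  (forall x, 0 <= f x) -> (forall x, 0 <= g x) ->
  (\int[mu]_x (f x + g x)%:E = \int[mu]_x (f x)%:E + \int[mu]_x (g x)%:E)%E.
Proof.
move=> mf mg f0 g0; under eq_integral do rewrite EFinD.
apply: ge0_integralD => //.
- by move=> x _; rewrite lee_fin.
- exact/measurable_EFinP.
- by move=> x _; rewrite lee_fin.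
- exact/measurable_EFinP.
Qed.

Lemma integral_EFinZl f k : measurable_fun setT f -> (forall x, 0 <= f x) ->
  0 <= k -> (\int[mu]_x (k * f x)%:E = k%:E * \int[mu]_x (f x)%:E)%E.
Proof.
move=> mf f0 k0; under eq_integral do rewrite EFinM.
apply: ge0_integralZl_EFin => //; last exact/measurable_EFinP.
by move=> x _; rewrite lee_fin.
Qed.

Lemma sqintD_le f g k : measurable_fun setT f -> measurable_fun setT g ->
  (\int[mu]_x ((k * f x + g x) ^+ 2)%:E <=
   (2 * k ^+ 2)%:E * \int[mu]_x (f x ^+ 2)%:E + 2%:E * \int[mu]_x (g x ^+ 2)%:E)%E.
Proof.
move=> mf mg.
have mf2 : measurable_fun setT (fun x => f x ^+ 2) by exact: measurable_funX.
have mg2 : measurable_fun setT (fun x => g x ^+ 2) by exact: measurable_funX.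
have k2 : 0 <= 2 * k ^+ 2 by rewrite mulr_ge0// sqr_ge0.
rewrite -!integral_EFinZl//; try (by move=> x; rewrite sqr_ge0).
rewrite -integral_EFinD//.
- apply: le_integral_EFin => //.
  + apply: measurable_funX; apply: measurable_funD => //; exact: measurable_funM.
  + by apply: measurable_funD; exact: measurable_funM.
  + by move=> x /=; exact: sqr_ge0.
  + move=> x; have := sqr_ge0 (k * f x - g x); nra.
- exact: measurable_funM.
- exact: measurable_funM.
- by move=> x; rewrite mulr_ge0// sqr_ge0.
- by move=> x; rewrite mulr_ge0// sqr_ge0.
Qed.

Lemma sqint_lin f g k : sqint f -> sqint g -> sqint (fun x => k * f x + g x).
Proof.
move=> [mf fo] [mg go]; split.
  by apply: measurable_funD => //; exact: measurable_funM.
apply: le_lt_trans (sqintD_le k mf mg) _.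
apply: lte_add_pinfty; apply: lte_mul_pinfty => //.
by rewrite lee_fin mulr_ge0// sqr_ge0.
Qed.

Lemma sqint0 : sqint (fun=> 0).
Proof.
split; first exact: measurable_cst.
by under eq_integral do rewrite expr0n/=; rewrite integral0.
Qed.

Lemma eq_sqint f g : f =1 g -> sqint f -> sqint g.
Proof. by move=> /funext ->. Qed.

Lemma sqintD f g : sqint f -> sqint g -> sqint (fun x => f x + g x).
Proof.
by move=> sf sg; apply: eq_sqint (sqint_lin 1 sf sg) => x; rewrite mul1r.
Qed.

Lemma sqintZ f k : sqint f -> sqint (fun x => k * f x).
Proof.
by move=> sf; apply: eq_sqint (sqint_lin k sf sqint0) => x; rewrite addr0.
Qed.

Lemma sqintB f g : sqint f -> sqint g -> sqint (fun x => f x - g x).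
Proof.
move=> sf sg; apply: eq_sqint (sqint_lin (-1) sg sf) => x.
by rewrite mulN1r addrC.
Qed.

Lemma sqint_mul f g : sqint f -> sqint g ->
  mu.-integrable setT (EFin \o (fun x => f x * g x)).
Proof.
move=> [mf fo] [mg go]; apply/integrableP; split.
  by apply/measurable_EFinP; exact: measurable_funM.
have mf2 : measurable_fun setT (fun x => f x ^+ 2) by exact: measurable_funX.
have mg2 : measurable_fun setT (fun x => g x ^+ 2) by exact: measurable_funX.
apply: (@le_lt_trans _ _ (\int[mu]_x (f x ^+ 2 + g x ^+ 2)%:E)%E).
  apply: le_integral_EFin => //.
  - apply: measurableT_comp => //; exact: measurable_funM.
  - exact: measurable_funD.
  - move=> x; rewrite ler_norml.
    by have := sqr_ge0 (f x + g x); have := sqr_ge0 (f x - g x) => *; nra.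
rewrite integral_EFinD//; try (by move=> x; rewrite sqr_ge0).
exact: lte_add_pinfty.
Qed.

Lemma sqint_integrable_sqr f : sqint f ->
  mu.-integrable setT (EFin \o (fun x => f x ^+ 2)).
Proof. by move=> sf; under eq_fun do rewrite expr2; exact: sqint_mul. Qed.

Lemma dotC f g : dot f g = dot g f.
Proof. by apply: eq_Rintegral => x _; rewrite mulrC. Qed.

Lemma dot_linl f g h k : sqint f -> sqint g -> sqint h ->
  dot (fun x => k * f x + g x) h = k * dot f h + dot g h.
Proof.
move=> sf sg sh; rewrite /dot -RintegralZl//; last exact: sqint_mul.
rewrite -RintegralD//; last 2 first.
- under eq_fun do rewrite mulrA.
  by apply: sqint_mul => //; exact: sqintZ.
- exact: sqint_mul.
by apply: eq_Rintegral => x _; rewrite mulrDl mulrA.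
Qed.

Lemma dotBl f g h : sqint f -> sqint g -> sqint h ->
  dot (fun x => f x - g x) h = dot f h - dot g h.
Proof.
move=> sf sg sh; rewrite -[RHS]addrC -mulN1r -dot_linl//.
by apply: eq_Rintegral => x _; rewrite mulN1r (addrC (- _)).
Qed.

Lemma dot_sqr f : dot f f = \int[mu]_x (f x ^+ 2).
Proof. by apply: eq_Rintegral => x _; rewrite expr2. Qed.

Lemma dot_ge0 f : 0 <= dot f f.
Proof. by rewrite dot_sqr; apply: Rintegral_ge0 => x _; exact: sqr_ge0. Qed.

Lemma dot_sqrE f : sqint f -> (dot f f)%:E = (\int[mu]_x (f x ^+ 2)%:E)%E.
Proof.
move=> sf; rewrite dot_sqr /Rintegral fineK//.
exact: (integrable_fin_num _ (sqint_integrable_sqr sf)).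
Qed.

Lemma dot_CS f g : sqint f -> sqint g -> dot f g ^+ 2 <= dot f f * dot g g.
Proof.
move=> sf sg; apply: quadratic_ge0_disc => [|k]; first exact: dot_ge0.
pose X x := k * g x + f x; have sX : sqint X by exact: sqint_lin.
have -> : dot f f + 2 * k * dot f g + k ^+ 2 * dot g g = dot X X.
  rewrite {1}/X dot_linl// (dotC g X) (dotC f X) /X !dot_linl// (dotC g f); ring.
exact: dot_ge0.
Qed.

Lemma dot_eq0_ae f : sqint f -> dot f f = 0 -> {ae mu, forall x, f x = 0}.
Proof.
move=> sf f0; have := dot_sqrE sf; rewrite f0 => h.
have := @ae_eq_integral_abs _ _ _ mu _ measurableT _ (measurable_sqrE sf.1).
under eq_integral do rewrite gee0_abs ?lee_fin ?sqr_ge0//.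
rewrite -h => -[/(_ erefl) + _]; apply: filterS => x /(_ I)/= [].
by move=> /eqP; rewrite sqrf_eq0 => /eqP.
Qed.

Lemma sqint_ae f g : measurable_fun setT g -> {ae mu, forall x, f x = g x} ->
  sqint f -> sqint g.
Proof.
move=> mg fg [mf fo]; split=> //.
rewrite -(@ge0_ae_eq_integral _ _ _ mu setT (fun x => (f x ^+ 2)%:E))//.
- exact: measurable_sqrE.
- exact: measurable_sqrE.
- by move=> x _; rewrite lee_fin sqr_ge0.
- by move=> x _; rewrite lee_fin sqr_ge0.
- by apply: filterS fg => x ->.
Qed.

Lemma dot_ae f f' g g' : measurable_fun setT f -> measurable_fun setT f' ->
  measurable_fun setT g -> measurable_fun setT g' ->
  {ae mu, forall x, f x = f' x} -> {ae mu, forall x, g x = g' x} ->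
  dot f g = dot f' g'.
Proof.
move=> mf mf' mg mg' ff' gg'; congr fine; apply: ae_eq_integral => //.
- by apply/measurable_EFinP; exact: measurable_funM.
- by apply/measurable_EFinP; exact: measurable_funM.
- by apply: filterS2 ff' gg' => x -> ->.
Qed.

End square_integrable.

(** * Completeness of L2 *)

Section fast_convergence.
Context (R : realType).

(* Cauchy-Schwarz with the weights [2 ^+ k], summable in the inverse. *)
Lemma fast_increments (y : nat -> R) n m : (n <= m)%N ->
  (y m - y n) ^+ 2 <= (2 * 2^-1 ^+ n - 2 * 2^-1 ^+ m) *
    (\sum_(0 <= k < m) 2 ^+ k * (y k.+1 - y k) ^+ 2 -
     \sum_(0 <= k < n) 2 ^+ k * (y k.+1 - y k) ^+ 2).
Proof.
elim: m => [|m IH].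
  by rewrite leqn0 => /eqP ->; rewrite !subrr expr0n/= mul0r.
rewrite leq_eqVlt => /predU1P[->|].
  by rewrite !subrr expr0n/= mul0r.
rewrite ltnS => nm; rewrite big_nat_recr//= [in leRHS]addrAC.
have := IH nm; set a := 2 * 2^-1 ^+ n - _; set A := \sum_(0 <= k < m) _ - _ => h.
have -> : 2 * 2^-1 ^+ n - 2 * 2^-1 ^+ m.+1 = a + 2^-1 ^+ m :> R.
  by rewrite /a exprS; field.
have p0 : 0 < 2 ^+ m :> R by rewrite exprn_gt0.
have pE : 2^-1 ^+ m = (2 ^+ m)^-1 :> R by rewrite exprVn.
set p := 2 ^+ m in p0 pE *.
have a0 : 0 <= a.
  rewrite /a -mulrBr mulr_ge0// subr_ge0 !exprVn lef_pV2 ?posrE ?exprn_gt0//.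
  by rewrite ler_eXn2l// ltr1n.
have A0 : 0 <= A.
  rewrite /A (big_cat_nat (leq0n n) nm)/= addrAC subrr add0r.
  by rewrite sumr_ge0// => k _; rewrite mulr_ge0 ?sqr_ge0 ?exprn_ge0.
have -> : y m.+1 - y n = (y m - y n) + (y m.+1 - y m) by ring.
set u := y m - y n in h *; set v := y m.+1 - y m.
have q0 : 0 < p^-1 by rewrite invr_gt0.
have pq : p * p^-1 = 1 by rewrite divff// gt_eqF.
rewrite pE; set q := p^-1 in q0 pq *.
have -> : (a + q) * (A + p * v ^+ 2) = a * A + q * A + a * p * v ^+ 2 + v ^+ 2.
  by rewrite -[X in _ = _ + X]mul1r -pq; ring.
(* Arithmetic-geometric mean inequality: the product of the two terms on the right is
   [a * A * v ^+ 2], which is at least (u v)^2 by the induction hypothesis. *)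
suff : 2 * (u * v) <= q * A + a * p * v ^+ 2 by nra.
have h2 : (2 * (u * v)) ^+ 2 <= (q * A + a * p * v ^+ 2) ^+ 2.
  have h3 : u ^+ 2 * v ^+ 2 <= a * A * v ^+ 2 by rewrite ler_wpM2r ?sqr_ge0.
  have h4 := sqr_ge0 (q * A - a * p * v ^+ 2).
  have h5 : q * A * (a * p * v ^+ 2) = a * A * v ^+ 2.
    by rewrite -[RHS]mul1r -pq; ring.
  nra.
have h6 : 0 <= q * A + a * p * v ^+ 2.
  by have := mulr_ge0 (ltW q0) A0; have := mulr_ge0 (mulr_ge0 a0 (ltW p0)) (sqr_ge0 v); lra.
by rewrite leNgt; apply/negP => h7; nra.
Qed.

(** The explicit rate, linear in [S], is what allows integrating the pointwise estimate in
    [sqint_fast_cvg]. *)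
Lemma fast_increments_cvg (y : nat -> R) (S : R) :
  (forall m, \sum_(0 <= k < m) 2 ^+ k * (y k.+1 - y k) ^+ 2 <= S) ->
  cvgn y /\ forall n, (limn y - y n) ^+ 2 <= 2 * 2^-1 ^+ n * S.
Proof.
move=> yS.
have S0 : 0 <= S by have := yS 0%N; rewrite big_geq.
have h n m : (n <= m)%N -> (y m - y n) ^+ 2 <= 2 * 2^-1 ^+ n * S.
  move=> nm; rewrite (le_trans (fast_increments y nm))//.
  have p0 k : 0 <= 2^-1 ^+ k :> R by rewrite exprn_ge0// invr_ge0.
  apply: ler_pM.
  - rewrite -mulrBr mulr_ge0// subr_ge0 !exprVn lef_pV2 ?posrE ?exprn_gt0//.
    by rewrite ler_eXn2l// ltr1n.
  - rewrite (big_cat_nat (leq0n n) nm)/= addrAC subrr add0r.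
    by rewrite sumr_ge0// => k _; rewrite mulr_ge0 ?sqr_ge0 ?exprn_ge0.
  - by have := p0 m; lra.
  - rewrite lerBlDr (le_trans (yS m))// lerDl sumr_ge0// => k _.
    by rewrite mulr_ge0 ?sqr_ge0 ?exprn_ge0.
have cy : cvgn y.
  apply/cauchy_cvgP/cauchy_exP => e e0.
  have e2 : 0 < e ^+ 2 / (2 * (S + 1)) by rewrite divr_gt0 ?exprn_gt0// mulr_gt0// ltr_wpDl.
  have : (fun n => 2^-1 ^+ n : R) @ \oo --> 0.
    by apply: cvg_expr; rewrite ger0_norm ?invr_ge0// invf_lt1 ?ltr1n.
  move=> /cvgrPdist_lt /(_ _ e2)[N _ /(_ N (leqnn _))/=].
  rewrite sub0r normrN ger0_norm ?exprn_ge0 ?invr_ge0// => hN.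
  exists (y N); near=> m; rewrite /ball/= -(ltr_pXn2r (n := 2))// ?nnegrE// ?ltW//.
  rewrite real_normK ?num_real// -[_ ^+ 2]sqrrN opprB.
  have Nm : (N <= m)%N by near: m; exists N.
  apply: le_lt_trans (h _ _ Nm) _.
  have S1 : 0 < S + 1 by rewrite ltr_wpDl.
  have : 2^-1 ^+ N * (2 * (S + 1)) < e ^+ 2.
    by rewrite -ltr_pdivlMr// mulr_gt0.
  have : 0 <= 2^-1 ^+ N :> R by rewrite exprn_ge0// invr_ge0.
  lra.
split=> // n; apply: (@cvgr_to_le _ \oo _ _ (fun m => (y m - y n) ^+ 2)).
  by rewrite expr2; under eq_fun do rewrite expr2; apply: cvgM;
    apply: cvgB => //; exact: cvg_cst.
by exists n => // m /= nm; exact: h.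
Unshelve. all: by end_near. Qed.

Context d (T : measurableType d) (mu : {measure set T -> \bar R}).

(** Riesz-Fischer. The increments weighted by 2^k have integrals at most 4^-k, so their sum [S] is
    integrable and finite almost everywhere; there [f ^~ x] converges, at a rate proportional to
    [S x]. Almost everywhere convergence is part of the conclusion because it identifies limits of
    products with the square root of the potential later. *)
Lemma sqint_fast_cvg (f : nat -> T -> R) : (forall n, sqint mu (f n)) ->
  (forall n, dot mu (fun x => f n.+1 x - f n x) (fun x => f n.+1 x - f n x) <=
     8^-1 ^+ n) ->
  exists g, [/\ sqint mu g,
    forall e, 0 < e -> exists N, forall n, (N <= n)%N ->
      dot mu (fun x => f n x - g x) (fun x => f n x - g x) <= e &
    {ae mu, forall x, f ^~ x @ \oo --> g x}].
Proof.
move=> sf f8.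
pose h k x := 2 ^+ k * (f k.+1 x - f k x) ^+ 2.
have h0 k x : 0 <= h k x by rewrite mulr_ge0 ?sqr_ge0 ?exprn_ge0.
have mh k : measurable_fun setT (h k).
  apply: measurable_funM => //; apply: measurable_funX; apply: measurable_funB;
  [exact: (sf _).1|exact: (sf _).1].
pose S x := (\sum_(0 <= k <oo) (h k x)%:E)%E.
have S0 x : (0 <= S x)%E by apply: nneseries_ge0 => k _ _; rewrite lee_fin.
have mS : measurable_fun setT S.
  apply: ge0_emeasurable_sum => [k x _ _|k _]; first by rewrite lee_fin.
  exact/measurable_EFinP.
have iS : (\int[mu]_x S x <= 2%:E)%E.
  rewrite integral_nneseries//; last 2 first.
  - by move=> k; exact/measurable_EFinP.
  - by move=> k x _; rewrite lee_fin.
  have ih0 k : (0 <= \int[mu]_x (h k x)%:E)%E.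
    by apply: integral_ge0 => x _; rewrite lee_fin.
  apply: (@lime_le nat \oo _ R _ _ (is_cvg_nneseries (fun k _ _ => ih0 k))).
  exists 0%N => // n _ /=.
  apply: (@le_trans _ _ (\sum_(0 <= k < n) (4^-1 ^+ k)%:E)%E).
    apply: lee_sum => k _; rewrite /h integral_EFinZl ?exprn_ge0//; last 2 first.
    - by apply: measurable_funX; apply: measurable_funB;
        [exact: (sf _).1|exact: (sf _).1].
    - by move=> x; rewrite sqr_ge0.
    rewrite -dot_sqrE; last exact: sqintB.
    rewrite -EFinM lee_fin (le_trans (ler_wpM2l _ (f8 k))) ?exprn_ge0//.
    by rewrite -exprMn (_ : 2 * 8^-1 = 4^-1 :> R)//; field.
  rewrite sumEFin lee_fin.
  suff : \sum_(0 <= k < n) 4^-1 ^+ k <= 2 * (1 - 4^-1 ^+ n) :> R.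
    move/le_trans; apply; have : 0 <= 4^-1 ^+ n :> R by rewrite exprn_ge0// invr_ge0.
    lra.
  elim: n => [|n IH]; first by rewrite big_geq// expr0 subrr mulr0.
  rewrite big_nat_recr//= exprS; have : 0 <= 4^-1 ^+ n :> R.
    by rewrite exprn_ge0// invr_ge0.
  lra.
have SfinE x : (S x < +oo)%E -> forall m,
    \sum_(0 <= k < m) h k x <= fine (S x).
  move=> Sx m; rewrite -lee_fin fineK ?ge0_fin_numE// -sumEFin.
  by apply: nneseries_lim_ge => k _ _; rewrite lee_fin.
pose G := [set x | (S x < +oo)%E].
have mG : measurable G.
  by rewrite -[G]setTI; exact: emeasurable_fun_infty_o.
have aeG : {ae mu, forall x, G x}.
  have iS' : mu.-integrable setT S.
    apply/integrableP; split=> //.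
    under eq_integral do rewrite gee0_abs//.
    exact: le_lt_trans iS (ltry _).
  by apply: filterS (integrable_ae measurableT iS') => x /(_ I); rewrite ge0_fin_numE.
(* Cut off outside the set of convergence, so that the limit exists everywhere and is measurable. *)
pose f' k x := f k x * \1_G x.
have mf' k : measurable_fun setT (f' k).
  by apply: measurable_funM; [exact: (sf k).1|exact: measurable_indic].
have cf' x : cvgn (f' ^~ x).
  rewrite /f'; have [Gx|nGx] := pselect (G x).
    rewrite indicE mem_set//=; under eq_fun do rewrite mulr1.
    exact: (fast_increments_cvg (SfinE x Gx)).1.
  rewrite indicE memNset//=; under eq_fun do rewrite mulr0; exact: is_cvg_cst.
pose g x := limn (f' ^~ x).
have mg : measurable_fun setT g.
  by apply: (measurable_fun_cvg mf') => x _; exact: cf'.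
have gE x : G x -> g x = limn (f ^~ x).
  move=> Gx; rewrite /g (_ : f' ^~ x = f ^~ x)//; apply/funext => k.
  by rewrite /f' indicE mem_set// mulr1.
have gf n : (\int[mu]_x ((g x - f n x) ^+ 2)%:E <= (4 * 2^-1 ^+ n)%:E)%E.
  have p0 : 0 <= 2 * 2^-1 ^+ n :> R by rewrite mulr_ge0// exprn_ge0// invr_ge0.
  apply: (@le_trans _ _ (\int[mu]_x ((2 * 2^-1 ^+ n)%:E * S x))%E).
    apply: ae_ge0_le_integral => //.
    - by move=> x _; rewrite lee_fin sqr_ge0.
    - apply/measurable_EFinP; apply: measurable_funX; apply: measurable_funB => //.
      exact: (sf n).1.
    - by move=> x _; rewrite mule_ge0// lee_fin.
    - exact: measurable_funeM.
    apply: filterS aeG => x Gx _; rewrite gE//.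
    have Sx : S x \is a fin_num by rewrite ge0_fin_numE.
    rewrite -[S x]fineK// -EFinM lee_fin.
    exact: (fast_increments_cvg (SfinE x Gx)).2.
  have p0' : (0 <= (2 * 2^-1 ^+ n)%:E :> \bar R)%E by rewrite lee_fin.
  rewrite ge0_integralZl//.
  apply: le_trans (lee_wpmul2l p0' iS) _.
  by rewrite -EFinM lee_fin; lra.
have sgf n : sqint mu (fun x => g x - f n x).
  split; last exact: le_lt_trans (gf n) (ltry _).
  by apply: measurable_funB => //; exact: (sf n).1.
exists g; split.
- by apply: eq_sqint (sqintD (sgf 0%N) (sf 0%N)) => x; rewrite subrK.
- move=> e e0.
  have e4 : 0 < e / 4 by rewrite divr_gt0.
  have : (fun n => 2^-1 ^+ n : R) @ \oo --> 0.
    by apply: cvg_expr; rewrite ger0_norm ?invr_ge0// invf_lt1 ?ltr1n.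
  move=> /cvgrPdist_lt /(_ _ e4)[N _ NP]; exists N => n /NP/=.
  rewrite sub0r normrN ger0_norm ?exprn_ge0 ?invr_ge0// => hn.
  have -> : dot mu (fun x => f n x - g x) (fun x => f n x - g x) =
      dot mu (fun x => g x - f n x) (fun x => g x - f n x).
    by apply: eq_Rintegral => x _; ring.
  rewrite -lee_fin dot_sqrE// (le_trans (gf n))// lee_fin; lra.
- apply: filterS aeG => x Gx; rewrite gE//.
  exact: (fast_increments_cvg (SfinE x Gx)).1.
Qed.

End fast_convergence.

(** * Lebesgue measure on R^n *)

Section mes_theory.
Context (R : realType).
Local Notation leb := (@lebesgue_measure R).

Lemma measurable_shift1 (a : R) :
  measurable_fun setT (fun x : measurableTypeR R => x + a : measurableTypeR R).
Proof. by apply: measurable_funD => //; exact: measurable_cst. Qed.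

(** Lebesgue measure is determined by its values on half-open intervals, where the shifted measure
    agrees with it. *)
Lemma lebesgue_shift (a : R) (A : set (measurableTypeR R)) : measurable A ->
  leb ((fun x => x + a) @^-1` A) = leb A.
Proof.
move=> mA.
pose m' := @measure_function_pushforward__canonical__measure_function_Measure
  _ _ _ _ _ leb _ (measurable_shift1 a).
rewrite -[LHS]/(m' A); apply/esym; apply: lebesgue_measure_unique => // X.
move=> [[x y] _ <-] /=; rewrite /m' /= /pushforward.
have -> : (fun z => z + a) @^-1` `]x, y]%classic = `]x - a, y - a]%classic.
  by apply/seteqP; split => z /=; rewrite !in_itv/= ltrBlDr lerBrDr.
by rewrite !lebesgue_measure_itv/= !lte_fin ltrD2r -!EFinD opprD opprK addrACA
  addNr addr0.
Qed.

Lemma ge0_integral_shift1 (a : R) (f : measurableTypeR R -> \bar R) :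
  measurable_fun setT f -> (forall x, 0 <= f x)%E ->
  (\int[leb]_x f (x + a)%R = \int[leb]_x f x)%E.
Proof.
move=> mf f0.
rewrite -[LHS](@ge0_integral_pushforward _ _ _ _ _ _ (measurable_shift1 a) leb setT f)//.
apply: eq_measure_integral; first exact: measurable_shift1.
by move=> m1 A mA _; exact: lebesgue_shift.
Qed.

Lemma integral_mesS n (f : 'rV[R]_n.+1 -> \bar R) :
  measurable_fun setT f -> (forall x, 0 <= f x)%E ->
  (\int[mes]_x f x = \int[leb]_a \int[mes]_v f (rV_cons (a, v)))%E.
Proof.
move=> mf f0.
rewrite [LHS](@ge0_integral_pushforward _ _ _ _ _ _ (@measurable_rV_cons R n)
  (leb \x mes)%E setT f)// fubini_tonelli1//.
  exact: measurableT_comp (@measurable_rV_cons R n).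
by move=> p; exact: f0.
Qed.

Lemma measurable_shift n (z : 'rV[R]_n) : measurable_fun setT (fun x : 'rV[R]_n => x + z).
Proof.
apply: measurable_fun_rV => i; under eq_fun do rewrite mxE.
by apply: measurable_funD; [exact: measurable_coord|exact: measurable_cst].
Qed.

Lemma measurable_add n :
  measurable_fun setT (fun p : 'rV[R]_n * 'rV[R]_n => p.1 + p.2).
Proof.
apply: measurable_fun_rV => i; under eq_fun do rewrite mxE.
apply: measurable_funD.
- exact: (measurableT_comp (@measurable_coord R n i) measurable_fst).
- exact: (measurableT_comp (@measurable_coord R n i) measurable_snd).
Qed.

(** [mes] is built one coordinate at a time, so the shift splits into a one-dimensional shift of the
    outer integral and the induction hypothesis for the inner one. *)
Lemma ge0_integral_shift n (z : 'rV[R]_n) (f : 'rV[R]_n -> \bar R) :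
  measurable_fun setT f -> (forall x, 0 <= f x)%E ->
  (\int[mes]_x f (x + z)%R = \int[mes]_x f x)%E.
Proof.
elim: n z f => [|n IH] z f mf f0.
  by apply: eq_integral => x _; rewrite [z]thinmx0 addr0.
rewrite !integral_mesS//; last first.
  exact: (measurableT_comp mf (measurable_shift z)).
have zE a v : rV_cons (a, v) + z = rV_cons (a + z ord0 ord0, v + (rV_uncons z).2).
  apply/rowP => i; rewrite !mxE; case: unliftP => [j ->|->] //=.
  by rewrite !mxE.
have mfc : measurable_fun setT (f \o @rV_cons R n).
  exact: (measurableT_comp mf (@measurable_rV_cons R n)).
under eq_integral => a _ do under eq_integral => v _ do rewrite zE.
transitivity (\int[leb]_a \int[mes]_v f (rV_cons ((a + z ord0 ord0)%R, v)))%E.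
  apply: eq_integral => a _.
  apply: (IH (rV_uncons z).2 (fun v => f (rV_cons (a + z ord0 ord0, v)))) => //.
  exact: (measurableT_comp mfc (@measurable_pair1 _ _ _ _ _)).
apply: (@ge0_integral_shift1 (z ord0 ord0)
  (fun a => \int[mes]_v f (rV_cons (a, v)))%E).
- by apply: (measurable_fun_fubini_tonelli_F (f \o @rV_cons R n)) => // p; exact: f0.
- by move=> a; apply: integral_ge0.
Qed.

Lemma integral_shift n (z : 'rV[R]_n) (f : 'rV[R]_n -> R) :
  measurable_fun setT f ->
  \int[mes]_x f (x + z) = \int[mes]_x f x.
Proof.
move=> mf; rewrite /Rintegral integralE [in RHS]integralE.
have mEf : measurable_fun setT (EFin \o f) by exact/measurable_EFinP.
have pE : ((fun x => (f (x + z)%R)%:E)^\+ = (fun x => (EFin \o f)^\+ (x + z)%R))%E.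
  exact: (funepos_comp (EFin \o f) (fun x => x + z)).
have nE : ((fun x => (f (x + z)%R)%:E)^\- = (fun x => (EFin \o f)^\- (x + z)%R))%E.
  exact: (funeneg_comp (EFin \o f) (fun x => x + z)).
rewrite pE nE !ge0_integral_shift//.
- exact: measurable_funeneg.
- exact: measurable_funepos.
Qed.

Lemma measurable_prod_set n (I : 'I_n -> set (measurableTypeR R)) :
  (forall i, measurable (I i)) ->
  measurable [set x : 'rV[R]_n | forall i, I i (x ord0 i)].
Proof.
move=> mI.
have -> : [set x : 'rV[R]_n | forall i, I i (x ord0 i)] =
    \bigcap_(i in setT) ((fun x : 'rV[R]_n => x ord0 i : measurableTypeR R) @^-1` I i).
  by apply/seteqP; split => [x h i _|x h i]; exact: h.
apply: fin_bigcap_measurable => [|i _].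
  exact: finite_finset.
by rewrite -[X in measurable X]setTI; exact: measurable_coord.
Qed.

Lemma mes_prod_set n (I : 'I_n -> set (measurableTypeR R)) :
  (forall i, measurable (I i)) ->
  mes [set x : 'rV[R]_n | forall i, I i (x ord0 i)] = (\prod_i leb (I i))%E.
Proof.
elim: n I => [|n IH] I mI.
  rewrite big_ord0 (_ : [set x | _] = setT); first exact: probability_setT.
  by apply/seteqP; split => // x _ [].
have mA := measurable_prod_set mI.
have mI' i : measurable (I (lift ord0 i)) by [].
have mA' := measurable_prod_set mI'.
rewrite -[X in mes X]setIT -integral_indic// integral_mesS//; last first.
  by apply/measurable_EFinP; exact: measurable_indic.
rewrite big_ord_recl.
transitivity (\int[leb]_a ((\1_(I ord0) a)%:E *
   mes [set x : 'rV[R]_n | forall i, I (lift ord0 i) (x ord0 i)]))%E.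
  apply: eq_integral => a _.
  rewrite -[X in mes X]setIT -integral_indic//.
  rewrite -ge0_integralZl//; last first.
    by apply/measurable_EFinP; exact: measurable_indic.
  apply: eq_integral => v _; rewrite -EFinM !indicE -natrM mulnb; congr (_%:R%:E).
  congr nat_of_bool; apply/idP/andP; rewrite !inE.
    move=> h; split; first by have := h ord0; rewrite mxE unlift_none.
    by move=> i; have := h (lift ord0 i); rewrite mxE liftK.
  move=> [h0 h] i; rewrite mxE; case: unliftP => [j ->|->] //=; exact: h.
rewrite ge0_integralZr//; last by apply/measurable_EFinP; exact: measurable_indic.
by rewrite integral_indic// setIT (IH _ mI').
Qed.

End mes_theory.

(** * Continuous functions and half-open boxes in R^n *)

Section borel_rV.
Context (R : realType) (n : nat).
Implicit Types (f : 'rV[R]_n -> R) (x : 'rV[R]_n).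

(* A continuous function is the limit of its compositions with the roundings
   of the coordinates to multiples of [1 / (k + 1)]. *)
Lemma continuous_measurable_rV f : continuous f -> measurable_fun setT f.
Proof.
move=> cf.
pose q (k : nat) x : 'rV[R]_n := \row_i ((Num.floor (x ord0 i * k.+1%:R))%:~R / k.+1%:R).
have mq k : measurable_fun setT (f \o q k).
  move=> _ Y mY; rewrite setTI.
  pose Z (m : 'rV[int]_n) := [set x : 'rV[R]_n | forall i,
    [set a : measurableTypeR R | Num.floor (a * k.+1%:R) = m ord0 i] (x ord0 i)].
  pose fm (m : 'rV[int]_n) := f (\row_i ((m ord0 i)%:~R / k.+1%:R)).
  have -> : (f \o q k) @^-1` Y = \bigcup_m (if `[< Y (fm m) >] then Z m else set0).
    apply/seteqP; split => [x /= Yx|x [m _]].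
      exists (\row_i Num.floor (x ord0 i * k.+1%:R)) => //.
      rewrite asboolT; first by move=> i /=; rewrite mxE.
      by move: Yx; congr (Y (f _)); apply/rowP => i; rewrite !mxE.
    case: asboolP => // Ym Zx; move: Ym; rewrite /fm /=; congr (Y (f _)).
    by apply/rowP => i; rewrite !mxE Zx.
  apply: countable_bigcupT_measurable; first exact: (@countableP ('rV[int]_n : countType)).
  move=> m.
  case: ifP => // _; apply: (measurable_prod_set (I := fun i =>
    [set a : measurableTypeR R | Num.floor (a * k.+1%:R) = m ord0 i])) => i.
  have -> : [set a : measurableTypeR R | Num.floor (a * k.+1%:R) = m ord0 i] =
     `[(m ord0 i)%:~R / k.+1%:R, (m ord0 i + 1)%:~R / k.+1%:R[%classic.
    apply/seteqP; split => a /=; rewrite in_itv/= ler_pdivrMr ?ltr0Sn// ltr_pdivlMr ?ltr0Sn//.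
      by move/eqP; rewrite floor_eq.
    by move=> h; apply/eqP; rewrite floor_eq.
  exact: measurable_itv.
apply: (measurable_fun_cvg mq) => x _.
apply: (@cvg_comp _ _ _ (q ^~ x) f _ (nbhs x)); last exact: cf.
apply/cvg_ballP => e e0.
have [N _ NP] : \forall k \near \oo, k.+1%:R^-1 < e by exact: near_infty_natSinv_lt (PosNum e0).
exists N => // k /NP /= ke; split=> // i j; rewrite ord1 /ball/= mxE.
have k0 : 0 < k.+1%:R :> R by rewrite ltr0Sn.
have := floor_itv (x ord0 j * k.+1%:R); set m := Num.floor _ => /andP[h1 h2].
rewrite intrD in h2; apply: lt_trans ke.
have -> : x ord0 j - m%:~R / k.+1%:R = (x ord0 j * k.+1%:R - m%:~R) / k.+1%:R.
  by field; rewrite lt0r_neq0.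
rewrite normrM (ger0_norm (x := k.+1%:R^-1)) ?invr_ge0 ?ltW//.
rewrite ltr_pdivrMr// mulVf ?lt0r_neq0// ger0_norm; lra.
Qed.

Definition box_set (B : set 'rV[R]_n) := exists2 I : 'I_n -> set R,
  (forall i, ocitv (I i)) & B = [set x : 'rV[R]_n | forall i, I i (x ord0 i)].

Lemma box_set_setI : setI_closed box_set.
Proof.
move=> _ _ [I oI ->] [J oJ ->]; exists (fun i => I i `&` J i).
  by move=> i; exact: ocitvI.
by apply/seteqP; split => [x [h1 h2] i|x h]; split=> // i; have [] := h i.
Qed.

Lemma box_set_measurable B : box_set B -> measurable B.
Proof.
move=> [I oI ->]; apply: (measurable_prod_set (I := I)) => i.
by apply: sub_sigma_algebra; exact: oI.
Qed.

Let bigbox (k : nat) : set 'rV[R]_n :=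
  [set x : 'rV[R]_n | forall i, (`]- k%:R, k%:R]%classic : set R) (x ord0 i)].

Let bigbox_box k : box_set (bigbox k).
Proof.
by exists (fun=> `]- k%:R, k%:R]%classic) => // i; exact: is_ocitv.
Qed.

Let bigbox_cover : \bigcup_k bigbox k = setT.
Proof.
rewrite -subTset => x _.
have /choice[N NP] i : exists k : nat, `|x ord0 i| < k%:R.
  by exists (Num.bound `|x ord0 i|); rewrite archi_boundP.
exists (\max_i N i)%N => // i /=.
have : `|x ord0 i| < (\max_i N i)%N%:R.
  by rewrite (lt_le_trans (NP i))// ler_nat (bigop.leq_bigmax i).
by rewrite in_itv/= ltr_norml => /andP[-> /ltW ->].
Qed.

Lemma measurable_box_set : measurable = <<s box_set >> :> set (set 'rV[R]_n).
Proof.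
apply/seteqP; split; last first.
  by apply: smallest_sub; [exact: sigma_algebra_measurable|exact: box_set_measurable].
apply: smallest_sub; first exact: smallest_sigma_algebra.
rewrite -bigcup_seq; apply: bigcup_sub => i _ _ [A mA <-]; rewrite setTI.
pose X (x : 'rV[R]_n) : R := x ord0 i.
suff : (R.-ocitv.-measurable).-sigma.-measurable `<=`
    image_set_system setT X <<s box_set >>.
  by move=> /(_ _ mA); rewrite /image_set_system /= setTI.
apply: smallest_sub.
  by apply: sigma_algebra_image; exact: smallest_sigma_algebra.
move=> C oC; rewrite /image_set_system /= setTI.
(* The preimage of an interval under one coordinate is an unbounded slab; it is exhausted by boxes
   whose other sides grow. *)
have -> : X @^-1` C = \bigcup_k ([set x : 'rV[R]_n | forall j,
    (if j == i then C else `]- k%:R, k%:R]%classic) (x ord0 j)]).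
  apply/seteqP; split => [x Cx|x [k _ /(_ i)]]; last by rewrite eqxx.
  have [k _ kx] : (\bigcup_k bigbox k) x by rewrite bigbox_cover.
  by exists k => // j; case: eqP => [->//|_]; exact: kx.
apply: sigma_algebra_bigcup => k; apply: sub_sigma_algebra.
exists (fun j => if j == i then C else `]- k%:R, k%:R]%classic) => // j.
by case: eqP => // _; exact: is_ocitv.
Qed.

Lemma measure_box_unique (m1 m2 : {measure set 'rV[R]_n -> \bar R}) :
  (forall B, box_set B -> (m1 B < +oo)%E) ->
  (forall B, box_set B -> m1 B = m2 B) ->
  forall A, measurable A -> m1 A = m2 A.
Proof.
move=> m1oo m12 A mA; apply: (measure_unique box_set bigbox) => //.
- exact: measurable_box_set.
- exact: box_set_setI.
- by move=> k; exact: m1oo.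
Qed.

Lemma mes_box_fin B : box_set B -> (mes B < +oo)%E.
Proof.
move=> [I oI ->]; rewrite (mes_prod_set (I := I)) => [|i]; last first.
  by apply: sub_sigma_algebra; exact: oI.
rewrite ltey_eq prode_fin_num// => i _; have [[a b] _ <-] := oI i.
by rewrite lebesgue_measure_itv/=; case: ifP.
Qed.

End borel_rV.

(** * Test functions *)

Section smooth_functions.
Context (R : realType).
Implicit Types (f g : R -> R) (p : {poly R}) (k : nat).

Fixpoint Ck1 k f : Prop :=
  match k with
  | 0 => continuous f
  | k'.+1 => (forall x, derivable f x 1) /\ Ck1 k' (derive1 f)
  end.

Definition smooth f := forall k, Ck1 k f.

Lemma is_derive_continuous f x a : is_derive x (1 : R) f a -> {for x, continuous f}.
Proof.
move=> [df _]; apply: differentiable_continuous; exact/derivable1_diffP.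
Qed.

Lemma Ck1_is_derive k f : Ck1 k.+1 f -> forall x, is_derive x (1 : R) f ((derive1 f) x).
Proof. by move=> [df _] x; apply: DeriveDef; rewrite ?derive1E. Qed.

Lemma is_derive_Ck1 k f g : (forall x, is_derive x (1 : R) f (g x)) ->
  Ck1 k g -> Ck1 k.+1 f.
Proof.
move=> fg cg; split; first by move=> x; have [] := fg x.
by rewrite (_ : (derive1 f) = g)//; apply/funext => x; rewrite derive1E; have [] := fg x.
Qed.

Lemma Ck1W k f : Ck1 k.+1 f -> Ck1 k f.
Proof.
elim: k f => [|k IH] f cf; last first.
  by have [df cf'] := cf; split=> //; exact: IH.
by move=> x; apply: is_derive_continuous (Ck1_is_derive cf x).
Qed.

Lemma Ck1D k f g : Ck1 k f -> Ck1 k g -> Ck1 k (f \+ g).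
Proof.
elim: k f g => [|k IH] f g cf cg.
  by move=> x; apply: cvgD; [exact: cf|exact: cg].
apply: (is_derive_Ck1 (g := (derive1 f) \+ (derive1 g))); last exact: IH cf.2 cg.2.
move=> x; apply: is_deriveD; [exact: Ck1_is_derive cf x|exact: Ck1_is_derive cg x].
Qed.

Lemma Ck1M k f g : Ck1 k f -> Ck1 k g -> Ck1 k (f \* g).
Proof.
elim: k f g => [|k IH] f g cf cg.
  by move=> x; apply: cvgM; [exact: cf|exact: cg].
apply: (is_derive_Ck1 (g := (f \* (derive1 g)) \+ (g \* (derive1 f)))).
  move=> x; apply: is_deriveM; [exact: Ck1_is_derive cf x|exact: Ck1_is_derive cg x].
by apply: Ck1D; apply: IH; [exact: Ck1W|exact: cg.2|exact: Ck1W|exact: cf.2].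
Qed.

Lemma Ck1_cst k (c : R) : Ck1 k (fun=> c).
Proof.
elim: k c => [|k IH] c; first by move=> x; exact: cvg_cst.
apply: (is_derive_Ck1 (g := fun=> 0)) => // x; exact: is_derive_cst.
Qed.

Lemma is_derive_affine (a b x : R) : is_derive x (1 : R) (fun y => a * y + b) a.
Proof.
have h : is_derive x (1 : R) (fun y : R => a *: y + b) (a *: 1 + 0).
  by apply: is_deriveD; exact: is_deriveZ.
by apply: (is_derive_eq h); rewrite addr0 /GRing.scale/= mulr1.
Qed.

Lemma Ck1_affine k f (a b : R) : Ck1 k f -> Ck1 k (fun x => f (a * x + b)).
Proof.
elim: k f => [|k IH] f cf.
  move=> x; apply: (@continuous_comp _ _ _ (fun x => a * x + b) f); last exact: cf.
  exact: is_derive_continuous (is_derive_affine a b x).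
apply: (is_derive_Ck1 (g := (fun x => (derive1 f) (a * x + b)) \* (fun=> a))).
  move=> x; apply: (@is_derive1_comp _ f (fun x => a * x + b)).
    exact: Ck1_is_derive cf _.
  exact: is_derive_affine.
by apply: Ck1M; [exact: IH cf.2|exact: Ck1_cst].
Qed.

Lemma smooth_continuous f : smooth f -> continuous f.
Proof. by move=> /(_ 0%N). Qed.

Lemma smooth_is_derive f : smooth f -> forall x, is_derive x (1 : R) f ((derive1 f) x).
Proof. by move=> sf; apply: (@Ck1_is_derive 0); exact: sf. Qed.

Lemma smooth_derive f : smooth f -> smooth (derive1 f).
Proof. by move=> sf k; exact: (sf k.+1).2. Qed.

Lemma smooth_primitive f g :
  (forall x, is_derive x (1 : R) f (g x)) -> smooth g -> smooth f.
Proof. by move=> fg sg k; apply: Ck1W; apply: is_derive_Ck1 (sg k). Qed.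

Lemma smoothM f g : smooth f -> smooth g -> smooth (f \* g).
Proof. by move=> sf sg k; exact: Ck1M. Qed.

Lemma smooth_affine f (a b : R) : smooth f -> smooth (fun x => f (a * x + b)).
Proof. by move=> sf k; exact: Ck1_affine. Qed.

Lemma smoothB f g : smooth f -> smooth g -> smooth (fun x => f x - g x).
Proof.
move=> sf sg k.
rewrite (_ : (fun x => _) = f \+ ((fun=> -1) \* g)); last first.
  by apply/funext => x /=; rewrite mulN1r.
by apply: Ck1D => //; apply: Ck1M => //; exact: Ck1_cst.
Qed.

(* Closed under derivation; [flat 1] is the standard smooth function that
   vanishes exactly on the nonpositive half-line. *)
Definition flat p (x : R) : R := if 0 < x then p.[x^-1] * expR (- x^-1) else 0.

(** For the monomial of degree i take m = i + 1 and use exp(y) = exp(y / m)^m >= (y / m)^m: one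
    power of y more than the monomial has. *)
Lemma poly_expR_bound p : exists2 C, 0 <= C &
  forall y, 0 < y -> `|p.[y]| * expR (- y) <= C * y^-1.
Proof.
exists (\sum_(i < size p) `|p`_i| * i.+1%:R ^+ i.+1).
  by rewrite sumr_ge0// => i _; rewrite mulr_ge0.
move=> y y0; rewrite horner_coef.
have e0 : 0 < expR (- y) by exact: expR_gt0.
apply: (@le_trans _ _ (\sum_(i < size p) `|p`_i| * (y ^+ i * expR (- y)))).
  apply: (@le_trans _ _ ((\sum_(i < size p) `|p`_i * y ^+ i|) * expR (- y))).
    by rewrite ler_pM2r// ler_norm_sum.
  rewrite mulr_suml ler_sum// => i _.
  by rewrite normrM (ger0_norm (x := y ^+ i)) ?exprn_ge0 ?(ltW y0)// mulrA.
rewrite mulr_suml ler_sum// => i _; rewrite -mulrA ler_wpM2l//.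
set m := i.+1; have m0 : 0 < m%:R :> R by rewrite ltr0Sn.
have h : (y / m%:R) ^+ m <= expR y.
  have -> : expR y = expR (y / m%:R) ^+ m.
    by rewrite -expRM_natl mulrC divfK// lt0r_neq0.
  have ym : 0 <= y / m%:R by rewrite divr_ge0 ?(ltW y0).
  rewrite ler_pXn2r ?nnegrE ?expR_ge0//.
  by apply: le_trans (expR_ge1Dx _); rewrite lerDr.
rewrite -(ler_pM2r (expR_gt0 y)) -mulrA -expRD addNr expR0 mulr1.
have : m%:R ^+ m * y^-1 * (y / m%:R) ^+ m <= m%:R ^+ m * y^-1 * expR y.
  by rewrite ler_pM2l// mulr_gt0 ?exprn_gt0 ?invr_gt0.
apply: le_trans; set q := m%:R in m0 *.
have -> : q ^+ m * y^-1 * (y / q) ^+ m = y^-1 * y ^+ m.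
  by rewrite expr_div_n [X in _ * X]mulrC mulrACA divff ?mul1r// expf_neq0// lt0r_neq0.
by rewrite /m exprS mulrA mulVf ?mul1r// lt0r_neq0.
Qed.

(** The polynomial is what differentiating p(1/x) exp(-1/x) produces for x > 0. At 0 the difference
    quotient is the function attached to ['X * p], which [poly_expR_bound] makes O(x). *)
Lemma flat_is_derive p x :
  is_derive x (1 : R) (flat p) (flat ('X^2 * (p - p^`())) x).
Proof.
have [x0|x0|x0] := ltgtP 0 x.
- have h : is_derive x (1 : R) (fun y => p.[y^-1] * expR (- y^-1))
      (flat ('X^2 * (p - p^`())) x).
    have iV : is_derive x (1 : R) (fun y : R => y^-1) (- x ^- 2).
      have := @is_deriveV R id x 1 1 (lt0r_neq0 x0) _.
      by move/(_ (is_derive_id _ _))=> h; apply: is_derive_eq h _; rewrite /GRing.scale/= mulr1.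
    have iN : is_derive x (1 : R) (fun y : R => - y^-1) (x ^- 2).
      by have := is_deriveN iV; rewrite opprK.
    have iE := @is_derive1_comp _ expR _ _ _ _ (is_derive_expR _) iN.
    have iP := @is_derive1_comp _ (horner p) _ _ _ _ (is_derive_poly p _) iV.
    apply: is_derive_eq (is_deriveM iP iE) _.
    rewrite /flat x0 !hornerE /GRing.scale/= exprVn; ring.
  apply: near_eq_is_derive h; near=> y; rewrite /flat ifT//.
  by near: y; exact: lt_nbhsr.
- have h : is_derive x (1 : R) (fun=> 0) (flat ('X^2 * (p - p^`())) x).
    by rewrite /flat ltNge (ltW x0)/=; exact: is_derive_cst.
  apply: near_eq_is_derive h; near=> y; rewrite /flat ifF//.
  apply/negbTE; rewrite -leNgt ltW//; near: y; exact: lt_nbhsl.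
- rewrite -x0.
  have h : (fun h => h^-1 *: (flat p (h *: 1 + 0) - flat p 0)) @ 0^' --> (0 : R).
    have [C C0 Cp] := poly_expR_bound ('X * p).
    apply/cvgrPdist_le => e e0; near=> y.
    rewrite sub0r normrN /flat ltxx subr0 addr0 /GRing.scale/= mulr1.
    case: ifPn => [y0|_]; last by rewrite mulr0 normr0 ltW.
    have yV : 0 < y^-1 by rewrite invr_gt0.
    have := Cp _ yV; rewrite hornerM hornerX invrK.
    rewrite mulrA !normrM (gtr0_norm yV) (gtr0_norm (expR_gt0 _)).
    move/le_trans; apply.
    have : `|y| <= e / (C + 1).
      near: y; apply: dnbhs0_le.
      by rewrite divr_gt0// ltr_wpDl.
    rewrite gtr0_norm// ler_pdivlMr ?ltr_wpDl//; have := mulr_ge0 C0 (ltW y0); nra.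
  apply: DeriveDef; first by apply/cvg_ex; exists 0.
  by rewrite /flat ltxx; apply/cvg_lim.
Unshelve. all: by end_near. Qed.

Lemma flat_smooth p : smooth (flat p).
Proof.
move=> k; elim: k p => [|k IH] p.
  by move=> x; exact: is_derive_continuous (flat_is_derive p x).
by apply: is_derive_Ck1; [exact: flat_is_derive|exact: IH].
Qed.

End smooth_functions.

(** * Products of one-variable test functions *)

Section test_functions.
Context (R : realType) (d : nat).
Implicit Types (f : 'I_d -> R -> R) (x : 'rV[R]_d) (phi psi : 'rV[R]_d -> R).

Definition prodf f x : R := \prod_i f i (x ord0 i).

(** A partial derivative, a translation along an axis, or a primitive in one variable changes a
    product only in its j-th factor. *)
Definition updf f j (g : R -> R) i := if i == j then g else f i.

Definition csupp (g : R -> R) :=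
  exists A B : R, forall y, g y != 0 -> A <= y <= B.

Lemma prodf_updf f j g x :
  prodf (updf f j g) x = g (x ord0 j) * \prod_(i | i != j) f i (x ord0 i).
Proof.
rewrite /prodf (bigD1 j)//= /updf eqxx; congr (_ * _).
by apply: eq_bigr => i /negbTE ->.
Qed.

Lemma prodf_shift f j t x :
  prodf f (x + t *: basis_vec R j) =
  prodf (updf f j (fun y => f j (y + t))) x.
Proof.
rewrite prodf_updf /prodf (bigD1 j)//=; congr (f j _ * _).
  by rewrite !mxE !eqxx mulr1.
by apply: eq_bigr => i ij; rewrite !mxE eqxx (negbTE ij) mulr0 addr0.
Qed.

Lemma prodf_is_derive f j g x : (forall y, is_derive y (1 : R) (f j) (g y)) ->
  is_derive x (basis_vec R j) (prodf f) (prodf (updf f j g) x).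
Proof.
move=> fg.
have h : (fun h => h^-1 *: (prodf f (h *: basis_vec R j + x) - prodf f x)) @ 0^' -->
    prodf (updf f j g) x.
  rewrite prodf_updf.
  have [df dv] := fg (x ord0 j).
  have {dv} : (fun h => h^-1 *: (f j (h *: 1 + x ord0 j) - f j (x ord0 j))) @ 0^'
      --> g (x ord0 j).
    by rewrite -dv; exact: df.
  move/cvgMl_tmp => /(_ (\prod_(i | i != j) f i (x ord0 i))).
  rewrite [X in _ -> _ --> X]mulrC; apply: cvg_trans; apply: near_eq_cvg; near=> h.
  have -> : prodf f x = f j (x ord0 j) * \prod_(i | i != j) f i (x ord0 i).
    by rewrite /prodf (bigD1 j).
  rewrite [h *: _ + x]addrC prodf_shift prodf_updf.
  by rewrite /GRing.scale/= mulr1 (addrC h); ring.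
by apply: DeriveDef; [apply/cvg_ex; exists (prodf (updf f j g) x)|exact/cvg_lim].
Unshelve. all: by end_near. Qed.

Lemma prodf_continuous f : (forall i, continuous (f i)) -> continuous (prodf f).
Proof.
move=> cf; rewrite /prodf.
suff : forall s, continuous (fun x => \prod_(i <- s) f i (x ord0 i)) by apply.
elim=> [|i s IH] x.
  rewrite (_ : (fun y => _) = fun=> 1); first exact: cst_continuous.
  by apply/funext => y; rewrite big_nil.
rewrite (_ : (fun y => _) =
  (fun y : 'rV[R]_d => f i (y ord0 i)) \* (fun y => \prod_(i <- s) f i (y ord0 i))).
  apply: (@continuousM _ _ (fun y : 'rV[R]_d => f i (y ord0 i))); last exact: IH.
  apply: (@continuous_comp _ _ _ (fun x : 'rV[R]_d => x ord0 i) (f i)).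
    exact: coord_continuous.
  exact: cf.
by apply/funext => y; rewrite big_cons.
Qed.

Lemma updf_smooth f j g : (forall i, smooth (f i)) -> smooth g ->
  forall i, smooth (updf f j g i).
Proof. by move=> sf sg i; rewrite /updf; case: eqP. Qed.

Lemma updf_csupp f j g : (forall i, csupp (f i)) -> csupp g ->
  forall i, csupp (updf f j g i).
Proof. by move=> sf sg i; rewrite /updf; case: eqP. Qed.

Lemma prodf_derive f j : (forall i, smooth (f i)) ->
  (fun x => 'D_(basis_vec R j) (prodf f) x) = prodf (updf f j (derive1 (f j))).
Proof.
move=> sf; apply/funext => x.
have h := @prodf_is_derive f j _ x (smooth_is_derive (sf j)).
by rewrite (@derive_val _ _ _ _ _ _ _ h).
Qed.

Lemma prodf_Ck k f : (forall i, smooth (f i)) -> Ck k (prodf f).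
Proof.
elim: k f => [|k IH] f sf /=.
  by apply: prodf_continuous => i; exact: smooth_continuous.
split; first by apply: prodf_continuous => i; exact: smooth_continuous.
move=> j; split.
  by move=> x; have [] := @prodf_is_derive f j _ x (smooth_is_derive (sf j)).
by rewrite prodf_derive//; apply: IH; apply: updf_smooth => //; exact: smooth_derive.
Qed.

Lemma prodf_test f : (forall i, smooth (f i)) -> (forall i, csupp (f i)) ->
  test_function (prodf f).
Proof.
move=> sf /(_ _)/cid - /all_sig[A /(_ _)/cid - /all_sig[B AB]].
split; first by move=> k; exact: prodf_Ck.
pose K := [set x : 'rV[R]_d | forall i, `[A i, B i]%classic (x ord0 i)].
have cK : compact K.
  apply: (@rV_compact _ _ (fun i => `[A i, B i]%classic)) => i.
  exact: segment_compact.
apply: (subclosed_compact _ cK); first exact: closed_closure.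
have clK : closed K by apply: compact_closed => //; exact: norm_hausdorff.
rewrite [X in _ `<=` X]((closure_id K).1 clK); apply: closure_subset.
move=> x /= fx i /=; rewrite in_itv/=; apply: AB.
by apply: contra fx => /eqP fi; rewrite /prodf (bigD1 i)//= fi mul0r.
Qed.

Lemma compact_support_sqint (K : set 'rV[R]_d) phi : compact K ->
  continuous phi -> (forall x, ~ K x -> phi x = 0) -> sqint mes phi.
Proof.
move=> cK cphi phi0; have mphi := continuous_measurable_rV cphi.
split=> //.
have [M [Mr MK]] : bounded_set K by exact: compact_bounded.
have [M' [M'r M'K]] : bounded_set (phi @` K).
  by apply: compact_bounded; apply: continuous_compact => //; exact: continuous_subspaceT.
pose b := `|M| + 1; pose c := `|M'| + 1.
have Mb : M < b by rewrite (le_lt_trans (ler_norm M))// ltrDl.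
have Mc : M' < c by rewrite (le_lt_trans (ler_norm M'))// ltrDl.
(* On [K] the coordinates lie in the closed interval [-b, b]; the left end is moved because the
   sides of a box are open there. *)
pose Q := [set x : 'rV[R]_d | forall i, (`]- (b + 1), b]%classic : set R) (x ord0 i)].
have bQ : box_set Q by exists (fun=> `]- (b + 1), b]%classic) => // i; exact: is_ocitv.
have mQ := box_set_measurable bQ.
apply: (@le_lt_trans _ _ (\int[mes]_x (c ^+ 2 * \1_Q x)%:E)%E); last first.
  rewrite integral_EFinZl ?sqr_ge0//.
  rewrite integral_indic// setIT lte_mul_pinfty ?lee_fin ?sqr_ge0//.
  exact: mes_box_fin.
apply: le_integral_EFin.
- exact: measurable_funX.
- by apply: measurable_funM => //; exact: measurable_indic.
- by move=> x; exact: sqr_ge0.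
- move=> x; have [Kx|nKx] := pselect (K x); last first.
    by rewrite phi0// expr0n/= mulr_ge0 ?sqr_ge0.
  rewrite indicE mem_set ?mulr1 => [|i /=].
    rewrite -real_normK ?num_real// lerXn2r ?nnegrE ?addr_ge0//.
    by apply: M'K Mc _ _; exists x.
  have : `|x ord0 i| <= b.
    apply: le_trans (MK _ Mb _ Kx); rewrite [leRHS]mx_normrE.
    exact: (le_bigmax _ (fun ij => `|x ij.1 ij.2|) (ord0, i)).
  by rewrite in_itv/= ler_norml => /andP[h1 ->]; rewrite andbT; lra.
Qed.

Lemma test_function_sqint phi : test_function phi -> sqint mes phi.
Proof.
move=> [cphi cK]; apply: (compact_support_sqint cK); first exact: (cphi 0%N).
move=> x nx; apply: contrapT => /eqP px; apply: nx; exact: subset_closure.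
Qed.

Lemma test_function_derive_sqint phi j : test_function phi ->
  sqint mes (fun x => 'D_(basis_vec R j) phi x).
Proof.
move=> [cphi cK]; apply: (compact_support_sqint cK).
  by have [_ /(_ j)[]] := cphi 1%N.
move=> x nx.
transitivity ('D_(basis_vec R j) (cst (0 : R)) x); last exact: derive_cst.
apply: near_eq_derive.
have : nbhs x (~` closure [set x | phi x != 0]).
  by apply: open_nbhs_nbhs; split=> //; apply: closed_openC; exact: closed_closure.
apply: filterS => y ny; apply: contrapT => /eqP px; apply: ny.
exact: subset_closure.
Qed.

End test_functions.

(** * Measures given by a density *)

Section density.
Context d (T : measurableType d) (R : realType) (mu : {measure set T -> \bar R}).
Variables (f : T -> \bar R) (mf : measurable_fun setT f).
Hypothesis f0 : forall x, (0 <= f x)%E.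

(* The two proofs are arguments so that the measure structure below can be
   inferred from the term. *)
Definition density (_ : measurable_fun setT f) (_ : forall x, (0 <= f x)%E)
  (A : set T) : \bar R := (\int[mu]_(x in A) f x)%E.

Let density0 : density mf f0 set0 = 0%E.
Proof. exact: integral_set0. Qed.

Let density_ge0 A : (0 <= density mf f0 A)%E.
Proof. exact: integral_ge0. Qed.

Let density_sigma_additive : semi_sigma_additive (density mf f0).
Proof.
move=> F mF tF mUF; rewrite /density ge0_integral_bigcup//; last first.
  exact: measurable_funTS.
by apply: is_cvg_nneseries => n _ _; exact: integral_ge0.
Qed.

HB.instance Definition _ := isMeasure.Build _ _ _ (density mf f0)
  density0 density_ge0 density_sigma_additive.

End density.

(** * Fundamental lemma of the calculus of variations *)

Section fundamental_lemma.
Context (R : realType) (d : nat).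

Lemma flat1E (x : R) : flat 1 x = if 0 < x then expR (- x^-1) else 0.
Proof. by rewrite /flat hornerC mul1r. Qed.

Lemma flat1_bounds (x : R) : 0 <= flat 1 x <= 1.
Proof.
rewrite flat1E; case: ifP => [x0|_]; last by rewrite lexx ler01.
by rewrite expR_ge0 expR_le1 oppr_le0 invr_ge0 ltW.
Qed.

Lemma flat1_cvg1 (u : nat -> R) (c : R) : 0 < c -> (forall n, c * n%:R <= u n) ->
  flat 1 (u n) @[n --> \oo] --> (1 : R).
Proof.
move=> c0 cu; apply/cvgrPdist_le => e e0.
have ce : 0 < c * e by rewrite mulr_gt0.
near=> n.
have n0 : (0 < n)%N by near: n; exact: nbhs_infty_gt.
have nce : (c * e)^-1 <= n%:R by near: n; exact: nbhs_infty_ger.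
have un : 0 < u n.
  by apply: lt_le_trans (cu n); rewrite mulr_gt0// ltr0n.
have /andP[h1 h2] := flat1_bounds (u n).
rewrite ger0_norm ?subr_ge0// flat1E un.
have h3 := expR_ge1Dx (- (u n)^-1).
have h4 : (u n)^-1 <= e.
  rewrite -[e]invrK lef_pV2 ?posrE ?invr_gt0//.
  apply: le_trans (cu n); move: nce; rewrite invfM => nce.
  by rewrite -ler_pdivrMl.
lra.
Unshelve. all: by end_near. Qed.

(* The second factor is [flat 1 (n (1 + n (b - y)))]: its support ends at
   [b + 1 / n], and at [y = b] it still tends to 1. *)
Definition bump (a b : R) (n : nat) (y : R) : R :=
  flat 1 (n%:R * y + - (n%:R * a)) *
  flat 1 (- (n ^ 2)%:R * y + (n%:R + (n ^ 2)%:R * b)).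

Lemma bump_smooth a b n : smooth (bump a b n).
Proof. by apply: smoothM; apply: smooth_affine; exact: flat_smooth. Qed.

Lemma bump_bounds a b n y : 0 <= bump a b n y <= 1.
Proof.
rewrite /bump; set x1 := flat 1 _; set x2 := flat 1 _.
have /andP[h1 h2] : 0 <= x1 <= 1 by exact: flat1_bounds.
have /andP[h3 h4] : 0 <= x2 <= 1 by exact: flat1_bounds.
by rewrite mulr_ge0// mulr_ile1.
Qed.

Lemma bump_supp a b n y : bump a b n y != 0 -> a < y <= b + 1.
Proof.
rewrite /bump mulf_eq0 negb_or !flat1E.
case: ifP => [h1|_]; last by rewrite eqxx.
case: ifP => [h2 _|_]; last by rewrite eqxx andbF.
have n0 : 0 < n%:R :> R.
  rewrite lt_def ler0n andbT; apply/eqP => n0.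
  by rewrite n0 !mul0r oppr0 addr0 ltxx in h1.
apply/andP; split; first by rewrite -(ltr_pM2l n0); lra.
rewrite natrX in h2; have n1 : 1 <= n%:R :> R by rewrite ler1n -(ltr0n R).
set m := n%:R in n0 n1 h2.
have h3 : 0 < m * (1 + m * (b - y)) by lra.
rewrite pmulr_rgt0// in h3.
by rewrite leNgt; apply/negP => h4; nra.
Qed.

Lemma bump_csupp a b n : csupp (bump a b n).
Proof. by exists a, (b + 1) => y /bump_supp/andP[/ltW -> ->]. Qed.

Lemma bump_cvg a b y :
  bump a b n y @[n --> \oo] --> (\1_(`]a, b]%classic : set R) y : R).
Proof.
have [ya|ay] := leP y a.
  rewrite indicE memNset /= => [|/=]; last by rewrite in_itv/= ltNge ya.
  rewrite (_ : (fun n => _) = fun=> 0); first exact: cvg_cst.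
  apply/funext => n; rewrite /bump !flat1E ifF ?mul0r//; apply/negbTE.
  by rewrite -leNgt -mulrN -mulrDr mulr_ge0_le0// subr_le0.
have [yb|by_] := leP y b.
  rewrite indicE mem_set /=; last by rewrite in_itv/= ay yb.
  rewrite -(mulr1 1) /bump; apply: cvgM.
    apply: (flat1_cvg1 (c := y - a)); first by rewrite subr_gt0.
    by move=> n; lra.
  apply: (flat1_cvg1 ltr01) => n; rewrite mul1r.
  by have := mulr_ge0 (ler0n R (n ^ 2)) (_ : 0 <= b - y);
    rewrite subr_ge0 => /(_ yb); lra.
rewrite indicE memNset /=; last by rewrite in_itv/= ay leNgt by_.
apply: (@cvg_trans _ ((fun=> 0 : R) @ \oo)); last exact: cvg_cst.
apply: near_eq_cvg; near=> n.
rewrite /bump !flat1E [X in _ = _ * X]ifF ?mulr0//; apply/negbTE; rewrite -leNgt.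
have nb : (y - b)^-1 <= n%:R by near: n; exact: nbhs_infty_ger.
have yb0 : 0 < y - b by rewrite subr_gt0.
rewrite natrX; have := ler0n R n; set m := n%:R in nb * => m0.
have h : 1 <= m * (y - b) by rewrite -ler_pdivrMr// mul1r.
nra.
Unshelve. all: by end_near. Qed.

Lemma indic_box_sqint (B : set 'rV[R]_d) : box_set B ->
  sqint mes (\1_B : _ -> R).
Proof.
move=> bB; have mB := box_set_measurable bB; split.
  exact: measurable_indic.
rewrite (_ : (fun x => _) = fun x => (\1_B x)%:E); last first.
  by apply/funext => x; rewrite indicE -natrX; case: (_ \in _).
by rewrite integral_indic// setIT mes_box_fin.
Qed.

Lemma box_setP (B : set 'rV[R]_d) : box_set B -> exists a b : 'I_d -> R,
  B = [set x : 'rV[R]_d | forall i, (`]a i, b i]%classic : set R) (x ord0 i)].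
Proof.
move=> [I oI ->].
have /choice[p pP] i : exists p : R * R, `]p.1, p.2]%classic = I i.
  by have [p _ pI] := oI i; exists p.
exists (fun i => (p i).1), (fun i => (p i).2).
by apply/seteqP; split => x h i; have := h i; rewrite (pP i).
Qed.

(** Dominated convergence: products of bumps converge pointwise to the indicator of the box, and |w|
    on the box with right ends enlarged by 1 dominates. *)
Lemma integral_box_eq0 (w : 'rV[R]_d -> R) : sqint mes w ->
  (forall f : 'I_d -> R -> R, (forall i, smooth (f i)) ->
     (forall i, csupp (f i)) -> \int[mes]_x (w x * prodf f x) = 0) ->
  forall B, box_set B -> \int[mes]_x (w x * \1_B x) = 0.
Proof.
move=> sw w0 B bB; have mB := box_set_measurable bB.
have [a [b BE]] := box_setP bB.
pose B' := [set x : 'rV[R]_d | forall i, (`]a i, b i + 1]%classic : set R) (x ord0 i)].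
have bB' : box_set B'.
  by exists (fun i => `]a i, b i + 1]%classic) => // i; exact: is_ocitv.
have mB' := box_set_measurable bB'.
pose F n x := prodf (fun i => bump (a i) (b i) n) x.
have sF n : sqint mes (F n).
  apply: test_function_sqint; apply: prodf_test => i;
    [exact: bump_smooth|exact: bump_csupp].
have F_bounds n x : `|F n x| <= \1_B' x.
  rewrite /F /prodf indicE; have [xB|xB] := pselect (B' x).
    rewrite mem_set//= ger0_norm; last first.
      by apply: prodr_ge0 => i _; have /andP[] := bump_bounds (a i) (b i) n (x ord0 i).
    apply: prodr_ile1 => i _; exact: bump_bounds.
  rewrite memNset//= normr_le0; apply: contrapT => /eqP Fx; apply: xB => i /=.
  rewrite in_itv/=; apply: (@bump_supp _ _ n); apply: contra Fx => /eqP fi.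
  by rewrite (bigD1 i)//= fi mul0r eqxx.
have F_cvg x : F n x @[n --> \oo] --> (\1_B x : R).
  have -> : \1_B x = \prod_i (\1_(`]a i, b i]%classic : set R) (x ord0 i) : R).
    rewrite indicE; have [xB|xB] := pselect (B x).
      rewrite mem_set//= big1// => i _; rewrite indicE mem_set//.
      by move: xB; rewrite BE; exact.
    rewrite memNset//=.
    have [i xi] : exists i, ~ (`]a i, b i]%classic : set R) (x ord0 i).
      by apply/existsNP => h; apply: xB; rewrite BE.
    by rewrite (bigD1 i)//= indicE memNset// mul0r.
  rewrite /F /prodf; elim: (index_enum 'I_d) => [|i s IH].
    by under eq_fun do rewrite big_nil; rewrite big_nil; exact: cvg_cst.
  under eq_fun do rewrite big_cons.
  rewrite big_cons; apply: cvgM => //; exact: bump_cvg.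
have sB' := indic_box_sqint bB'.
have aw : sqint mes (fun x => `|w x|).
  split; first by apply: measurableT_comp => //; exact: sw.1.
  rewrite (_ : (fun x => _) = (fun x => (w x ^+ 2)%:E)); first exact: sw.2.
  by apply/funext => x; rewrite real_normK ?num_real.
have ig := sqint_mul aw sB'.
have mw1B : measurable_fun setT (fun x => (w x * \1_B x)%:E).
  apply/measurable_EFinP; apply: measurable_funM; first exact: sw.1.
  exact: measurable_indic.
have mwF n : measurable_fun setT (fun x => (w x * F n x)%:E).
  by apply/measurable_EFinP; apply: measurable_funM; [exact: sw.1|exact: (sF n).1].
have [_ _] : [/\ mes.-integrable setT (fun x => (w x * \1_B x)%:E),
    ([sequence \int[mes]_x `|(w x * F n x)%:E - (w x * \1_B x)%:E|]_n @ \oo --> 0)%E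
    & ([sequence \int[mes]_x (w x * F n x)%:E]_n @ \oo -->
       \int[mes]_x (w x * \1_B x)%:E)%E].
  apply: (dominated_convergence measurableT mwF mw1B _ ig).
  - apply: aeW => x _; apply: cvg_EFin; first by near=> n.
    by apply: cvgMl_tmp; exact: F_cvg.
  - apply: aeW => x n _; rewrite lee_fin normrM ler_wpM2l//.
move=> h; rewrite /Rintegral.
rewrite -(cvg_lim _ h)//.
rewrite (_ : (fun n => _) = fun=> 0%E); first by rewrite lim_cst.
apply/funext => n.
rewrite -[LHS]fineK; last exact: (integrable_fin_num _ (sqint_mul sw (sF n))).
congr EFin; apply: w0 => i; [exact: bump_smooth|exact: bump_csupp].
Unshelve. all: by end_near. Qed.

(** The positive and negative parts of [w] are densities of two measures that agree, and are finite,
    on boxes; hence they agree on all measurable sets. On the set where [w] is nonnegative the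
    second measure vanishes, so the positive part is null there; symmetrically for the negative
    part. *)
Lemma fundamental_lemma (w : 'rV[R]_d -> R) : sqint mes w ->
  (forall f : 'I_d -> R -> R, (forall i, smooth (f i)) ->
     (forall i, csupp (f i)) -> \int[mes]_x (w x * prodf f x) = 0) ->
  {ae mes, forall x, w x = 0}.
Proof.
move=> sw w0; have mw : measurable_fun setT (EFin \o w).
  by apply/measurable_EFinP; exact: sw.1.
have mp := measurable_funepos mw; have mn := measurable_funeneg mw.
pose m1 := density mes mp (funepos_ge0 (EFin \o w)).
pose m2 := density mes mn (funeneg_ge0 (EFin \o w)).
have wB B : box_set B -> mes.-integrable B (EFin \o w).
  move=> bB; have mB := box_set_measurable bB.
  have := sqint_mul sw (indic_box_sqint bB).
  rewrite (_ : EFin \o _ = (EFin \o w) \_ B); last first.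
    apply/funext => x /=.
    by rewrite patchE indicE; case: ifP; rewrite ?mulr1 ?mulr0.
  by move=> iB; rewrite integrable_mkcond.
have m12 : forall B, box_set B -> m1 B = m2 B.
  move=> B bB; have mB := box_set_measurable bB.
  have := integral_box_eq0 sw w0 bB.
  have -> : \int[mes]_x (w x * \1_B x) = \int[mes]_(x in B) w x.
    rewrite [in RHS]Rintegral_mkcond; apply: eq_Rintegral => x _.
    by rewrite patchE indicE; case: ifP; rewrite ?mulr1 ?mulr0.
  have ip := integrable_funepos mB (wB _ bB).
  have in_ := integrable_funeneg mB (wB _ bB).
  rewrite /Rintegral integralE fineB; last 2 first.
  - exact: integrable_fin_num ip.
  - exact: integrable_fin_num in_.
  move/eqP; rewrite subr_eq0 => /eqP h.
  rewrite /m1 /m2 /density -[LHS]fineK; last exact: integrable_fin_num ip.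
  by rewrite h fineK//; exact: integrable_fin_num in_.
have m1B B : box_set B -> (m1 B < +oo)%E.
  move=> bB; have mB := box_set_measurable bB.
  exact: integrable_lty (integrable_funepos mB (wB _ bB)).
have m12A := measure_box_unique m1B m12.
have z (D : set 'rV[R]_d) (h : 'rV[R]_d -> \bar R) : measurable D ->
    measurable_fun setT h -> (forall x, 0 <= h x)%E -> (\int[mes]_(x in D) h x = 0)%E ->
    {ae mes, forall x, D x -> h x = 0%E}.
  move=> mD mh h0 hD.
  apply: (ae_eq_integral_abs mes mD _).1; first exact: measurable_funTS.
  by under eq_integral do rewrite gee0_abs//.
pose P := [set x | 0 <= w x]; pose N := [set x | w x <= 0].
have mP : measurable P.
  rewrite -[P]setTI; have := emeasurable_fun_c_infty measurableT mw 0%E.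
  by congr measurable; apply/seteqP; split => x [_ /=]; rewrite lee_fin.
have mN : measurable N.
  rewrite -[N]setTI; have := emeasurable_fun_infty_c measurableT mw 0%E.
  by congr measurable; apply/seteqP; split => x [_ /=]; rewrite lee_fin.
have P0 : {ae mes, forall x, P x -> ((EFin \o w)^\+ x = 0)%E}.
  apply: z => //; have := m12A _ mP; rewrite /= /density => ->.
  apply: integral0_eq => x; rewrite /P /= => wx.
  by rewrite funenegE/= max_r// lee_fin oppr_le0.
have N0 : {ae mes, forall x, N x -> ((EFin \o w)^\- x = 0)%E}.
  apply: z => //; have := m12A _ mN; rewrite /= /density => <-.
  apply: integral0_eq => x; rewrite /N /= => wx.
  by rewrite funeposE/= max_r// lee_fin.
apply: filterS2 P0 N0 => x hP hN; have [wx|/ltW wx] := leP 0 (w x).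
  have := hP wx; rewrite funeposE/= max_l ?lee_fin// => -[] //.
have := hN wx; rewrite funenegE/= max_l ?lee_fin ?oppr_ge0// => -[] /eqP.
by rewrite oppr_eq0 => /eqP.
Qed.

End fundamental_lemma.

(** * Translations and weak derivatives *)

Section segment_integral.
Context (R : realType) (d : nat).
Local Notation leb := (@lebesgue_measure R).
Implicit Types (a b : 'rV[R]_d -> R) (e x : 'rV[R]_d).
Variable t : R.
Hypothesis t0 : 0 <= t.
Let I : set R := `[0, t]%classic.

(** Integral of [a] along the segment from [x] to [x + s0 *: e]: the value expected for u(x + s0 e)
    - u(x) when [a] is the derivative of [u] along [e]. The indicator keeps the whole line as
    domain, which suits Fubini. *)
Definition segint (s0 : R) a e x : R :=
  \int[leb]_s (\1_(`[0, s0]%classic : set R) s * a (x + s *: e)).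

Let mI : measurable (I : set (measurableTypeR R)).
Proof. exact: measurable_itv. Qed.

Let lebI : leb I = t%:E.
Proof.
rewrite lebesgue_measure_itv/= lte_fin; case: ltP => [_|h].
  by rewrite oppr0 adde0.
by congr EFin; apply/eqP; rewrite eq_le t0 h.
Qed.

Let integral_indicI : (\int[leb]_s (\1_I s)%:E = t%:E)%E.
Proof. by rewrite integral_indic// setIT; exact: lebI. Qed.

Let measurable_line e :
  measurable_fun setT (fun p : measurableTypeR R * 'rV[R]_d => p.2 + p.1 *: e).
Proof.
apply: measurable_fun_rV => i; under eq_fun do rewrite !mxE.
apply: measurable_funD.
- exact: (measurableT_comp (@measurable_coord R d i) measurable_snd).
- by apply: measurable_funM => //; exact: measurable_cst.
Qed.

Let kern a e (p : measurableTypeR R * 'rV[R]_d) : R :=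
  \1_I p.1 * a (p.2 + p.1 *: e).

Let measurable_kern a e : measurable_fun setT a -> measurable_fun setT (kern a e).
Proof.
move=> ma; apply: measurable_funM.
  by apply: measurableT_comp => //; exact: measurable_indic.
exact: measurableT_comp (measurable_line e).
Qed.

Let measurable_kern1 a e x : measurable_fun setT a ->
  measurable_fun setT (fun s => kern a e (s, x)).
Proof.
by move=> /(measurable_kern e) mk; exact: measurableT_comp (measurable_pair2 x).
Qed.

Let indic_sqr s : (\1_I s : R) ^+ 2 = \1_I s.
Proof. by rewrite indicE -natrX; case: (_ \in _). Qed.

Lemma integral_kern_sqr a e : sqint mes a ->
  (\int[mes]_x \int[leb]_s ((\1_I s * a (x + s *: e)) ^+ 2)%:E =
   t%:E * \int[mes]_x (a x ^+ 2)%:E)%E.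
Proof.
move=> [ma _]; have mk := measurable_kern e ma.
rewrite -(fubini_tonelli (m1 := leb) (m2 := mes) (fun p => (kern a e p ^+ 2)%:E))//;
  last 2 first.
- exact: measurable_sqrE.
- by move=> p; rewrite lee_fin sqr_ge0.
transitivity (\int[leb]_s ((\1_I s)%:E * \int[mes]_x (a x ^+ 2)%:E))%E.
  apply: eq_integral => s _; rewrite /kern /=.
  under eq_integral do rewrite exprMn indic_sqr.
  have mas : measurable_fun setT (fun x => a (x + s *: e)).
    exact: measurableT_comp (measurable_shift (s *: e)).
  rewrite integral_EFinZl//; last 2 first.
  - exact: measurable_funX.
  - by move=> x; rewrite sqr_ge0.
  congr (_ * _)%E.
  apply: (ge0_integral_shift (s *: e) (f := fun x => (a x ^+ 2)%:E)).
  - exact: measurable_sqrE.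
  - by move=> x; rewrite lee_fin sqr_ge0.
rewrite ge0_integralZr//.
- by rewrite integral_indicI.
- by apply/measurable_EFinP; exact: measurable_indic.
- by apply: integral_ge0 => x _; rewrite lee_fin sqr_ge0.
Qed.

Lemma ae_sqint_segment a e : sqint mes a ->
  {ae mes, forall x, sqint leb (fun s => \1_I s * a (x + s *: e))}.
Proof.
move=> sa; have mk := measurable_kern e sa.1.
have mF : measurable_fun setT (fun x => \int[leb]_s (kern a e (s, x) ^+ 2)%:E)%E.
  apply: (measurable_fun_fubini_tonelli_G (m1 := leb) (fun p => (kern a e p ^+ 2)%:E)).
  - exact: measurable_sqrE.
  - by move=> p; rewrite lee_fin sqr_ge0.
have F0 x : (0 <= \int[leb]_s (kern a e (s, x) ^+ 2)%:E)%E.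
  by apply: integral_ge0 => s _; rewrite lee_fin sqr_ge0.
have iF : mes.-integrable setT (fun x => \int[leb]_s (kern a e (s, x) ^+ 2)%:E)%E.
  apply/integrableP; split=> //.
  under eq_integral do rewrite gee0_abs//.
  rewrite [X in (X < _)%E](integral_kern_sqr e sa) lte_mul_pinfty ?lee_fin//.
  exact: sa.2.
apply: filterS (integrable_ae measurableT iF) => x /(_ Logic.I).
rewrite ge0_fin_numE// => Fx; split=> //.
exact: (measurable_kern1 e x sa.1).
Qed.

Let segintE a e x : segint t a e x = dot leb (\1_I) (fun s => \1_I s * a (x + s *: e)).
Proof. by apply: eq_Rintegral => s _; rewrite mulrA -expr2 indic_sqr. Qed.

Let indic_sqint : sqint leb (\1_I : R -> R).
Proof.
split; first exact: measurable_indic.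
under eq_integral do rewrite indic_sqr.
by rewrite integral_indicI ltry.
Qed.

Lemma measurable_segint a e : measurable_fun setT a ->
  measurable_fun setT (segint t a e).
Proof.
move=> ma; have mk : measurable_fun setT (EFin \o kern a e).
  by apply/measurable_EFinP; exact: measurable_kern.
have -> : segint t a e = fine \o (fun x =>
    \int[leb]_s (EFin \o kern a e)^\+ (s, x) -
    \int[leb]_s (EFin \o kern a e)^\- (s, x))%E.
  apply/funext => x /=; rewrite /segint /Rintegral integralE.
  have -> : ((fun s => (\1_I s * a (x + s *: e)%R)%:E)^\+ =
      (fun s => (EFin \o kern a e)^\+ (s, x)))%E.
    exact: (funepos_comp (EFin \o kern a e) (fun s => (s, x))).
  have -> : ((fun s => (\1_I s * a (x + s *: e)%R)%:E)^\- =
      (fun s => (EFin \o kern a e)^\- (s, x)))%E.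
    exact: (funeneg_comp (EFin \o kern a e) (fun s => (s, x))).
  by [].
apply: measurableT_comp => //.
apply: emeasurable_funB.
- apply: (measurable_fun_fubini_tonelli_G (m1 := leb) (EFin \o kern a e)^\+%E).
  + exact: measurable_funepos.
  + by move=> p; exact: funepos_ge0.
- apply: (measurable_fun_fubini_tonelli_G (m1 := leb) (EFin \o kern a e)^\-%E).
  + exact: measurable_funeneg.
  + by move=> p; exact: funeneg_ge0.
Qed.

(** Cauchy-Schwarz on the segment gives one factor [t], Tonelli with translation invariance the
    other. *)
Lemma segint_le a e : sqint mes a ->
  (\int[mes]_x (segint t a e x ^+ 2)%:E <= (t ^+ 2)%:E * \int[mes]_x (a x ^+ 2)%:E)%E.
Proof.
move=> sa; have mk := measurable_kern e sa.1.
have F0 x : (0 <= \int[leb]_s (kern a e (s, x) ^+ 2)%:E)%E.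
  by apply: integral_ge0 => s _; rewrite lee_fin sqr_ge0.
have mF : measurable_fun setT (fun x => \int[leb]_s (kern a e (s, x) ^+ 2)%:E)%E.
  apply: (measurable_fun_fubini_tonelli_G (m1 := leb) (fun p => (kern a e p ^+ 2)%:E)).
  - exact: measurable_sqrE.
  - by move=> p; rewrite lee_fin sqr_ge0.
rewrite expr2 EFinM -muleA -(integral_kern_sqr e sa).
have t0' : (0 <= t%:E)%E by rewrite lee_fin.
rewrite -ge0_integralZl//; last by move=> x _; exact: F0.
apply: ae_ge0_le_integral => //.
- by move=> x _; rewrite lee_fin sqr_ge0.
- by apply: measurable_sqrE; apply: measurable_segint; exact: sa.1.
- by move=> x _; apply: mule_ge0 => //; exact: F0.
- exact: measurable_funeM.
apply: filterS (ae_sqint_segment e sa) => x sx _.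
rewrite segintE -(dot_sqrE sx) -EFinM lee_fin.
apply: le_trans (dot_CS indic_sqint sx) _; rewrite ler_wpM2r ?dot_ge0//.
rewrite dot_sqr; under eq_Rintegral do rewrite indic_sqr.
by rewrite /Rintegral integral_indicI.
Qed.

Lemma segint_sqint a e : sqint mes a -> sqint mes (segint t a e).
Proof.
move=> sa; split; first by apply: measurable_segint; exact: sa.1.
apply: le_lt_trans (segint_le e sa) _.
by rewrite lte_mul_pinfty ?lee_fin ?sqr_ge0//; exact: sa.2.
Qed.

Lemma shift_sqint a x : sqint mes a -> sqint mes (fun y => a (y + x)).
Proof.
move=> [ma sa]; split; first exact: measurableT_comp (measurable_shift x).
rewrite (ge0_integral_shift x (f := fun y => (a y ^+ 2)%:E))//.
- exact: measurable_sqrE.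
- by move=> y; rewrite lee_fin sqr_ge0.
Qed.

Lemma segint_dot a b e : sqint mes a -> sqint mes b ->
  dot mes (segint t a e) b =
  \int[leb]_s (\1_I s * \int[mes]_x (a (x + s *: e) * b x)).
Proof.
move=> sa sb; have mk := measurable_kern e sa.1.
pose h (p : measurableTypeR R * 'rV[R]_d) := (kern a e p * b p.2)%:E.
have mb2 : measurable_fun setT (fun p : measurableTypeR R * 'rV[R]_d => b p.2).
  by apply: measurableT_comp => //; exact: sb.1.
have mh : measurable_fun setT h by apply/measurable_EFinP; exact: measurable_funM.
have ih : (leb \x mes)%E.-integrable setT h.
  apply/integrable12ltyP => //.
  (* Joint integrability comes from |a b| <= a^2 + b^2: by translation invariance the integral over
     [x] is at most [K] for every [s] in the segment. *)
  pose K : \bar R := (\int[mes]_x (a x ^+ 2)%:E + \int[mes]_x (b x ^+ 2)%:E)%E.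
  have K0 : (0 <= K)%E.
    by rewrite adde_ge0//; apply: integral_ge0 => x _; rewrite lee_fin sqr_ge0.
  have Koo : (K < +oo)%E by rewrite lte_add_pinfty//; [exact: sa.2|exact: sb.2].
  apply: (@le_lt_trans _ _ (\int[leb]_s ((\1_I s)%:E * K))%E); last first.
    rewrite ge0_integralZr//; last by apply/measurable_EFinP; exact: measurable_indic.
    by rewrite integral_indicI lte_mul_pinfty ?lee_fin.
  apply: ge0_le_integral => //.
  - by move=> s _; exact: integral_ge0.
  - apply: (measurable_fun_fubini_tonelli_F (abse \o h)).
      exact: measurableT_comp.
    by move=> p; exact: abse_ge0.
  - under eq_fun do rewrite muleC; apply: measurable_funeM.
    by apply/measurable_EFinP; exact: measurable_indic.
  move=> s _.
  have mas : measurable_fun setT (fun x => a (x + s *: e)).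
    by apply: measurableT_comp (measurable_shift (s *: e)); exact: sa.1.
  have mb := sb.1.
  have -> : K = (\int[mes]_x (a (x + s *: e)%R ^+ 2 + b x ^+ 2)%:E)%E.
    rewrite integral_EFinD//; last 4 first.
    - exact: measurable_funX.
    - exact: measurable_funX.
    - by move=> x; rewrite sqr_ge0.
    - by move=> x; rewrite sqr_ge0.
    congr (_ + _)%E; apply/esym.
    apply: (ge0_integral_shift (s *: e) (f := fun y => (a y ^+ 2)%:E)).
    - by apply: measurable_sqrE; exact: sa.1.
    - by move=> y; rewrite lee_fin sqr_ge0.
  rewrite -integral_EFinZl//; last 2 first.
  - by apply: measurable_funD; exact: measurable_funX.
  - by move=> x; rewrite addr_ge0// sqr_ge0.
  apply: le_integral_EFin => //.
  - apply: measurableT_comp => //; apply: measurable_funM => //.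
    by rewrite /kern /=; apply: measurable_funM.
  - by apply: measurable_funM => //; apply: measurable_funD; exact: measurable_funX.
  - move=> x; rewrite /kern /= !normrM -mulrA ger0_norm// ler_wpM2l//.
    rewrite -(real_normK (num_real (a _))) -(real_normK (num_real (b _))).
    have := sqr_ge0 (`|a (x + s *: e)| - `|b x|).
    have := normr_ge0 (a (x + s *: e)); have := normr_ge0 (b x); nra.
have F := Fubini ih.
rewrite /dot /Rintegral; congr fine.
transitivity (\int[mes]_x \int[leb]_s h (s, x))%E.
  apply: ae_eq_integral => //.
  - apply/measurable_EFinP; apply: measurable_funM; last exact: sb.1.
    by apply: measurable_segint; exact: sa.1.
  - exact: (measurable_fubini_G ih).
  apply: filterS (ae_sqint_segment e sa) => x sx _.
  have ix : leb.-integrable setT (fun s => (\1_I s * a (x + s *: e))%:E).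
    have := sqint_mul indic_sqint sx; congr (_.-integrable _ _).
    by apply/funext => s /=; rewrite mulrA -expr2 indic_sqr.
  rewrite /h /kern /=.
  under eq_integral do rewrite mulrC EFinM.
  rewrite integralZl// EFinM muleC; congr (_ * _)%E.
  by rewrite /segint /Rintegral fineK//; exact: integrable_fin_num ix.
rewrite -F; apply: eq_integral => s _; rewrite /h /kern /=.
under eq_integral do rewrite -mulrA EFinM.
have iab := sqint_mul (shift_sqint (s *: e) sa) sb.
rewrite integralZl// EFinM; congr (_ * _)%E.
by rewrite /Rintegral fineK//; exact: integrable_fin_num iab.
Qed.

End segment_integral.

(** * Translation differences as integrals of the weak derivative *)

Section translation.
Context (R : realType) (d : nat).
Local Notation leb := (@lebesgue_measure R).
Implicit Types (u g : 'rV[R]_d -> R) (f : 'I_d -> R -> R).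

Lemma smooth_csupp_primitive (h : R -> R) : smooth h -> csupp h ->
  exists H : R -> R, forall y, is_derive y (1 : R) H (h y).
Proof.
move=> sh [A [B AB]]; have ch := smooth_continuous sh.
have ih : leb.-integrable setT (EFin \o h).
  have iAB : leb.-integrable `[A, B]%classic (EFin \o h).
    apply: continuous_compact_integrable; first exact: segment_compact.
    exact: continuous_subspaceT.
  rewrite integrable_mkcond// in iAB.
  rewrite (_ : EFin \o h = (EFin \o h) \_ `[A, B]%classic)//.
  apply/funext => y /=; rewrite patchE; case: ifPn => // /negP yAB.
  have [->//|/AB hy] := eqVneq (h y) 0.
  by exfalso; apply: yAB; rewrite inE /= in_itv/=.
exists (fun y => \int[leb]_(x in `]-oo, y]) h x) => y.
have iy : leb.-integrable [set` Interval -oo%O (BRight (y + 1))] (EFin \o h).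
  exact: integrableS ih.
have yu : y < y + 1 by rewrite ltrDl.
have [dh hE] := @continuous_FTC1 R h -oo%O y (y + 1) yu iy
  (ltNyr y) (ch y).
by apply: DeriveDef => //; rewrite -derive1E.
Qed.

Lemma segment_integrable (h : R -> R) (t y : R) : continuous h ->
  leb.-integrable setT
    (EFin \o (fun s => \1_(`[0, t]%classic : set R) s * h (y - s))).
Proof.
move=> ch; have iI : leb.-integrable `[0, t]%classic (EFin \o (fun s => h (y - s))).
  apply: continuous_compact_integrable; first exact: segment_compact.
  apply: continuous_subspaceT => s.
  apply: (@continuous_comp _ _ _ (fun s => y - s) h); last exact: ch.
  by apply: cvgB => //; exact: cvg_cst.
rewrite integrable_mkcond// in iI.
rewrite (_ : EFin \o _ = (EFin \o (fun s => h (y - s))) \_ `[0, t]%classic)//.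
apply/funext => s /=; rewrite patchE indicE.
by case: ifP; rewrite ?mul1r ?mul0r.
Qed.

Lemma primitive_segment (h H : R -> R) (t y : R) : 0 < t -> continuous h ->
  (forall y, is_derive y (1 : R) H (h y)) ->
  \int[leb]_s (\1_(`[0, t]%classic : set R) s * h (y - s)) = H y - H (y - t).
Proof.
move=> t0 ch dH.
pose G s := - H (- 1 * s + y).
have dG s : is_derive s (1 : R) G (h (y - s)).
  have h1 := is_derive_affine (-1) y s.
  have := is_deriveN (@is_derive1_comp _ H (fun s => -1 * s + y) s _ _ (dH (- 1 * s + y)) h1).
  by rewrite mulrN1 opprK mulN1r addrC.
have cG s : {for s, continuous G} by exact: is_derive_continuous (dG s).
have cf : continuous (fun s => h (y - s)).
  move=> s; apply: (@continuous_comp _ _ _ (fun s => y - s) h); last exact: ch.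
  by apply: cvgB => //; exact: cvg_cst.
transitivity (\int[leb]_(s in `[0, t]) h (y - s)).
  rewrite [in RHS]Rintegral_mkcond; apply: eq_Rintegral => s _.
  by rewrite patchE indicE; case: ifP; rewrite ?mul1r ?mul0r.
rewrite /Rintegral (@continuous_FTC2 _ (fun s => h (y - s)) G 0 t)//=.
- by rewrite /G mulN1r mulr0 add0r opprK addrC (addrC _ y).
- exact: continuous_subspaceT.
- split.
  + by move=> s _; have [] := dG s.
  + by apply: cvg_at_right_filter; exact: cG.
  + by apply: cvg_at_left_filter; exact: cG.
- by move=> s _; rewrite derive1E; have [] := dG s.
Qed.

(* Tensor products of one-variable test functions suffice: their span
   determines a square integrable function. *)
Definition weakd j u g := forall f, (forall i, smooth (f i)) ->
  (forall i, csupp (f i)) ->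
  dot mes u (prodf (updf f j (derive1 (f j)))) = - dot mes g (prodf f).

(** Move the translation onto the test function. In the j-th variable f_j(y) - f_j(y - t) is the
    derivative of Psi(y), the integral of f_j(y - s) over s in [0, t], so the weak derivative
    applies to the product with j-th factor Psi. Fubini turns its pairing with [g] into that of the
    segment integral of [g] with the original product. *)
Lemma weakd_segment j u g (t : R) f : 0 < t -> sqint mes u -> sqint mes g ->
  weakd j u g -> (forall i, smooth (f i)) -> (forall i, csupp (f i)) ->
  dot mes (fun x => u (x + t *: basis_vec R j) - u x) (prodf f) =
  dot mes (segint t g (basis_vec R j)) (prodf f).
Proof.
move=> t0 su sg wug sf cf; set e := basis_vec R j.
have sF : sqint mes (prodf f) by apply: test_function_sqint; exact: prodf_test.
have [H dH] := smooth_csupp_primitive (sf j) (cf j).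
pose Psi y := H y - H (y - t).
have PsiE y : Psi y = \int[leb]_s (\1_(`[0, t]%classic : set R) s * f j (y - s)).
  by rewrite (primitive_segment _ t0 (smooth_continuous (sf j)) dH).
have sH : smooth H by exact: smooth_primitive dH (sf j).
have HtE : (fun y => H (y - t)) = (fun y => H (1 * y + - t)).
  by apply/funext => y; rewrite mul1r.
have ftE : (fun y => f j (y - t)) = (fun y => f j (1 * y + - t)).
  by apply/funext => y; rewrite mul1r.
have sPsi : smooth Psi.
  by apply: smoothB => //; rewrite HtE; exact: smooth_affine.
have dPsi : derive1 Psi = fun y => f j y - f j (y - t).
  apply/funext => y; rewrite derive1E.
  have h1 : is_derive y (1 : R) (fun y => H (y - t)) (f j (y - t)).
    rewrite HtE; have := @is_derive1_comp _ H (fun y => 1 * y + - t) y _ _ (dH (1 * y + - t))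
      (is_derive_affine 1 (- t) y).
    by rewrite mulr1 mul1r.
  by have h2 := is_deriveB (dH y) h1; rewrite (@derive_val _ _ _ _ _ _ _ h2).
(* The primitive [H] need not have compact support; its difference over a step [t] does, as the
   integral formula shows. *)
have cPsi : csupp Psi.
  have [A [B AB]] := cf j; exists A, (B + t) => y.
  apply: contraNT => yAB; rewrite PsiE; apply/eqP.
  have f0 (s : R) : 0 <= s <= t -> f j (y - s) = 0.
    move=> /andP[s0 st]; have [//|/AB /andP[h1 h2]] := eqVneq (f j (y - s)) 0.
    by move: yAB => /negP; case; apply/andP; split; lra.
  rewrite -[RHS](mul0r (fine (leb setT))) -Rintegral_cst//; apply: eq_Rintegral => s _.
  rewrite indicE; case: (boolP (s \in _)) => [|_]; last by rewrite mul0r.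
  by rewrite inE /= in_itv/= mul1r => st; exact: f0 st.
have sft : smooth (fun y => f j (y - t)) by rewrite ftE; exact: smooth_affine.
have cft : csupp (fun y => f j (y - t)).
  have [A [B AB]] := cf j; exists (A + t), (B + t) => y /AB /andP[h1 h2].
  by apply/andP; split; lra.
have sFt : sqint mes (fun x => prodf f (x - t *: e)).
  exact: shift_sqint.
have FtE x : prodf f (x - t *: e) = prodf (updf f j (fun y => f j (y - t))) x.
  by rewrite -scaleNr prodf_shift.
have sut : sqint mes (fun x => u (x + t *: e)) by exact: shift_sqint.
have h1 : dot mes (fun x => u (x + t *: e)) (prodf f) =
          dot mes u (fun x => prodf f (x - t *: e)).
  rewrite /dot -(integral_shift (t *: e) (f := fun x => u x * prodf f (x - t *: e))).
    by apply: eq_Rintegral => x _; rewrite addrK.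
  by apply: measurable_funM; [exact: su.1|exact: sFt.1].
rewrite dotBl// h1.
have KE : (fun x => prodf f x - prodf f (x - t *: e)) =
    prodf (updf f j (derive1 Psi)).
  apply/funext => x; rewrite FtE !prodf_updf dPsi [X in X - _](bigD1 j)//=; ring.
have -> : dot mes u (fun x => prodf f (x - t *: e)) - dot mes u (prodf f) =
    - dot mes u (prodf (updf f j (derive1 Psi))).
  by rewrite -KE (dotC _ u (fun x => _ - _)) dotBl// opprB !(dotC _ _ u).
have -> : updf f j (derive1 Psi) =
    updf (updf f j Psi) j (derive1 (updf f j Psi j)).
  apply/funext => i; rewrite /updf eqxx; case: eqP => //.
rewrite wug ?opprK; last 2 first.
- exact: updf_smooth.
- exact: updf_csupp.
have -> : prodf (updf f j Psi) = segint t (prodf f) (- e).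
  apply/funext => x; rewrite /segint prodf_updf PsiE mulrC -RintegralZl//; last first.
    by apply: segment_integrable; exact: smooth_continuous.
  apply: eq_Rintegral => s _; rewrite scalerN -scaleNr prodf_shift prodf_updf; ring.
rewrite dotC (segint_dot (ltW t0))// (segint_dot (ltW t0))//.
apply: eq_Rintegral => s _; congr (_ * _).
rewrite -(integral_shift (s *: e)); last first.
  apply: measurable_funM; last exact: sg.1.
  by apply: (shift_sqint _ sF).1.
by apply: eq_Rintegral => x _; rewrite scalerN addrK mulrC.
Qed.

(** By duality and the fundamental lemma the difference equals the segment integral of [g] almost
    everywhere, so [segint_le] applies. *)
Lemma translation_le j u g (t : R) : 0 <= t -> sqint mes u -> sqint mes g ->
  weakd j u g ->
  (\int[mes]_x ((u (x + t *: basis_vec R j)%R - u x) ^+ 2)%:E <=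
   (t ^+ 2)%:E * \int[mes]_x (g x ^+ 2)%:E)%E.
Proof.
rewrite le_eqVlt => /predU1P[<- su sg _|t0 su sg wug].
  under eq_integral do rewrite scale0r addr0 subrr expr0n.
  by rewrite integral0 expr0n mul0e.
set e := basis_vec R j.
have sS : sqint mes (segint t g e) by apply: segint_sqint => //; exact: ltW.
have sD : sqint mes (fun x => u (x + t *: e) - u x).
  by apply: sqintB => //; exact: shift_sqint.
have z : {ae mes, forall x, u (x + t *: e) - u x - segint t g e x = 0}.
  apply: (fundamental_lemma (w := fun x => u (x + t *: e) - u x - segint t g e x)).
    exact: sqintB.
  move=> f sf cf; have sF : sqint mes (prodf f).
    by apply: test_function_sqint; exact: prodf_test.
  have := dotBl sD sS sF; rewrite /dot => ->.
  by apply/eqP; rewrite subr_eq0; apply/eqP; exact: weakd_segment.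
apply: le_trans (segint_le (ltW t0) e sg).
rewrite le_eqVlt; apply/orP; left; apply/eqP; apply: ge0_ae_eq_integral => //.
- by apply: measurable_sqrE; exact: sD.1.
- by apply: measurable_sqrE; exact: sS.1.
- by move=> x _; rewrite lee_fin sqr_ge0.
- by move=> x _; rewrite lee_fin sqr_ge0.
by apply: filterS z => x /eqP; rewrite subr_eq0 => /eqP ->.
Qed.

End translation.

(** * Averages of translation differences *)

Section averaging.
Context (R : realType) (d : nat).
Implicit Types (x z : 'rV[R]_d).

(** Source of the factor 2^d in the translation bounds; its size does not matter. *)
Lemma sqr_sum_le n (a : 'I_n -> R) :
  (\sum_i a i) ^+ 2 <= 2 ^+ n * \sum_i a i ^+ 2.
Proof.
elim: n a => [|n IH] a; first by rewrite !big_ord0 expr0n/= mulr0.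
rewrite !big_ord_recl [2 ^+ n.+1]exprS; have := IH (fun i => a (lift ord0 i)).
set S := \sum_(i < n) a (lift ord0 i).
set T := \sum_(i < n) a (lift ord0 i) ^+ 2 => h.
have : 1 <= 2 ^+ n :> R by rewrite exprn_ege1// ler1n.
set p := 2 ^+ n in h * => p1.
have h2 : a ord0 ^+ 2 <= p * a ord0 ^+ 2 by rewrite ler_peMl ?sqr_ge0.
have := sqr_ge0 (a ord0 - S); nra.
Qed.

Variables (u : 'rV[R]_d -> R) (g : 'I_d -> 'rV[R]_d -> R).
Hypotheses (su : sqint mes u) (sg : forall j, sqint mes (g j)).
Hypothesis wug : forall j, weakd j u (g j).

Let Dg : R := \sum_j dot mes (g j) (g j).

Let Dg0 : 0 <= Dg.
Proof. by apply: sumr_ge0 => j _; exact: dot_ge0. Qed.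

(** A negative step is read from its other end point. *)
Lemma translation_le_abs j (t : R) :
  (\int[mes]_x ((u (x + t *: basis_vec R j)%R - u x) ^+ 2)%:E <=
   (t ^+ 2 * dot mes (g j) (g j))%:E)%E.
Proof.
rewrite EFinM dot_sqrE//; have [t0|t0] := leP 0 t; first exact: translation_le.
rewrite -sqrrN; apply: le_trans (translation_le _ su (sg j) (@wug j)); last first.
  by rewrite oppr_ge0 ltW.
set e := basis_vec R j.
have sd : sqint mes (fun x => u (x + t *: e) - u x).
  by apply: sqintB => //; exact: shift_sqint.
rewrite -(ge0_integral_shift (- t *: e)
  (f := fun x => ((u (x + t *: e) - u x) ^+ 2)%:E)).
- rewrite le_eqVlt; apply/orP; left; apply/eqP; apply: eq_integral => x _.
  by rewrite -addrA -scalerDl addNr scale0r addr0 -sqrrN opprB.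
- by apply: measurable_sqrE; exact: sd.1.
- by move=> x; rewrite lee_fin sqr_ge0.
Qed.

(* The shift [z] is performed one coordinate at a time. *)
Lemma translate_bound (r : R) z : (forall i, `|z ord0 i| <= r) ->
  (\int[mes]_x ((u (x + z)%R - u x) ^+ 2)%:E <= (2 ^+ d * r ^+ 2 * Dg)%:E)%E.
Proof.
move=> zr.
pose zk (k : nat) : 'rV[R]_d := \row_i (if (i < k)%N then z ord0 i else 0).
pose D (k : 'I_d) x := u (x + zk k.+1) - u (x + zk k).
have zk0 : zk 0%N = 0 by apply/rowP => i; rewrite !mxE.
have zkd : zk d = z by apply/rowP => i; rewrite !mxE ltn_ord.
have zkS (k : 'I_d) : zk k.+1 = zk k + z ord0 k *: basis_vec R k.
  apply/rowP => i; rewrite !mxE eqxx /= ltnS leq_eqVlt.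
  have [->|ik] := eqVneq i k; first by rewrite eqxx ltnn add0r mulr1.
  by rewrite (negbTE (_ : (i : nat) != k))// mulr0 addr0.
have uD x : u (x + z) - u x = \sum_k D k x.
  rewrite -zkd -[u x in LHS](_ : u (x + zk 0%N) = _); last by rewrite zk0 addr0.
  by rewrite -(telescope_sumr (fun k => u (x + zk k)))// big_mkord.
have sD k : sqint mes (D k) by apply: sqintB; exact: shift_sqint.
have mD2 k : measurable_fun setT (fun x => D k x ^+ 2).
  by apply: measurable_funX; exact: (sD k).1.
have msum (s : seq 'I_d) : measurable_fun setT (fun x => \sum_(k <- s) D k x ^+ 2).
  exact: measurable_sum.
under eq_integral do rewrite uD.
apply: (@le_trans _ _ (\int[mes]_x (2 ^+ d * \sum_k D k x ^+ 2)%:E)%E).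
  apply: le_integral_EFin.
  - apply: measurable_funX; apply: measurable_sum => k; exact: (sD k).1.
  - by apply: measurable_funM => //; exact: (msum (index_enum _)).
  - by move=> x; exact: sqr_ge0.
  - by move=> x; exact: sqr_sum_le.
rewrite integral_EFinZl ?exprn_ge0//; last first.
  by move=> x; apply: sumr_ge0 => k _; exact: sqr_ge0.
rewrite -mulrA EFinM lee_wpmul2l ?lee_fin ?exprn_ge0//.
under eq_integral do rewrite -sumEFin.
rewrite ge0_integral_sum//; last 2 first.
- by move=> k; exact/measurable_EFinP.
- by move=> k x _; rewrite lee_fin sqr_ge0.
rewrite /Dg mulr_sumr -sumEFin; apply: lee_sum => k _.
have mDz : measurable_fun setT (fun x => u (x + z ord0 k *: basis_vec R k) - u x).
  by apply: (sqintB (shift_sqint _ su) su).1.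
apply: (@le_trans _ _ (\int[mes]_x
    ((u (x + z ord0 k *: basis_vec R k)%R - u x) ^+ 2)%:E)%E).
  rewrite -[leRHS](ge0_integral_shift (zk k)); last 2 first.
  - exact: measurable_sqrE.
  - by move=> x; rewrite lee_fin sqr_ge0.
  rewrite le_eqVlt; apply/orP; left; apply/eqP; apply: eq_integral => x _.
  by rewrite /D zkS addrA.
apply: le_trans (translation_le_abs _ _) _; rewrite lee_fin ler_wpM2r ?dot_ge0//.
by rewrite -real_normK ?num_real// lerXn2r ?nnegrE// (le_trans _ (zr k)).
Qed.

(** Shared by the tail and the interior estimate. The weight [W] selects pairs with large potential
    at x + z in the former, and pairs x, x + z in a common cell in the latter. Integrating over [x]
    first leaves [translate_bound] for each [z] in [Z]. *)
Lemma averaging_bound (W : 'rV[R]_d * 'rV[R]_d -> R) (Z : set 'rV[R]_d) (r : R) :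
  measurable Z -> measurable_fun setT W -> (forall p, 0 <= W p) ->
  (forall x z, W (x, z) <= \1_Z z) -> (forall z, Z z -> forall i, `|z ord0 i| <= r) ->
  (\int[mes]_x \int[mes]_z (W (x, z) * (u (x + z)%R - u x) ^+ 2)%:E <=
   mes Z * (2 ^+ d * r ^+ 2 * Dg)%:E)%E.
Proof.
move=> mZ mW W0 WZ Zr.
have mk : measurable_fun setT (fun p => W p * (u (p.1 + p.2) - u p.1) ^+ 2).
  apply: measurable_funM => //; apply: measurable_funX; apply: measurable_funB.
    by apply: measurableT_comp (@measurable_add R d); exact: su.1.
  by apply: measurableT_comp => //; exact: su.1.
rewrite (fubini_tonelli (fun p => (W p * (u (p.1 + p.2)%R - u p.1) ^+ 2)%:E))/=;
  last 2 first.
- exact/measurable_EFinP.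
- by move=> p; rewrite lee_fin mulr_ge0// sqr_ge0.
have Kd0 : 0 <= 2 ^+ d * r ^+ 2 * Dg
  by apply: mulr_ge0 => //; apply: mulr_ge0; [exact: exprn_ge0|exact: sqr_ge0].
apply: (@le_trans _ _ (\int[mes]_z ((\1_Z z)%:E * (2 ^+ d * r ^+ 2 * Dg)%:E))%E);
    last first.
  rewrite ge0_integralZr//.
  - by rewrite integral_indic// setIT.
  - by apply/measurable_EFinP; exact: measurable_indic.
apply: ge0_le_integral => //.
- by move=> z _; apply: integral_ge0 => x _; rewrite lee_fin mulr_ge0// sqr_ge0.
- apply: (measurable_fun_fubini_tonelli_G
    (fun p => (W p * (u (p.1 + p.2)%R - u p.1) ^+ 2)%:E)).
  + exact/measurable_EFinP.
  + by move=> p; rewrite lee_fin mulr_ge0// sqr_ge0.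
- by apply: emeasurable_funM => //; apply/measurable_EFinP; exact: measurable_indic.
move=> z _.
have muz : measurable_fun setT (fun x => (u (x + z) - u x) ^+ 2).
  by apply: measurable_funX; apply: (sqintB (shift_sqint _ su) su).1.
apply: (@le_trans _ _ (\int[mes]_x (\1_Z z * (u (x + z)%R - u x) ^+ 2)%:E)%E).
  apply: le_integral_EFin.
  - by apply: measurable_funM => //; apply: measurableT_comp (measurable_pair2 z).
  - exact: measurable_funM.
  - by move=> x; rewrite mulr_ge0// sqr_ge0.
  - by move=> x; rewrite ler_wpM2r ?sqr_ge0.
rewrite integral_EFinZl//; last by move=> x; exact: sqr_ge0.
rewrite indicE; case: (boolP (z \in Z)) => [|_]; last by rewrite !mul0e.
by rewrite inE => /Zr zr; rewrite !mul1e; exact: translate_bound.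
Qed.

End averaging.

(** * The compactness estimate *)

Section tail.
Context (R : realType) (d : nat).
Implicit Types (x y z : 'rV[R]_d).

Lemma cubeE (r : R) y : 0 < r -> cube r y =
  [set x : 'rV[R]_d | forall i, (`[y ord0 i, y ord0 i + r]%classic : set R) (x ord0 i)].
Proof.
move=> r0; apply/seteqP; split => [_ [q qQ <-] i|x xQ].
  have := qQ i; rewrite /= in_itv/= !mxE => /andP[q0 q1].
  by apply/andP; split; nra.
exists (r^-1 *: (x - y)); last first.
  by rewrite scalerA divff ?lt0r_neq0// scale1r subrK.
move=> i; have := xQ i; rewrite /= in_itv/= !mxE => /andP[h1 h2].
apply/andP; split; first by rewrite mulr_ge0 ?subr_ge0// invr_ge0 ltW.
by rewrite ler_pdivrMl// mulr1 lerBlDl.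
Qed.

Lemma measurable_cube (r : R) y : 0 < r -> measurable (cube r y).
Proof.
move=> r0; rewrite cubeE//.
apply: (measurable_prod_set (I := fun i => `[y ord0 i, y ord0 i + r]%classic)) => i.
exact: measurable_itv.
Qed.

Lemma mes_prod_itv (I : 'I_d -> set (measurableTypeR R)) (r : R) :
  (forall i, measurable (I i)) -> (forall i, lebesgue_measure (I i) = r%:E) ->
  mes [set x : 'rV[R]_d | forall i, I i (x ord0 i)] = (r ^+ d)%:E.
Proof.
move=> mI Ir; rewrite mes_prod_set//; under eq_bigr do rewrite Ir.
by rewrite prodEFin prodr_const card_ord.
Qed.

Lemma mes_cube (r : R) y : 0 < r -> mes (cube r y) = (r ^+ d)%:E.
Proof.
move=> r0; rewrite cubeE//.
apply: (mes_prod_itv (I := fun i => `[y ord0 i, y ord0 i + r]%classic)) => i.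
  exact: measurable_itv.
by rewrite lebesgue_measure_itv/= lte_fin ltrDl r0 -EFinB addrC addKr.
Qed.

Lemma cube0_shift (r : R) x z : 0 < r -> cube r x (z + x) = cube r 0 z.
Proof.
move=> r0; rewrite !cubeE//; apply/propext.
by split=> h i; have := h i; rewrite /= !in_itv/= !mxE add0r => /andP[h1 h2];
  apply/andP; split; lra.
Qed.

Lemma mes_cube_setI (r : R) x (E : set 'rV[R]_d) : 0 < r -> measurable E ->
  (mes (cube r x `&` E) = \int[mes]_z (\1_(cube r 0) z * \1_E (x + z)%R)%:E)%E.
Proof.
move=> r0 mE; have mQ := measurable_cube x r0.
rewrite -[X in mes X]setIT -integral_indic//; last exact: measurableI.
rewrite -[LHS](ge0_integral_shift x (f := fun y => (\1_(cube r x `&` E) y)%:E)).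
- apply: eq_integral => z _; rewrite indicI /=; congr (_ * _)%:E.
    by rewrite !indicE; congr (nat_of_bool _)%:R; apply/idP/idP; rewrite !inE cube0_shift.
  by rewrite addrC.
- by apply/measurable_EFinP; apply: measurable_indic; exact: measurableI.
- by move=> y; rewrite lee_fin.
Qed.

Lemma iterated_integral (K : 'rV[R]_d * 'rV[R]_d -> R) :
  measurable_fun setT K -> (forall p, 0 <= K p) ->
  (\int[mes]_x \int[mes]_z (K (x, z))%:E = \int[mes \x mes]_p (K p)%:E)%E.
Proof.
move=> mK K0; rewrite (fubini_tonelli1 (fun p => (K p)%:E))//.
exact/measurable_EFinP.
Qed.

Variables (u : 'rV[R]_d -> R) (g : 'I_d -> 'rV[R]_d -> R) (V : 'rV[R]_d -> R).
Hypotheses (su : sqint mes u) (sg : forall j, sqint mes (g j)).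
Hypothesis wug : forall j, weakd j u (g j).
Hypotheses (mV : measurable_fun setT V) (V0 : forall x, 0 <= V x).
Let v x := Num.sqrt (V x) * u x.
Hypothesis sv : sqint mes v.

Let Dg : R := \sum_j dot mes (g j) (g j).

(* Average [u x ^+ 2 <= 2 (u (x + z) - u x)^2 + 2 u (x + z) ^+ 2] over the [z]
   in the cube with [s <= V (x + z)]. *)
Lemma tail_bound (r gam s : R) (T : set 'rV[R]_d) : 0 < r -> 0 < gam -> 0 < s ->
  measurable T ->
  (forall x, T x -> gam%:E * mes (cube r x) <= mes (cube r x `&` [set y | (s <= V y)%R]))%E ->
  (\int[mes]_x (\1_T x * u x ^+ 2)%:E <=
   (2 / gam * (2 ^+ d * r ^+ 2 * Dg + s^-1 * dot mes v v))%:E)%E.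
Proof.
move=> r0 gam0 s0 mT TV.
pose E := [set y | s <= V y].
have mE : measurable E.
  rewrite -[E]setTI; have mEV : measurable_fun setT (EFin \o V) by exact/measurable_EFinP.
  have := emeasurable_fun_c_infty measurableT mEV s%:E.
  by congr measurable; apply/seteqP; split => x [_ /=]; rewrite lee_fin.
have mZ := measurable_cube 0 r0; have mes_Z := mes_cube 0 r0.
set Z := cube r 0 in mZ mes_Z *.
pose W (p : 'rV[R]_d * 'rV[R]_d) : R := \1_Z p.2 * \1_E (p.1 + p.2).
have mW : measurable_fun setT W.
  apply: measurable_funM.
    by apply: measurableT_comp => //; exact: measurable_indic.
  by apply: measurableT_comp (@measurable_add R d); exact: measurable_indic.
have W0 p : 0 <= W p by rewrite mulr_ge0.
have m0 : 0 < r ^+ d by rewrite exprn_gt0.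
have gm0 : 0 < gam * r ^+ d by rewrite mulr_gt0.
have mu := su.1.
have mu1 : measurable_fun setT (fun p : 'rV[R]_d * 'rV[R]_d => u p.1 ^+ 2).
  by apply: measurable_funX; exact: measurableT_comp.
have mu2 : measurable_fun setT (fun p : 'rV[R]_d * 'rV[R]_d => u (p.1 + p.2) ^+ 2).
  by apply: measurable_funX; exact: measurableT_comp (@measurable_add R d).
have mu3 : measurable_fun setT
    (fun p : 'rV[R]_d * 'rV[R]_d => (u (p.1 + p.2) - u p.1) ^+ 2).
  apply: measurable_funX; apply: measurable_funB.
    exact: measurableT_comp (@measurable_add R d).
  exact: measurableT_comp.
have mT' : measurable_fun setT (fun x => \1_T x * u x ^+ 2).
  by apply: measurable_funM; [exact: measurable_indic|exact: measurable_funX].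
(* For [x] in [T] the weight has integral at least [gam * r ^+ d] in [z]: this is the hypothesis on
   the cube at [x], moved to the origin. *)
have step1 : ((gam * r ^+ d)%:E * \int[mes]_x (\1_T x * u x ^+ 2)%:E <=
    \int[mes \x mes]_p (W p * u p.1 ^+ 2)%:E)%E.
  rewrite -iterated_integral; last 2 first.
  - exact: measurable_funM.
  - by move=> p; rewrite mulr_ge0 ?sqr_ge0.
  rewrite -integral_EFinZl ?(ltW gm0)//; last first.
    by move=> x; rewrite mulr_ge0 ?sqr_ge0.
  apply: ge0_le_integral => //.
  - move=> x _; rewrite lee_fin; apply: mulr_ge0; first exact: ltW.
    by rewrite mulr_ge0 ?sqr_ge0.
  - by apply/measurable_EFinP; exact: measurable_funM.
  - apply: (measurable_fun_fubini_tonelli_F (fun p => (W p * u p.1 ^+ 2)%:E)).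
      by apply/measurable_EFinP; exact: measurable_funM.
    by move=> p; rewrite lee_fin mulr_ge0 ?sqr_ge0.
  move=> x _; rewrite [in leLHS]indicE.
  case: (boolP (x \in T)) => [|_]; last first.
    rewrite mul0r mulr0; apply: integral_ge0 => z _.
    by rewrite lee_fin mulr_ge0 ?sqr_ge0.
  rewrite inE => Tx; have := TV x Tx.
  rewrite mes_cube// -/E mes_cube_setI// => h.
  rewrite [leRHS](_ : _ = \int[mes]_z (u x ^+ 2 * W (x, z))%:E)%E; last first.
    by apply: eq_integral => z _; rewrite mulrC.
  rewrite integral_EFinZl ?sqr_ge0//; last first.
    exact: (measurableT_comp mW (measurable_pair1 x)).
  rewrite mul1r mulrC EFinM; apply: lee_wpmul2l; first by rewrite lee_fin sqr_ge0.
  by rewrite EFinM.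
have step2 : (\int[mes \x mes]_p (W p * u p.1 ^+ 2)%:E <=
   2%:E * \int[mes \x mes]_p (W p * (u (p.1 + p.2)%R - u p.1) ^+ 2)%:E +
   2%:E * \int[mes \x mes]_p (W p * u (p.1 + p.2)%R ^+ 2)%:E)%E.
  have mA : measurable_fun setT (fun p => W p * (u (p.1 + p.2) - u p.1) ^+ 2).
    exact: measurable_funM.
  have mB : measurable_fun setT (fun p => W p * u (p.1 + p.2) ^+ 2).
    exact: measurable_funM.
  have A0 p : 0 <= W p * (u (p.1 + p.2) - u p.1) ^+ 2 by rewrite mulr_ge0 ?sqr_ge0.
  have B0 p : 0 <= W p * u (p.1 + p.2) ^+ 2 by rewrite mulr_ge0 ?sqr_ge0.
  rewrite -!integral_EFinZl// -integral_EFinD//.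
  - apply: le_integral_EFin.
    + exact: measurable_funM.
    + by apply: measurable_funD; exact: measurable_funM.
    + by move=> p; rewrite mulr_ge0 ?sqr_ge0.
    (* The right side minus the left side is [W p] times this square. *)
    + move=> p; have := W0 p; have := sqr_ge0 (2 * u (p.1 + p.2) - u p.1).
      set a := u _; set b := u _; set w := W p => h1 h2.
      by have := mulr_ge0 h2 h1; nra.
  - exact: measurable_funM.
  - exact: measurable_funM.
  - by move=> p; rewrite mulr_ge0.
  - by move=> p; rewrite mulr_ge0.
have step3 : (\int[mes \x mes]_p (W p * (u (p.1 + p.2)%R - u p.1) ^+ 2)%:E <=
   (r ^+ d * (2 ^+ d * r ^+ 2 * Dg))%:E)%E.
  rewrite -iterated_integral; last 2 first.
  - exact: measurable_funM.
  - by move=> p; rewrite mulr_ge0 ?sqr_ge0.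
  rewrite EFinM -mes_Z; apply: (averaging_bound su sg wug mZ mW W0).
  - by move=> x z; rewrite /W/= ler_piMr// indicE; case: (_ \in _).
  - move=> z; rewrite /Z cubeE// => zZ i; have := zZ i.
    by rewrite /= in_itv/= mxE add0r => /andP[z0 z1]; rewrite ger0_norm.
(* For fixed [z] the shift disappears by translation invariance; what remains is the integral of u^2
   over [E], where 1 <= V / s. *)
have step4 : (\int[mes \x mes]_p (W p * u (p.1 + p.2)%R ^+ 2)%:E <=
   (r ^+ d * (s^-1 * dot mes v v))%:E)%E.
  rewrite -iterated_integral; last 2 first.
  - exact: measurable_funM.
  - by move=> p; rewrite mulr_ge0 ?sqr_ge0.
  rewrite (fubini_tonelli (fun p => (W p * u (p.1 + p.2)%R ^+ 2)%:E))/=; last 2 first.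
  - by apply/measurable_EFinP; exact: measurable_funM.
  - by move=> p; rewrite lee_fin mulr_ge0 ?sqr_ge0.
  have mEu : measurable_fun setT (fun x => \1_E x * u x ^+ 2).
    by apply: measurable_funM; [exact: measurable_indic|exact: measurable_funX].
  have Eu0 x : 0 <= \1_E x * u x ^+ 2 by rewrite mulr_ge0 ?sqr_ge0.
  apply: (@le_trans _ _
      (\int[mes]_z ((\1_Z z)%:E * \int[mes]_x (\1_E x * u x ^+ 2)%:E))%E).
    rewrite le_eqVlt; apply/orP; left; apply/eqP; apply: eq_integral => z _.
    under eq_integral do rewrite /W /= -mulrA.
    rewrite integral_EFinZl//.
      congr (_ * _)%E.
      have mEu' : measurable_fun setT (fun x => (\1_E x * u x ^+ 2)%:E : \bar R).
        exact/measurable_EFinP.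
      by apply: (ge0_integral_shift z mEu') => x; rewrite lee_fin.
    exact: measurableT_comp mEu (measurable_shift z).
  have k0 : (0 <= \int[mes]_x (\1_E x * u x ^+ 2)%:E)%E.
    by apply: integral_ge0 => x _; rewrite lee_fin.
  rewrite ge0_integralZr//; last first.
    by apply/measurable_EFinP; exact: measurable_indic.
  have -> : (\int[mes]_z (\1_Z z)%:E = (r ^+ d)%:E)%E.
    by rewrite integral_indic// setIT; exact: mes_Z.
  rewrite EFinM; apply: lee_wpmul2l.
    by rewrite lee_fin ltW.
  rewrite EFinM dot_sqrE// -integral_EFinZl//.
  - apply: le_integral_EFin => //.
      by apply: measurable_funM => //; apply: measurable_funX; exact: sv.1.
    move=> x; rewrite /v exprMn sqr_sqrtr// [leRHS]mulrA.
    rewrite ler_wpM2r ?sqr_ge0//.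
    rewrite indicE; case: (boolP (x \in E)) => [|_]; last by rewrite mulr_ge0// invr_ge0 ltW.
    by rewrite inE /E /= => sV; rewrite ler_pdivlMl// mulr1.
  - by apply: measurable_funX; exact: sv.1.
  - by move=> x; exact: sqr_ge0.
  - by rewrite invr_ge0 ltW.
have gmE : (0 < (gam * r ^+ d)%:E :> \bar R)%E by rewrite lte_fin.
have gmfin : (gam * r ^+ d)%:E \is a @fin_num R by [].
suff : ((gam * r ^+ d)%:E * \int[mes]_x (\1_T x * u x ^+ 2)%:E <=
    (gam * r ^+ d)%:E *
      (2 / gam * (2 ^+ d * r ^+ 2 * Dg + s^-1 * dot mes v v))%:E)%E.
  by rewrite (lee_pmul2l gmfin gmE).
apply: le_trans step1 _; apply: le_trans step2 _.
apply: (@le_trans _ _ (2%:E * (r ^+ d * (2 ^+ d * r ^+ 2 * Dg))%:E +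
    2%:E * (r ^+ d * (s^-1 * dot mes v v))%:E)%E).
  by apply: leeD; apply: lee_wpmul2l.
rewrite -!EFinM -EFinD lee_fin le_eqVlt; apply/orP; left; apply/eqP.
by field; apply/andP; split; exact: lt0r_neq0.
Qed.

End tail.

(** * Poincare inequality on small cells *)

Section interior.
Context (R : realType) (d : nat).
Implicit Types (x y z : 'rV[R]_d).
Variables (u : 'rV[R]_d -> R) (g : 'I_d -> 'rV[R]_d -> R).
Hypotheses (su : sqint mes u) (sg : forall j, sqint mes (g j)).
Hypothesis wug : forall j, weakd j u (g j).

Let Dg : R := \sum_j dot mes (g j) (g j).

Lemma indicM_id (T : Type) (A : set T) (t : T) : \1_A t * \1_A t = \1_A t :> R.
Proof. by rewrite indicE; case: (_ \in _); rewrite ?mulr1 ?mulr0. Qed.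

Lemma indic_mul_sqint (A : set 'rV[R]_d) : measurable A ->
  sqint mes (fun x => \1_A x * u x).
Proof.
move=> mA; split.
  by apply: measurable_funM; [exact: measurable_indic|exact: su.1].
apply: le_lt_trans su.2; apply: le_integral_EFin.
- by apply: measurable_funX; apply: measurable_funM;
    [exact: measurable_indic|exact: su.1].
- by apply: measurable_funX; exact: su.1.
- by move=> x; exact: sqr_ge0.
- by move=> x; rewrite exprMn ler_piMl ?sqr_ge0// expr2 indicM_id indicE.
Qed.

Lemma dot_indic_mul (A : set 'rV[R]_d) :
  dot mes (fun x => \1_A x * u x) (\1_A) = dot mes u (\1_A).
Proof. by apply: eq_Rintegral => x _; rewrite mulrAC indicM_id mulrC. Qed.

(** Variance identity: averaged over pairs in [A], the squared difference is twice the variance of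
    [u] on [A]. It converts a bound on translation differences into the Poincare inequality. *)
Lemma double_integral (A : set 'rV[R]_d) : box_set A ->
  (\int[mes]_x \int[mes]_z
     (\1_A x * \1_A (x + z)%R * (u (x + z)%R - u x) ^+ 2)%:E =
   (2 * dot mes (\1_A) (\1_A) *
      dot mes (fun x => \1_A x * u x) (fun x => \1_A x * u x) -
    2 * dot mes u (\1_A) ^+ 2)%:E)%E.
Proof.
move=> bA; have mA := box_set_measurable bA; have sp := indic_box_sqint bA.
have sq := indic_mul_sqint mA.
rewrite -(dot_indic_mul A).
set p : 'rV[R]_d -> R := \1_A in sp sq *; set q := (fun x => p x * u x) in sq *.
set a := dot mes p p; set S := dot mes q q; set M := dot mes q p.
have inner x : (\int[mes]_z (p x * p (x + z)%R * (u (x + z)%R - u x) ^+ 2)%:E =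
    (p x * (S - 2 * u x * M + u x ^+ 2 * a))%:E)%E.
  (* For fixed [x] this is u - u(x) cut off to [A]; after the substitution y = x + z its squared
     norm is the inner integral. *)
  pose h y := - u x * p y + q y.
  have sh : sqint mes h by exact: sqint_lin.
  have hE y : h y ^+ 2 = p y * (u y - u x) ^+ 2.
    have -> : h y = p y * (u y - u x) by rewrite /h /q; ring.
    by rewrite exprMn [p y ^+ 2]indicM_id.
  have <- : dot mes h h = S - 2 * u x * M + u x ^+ 2 * a.
    rewrite dot_linl// (dotC _ p h) (dotC _ q h) !dot_linl// (dotC _ p q) -/a -/S -/M.
    ring.
  rewrite EFinM dot_sqrE// -integral_EFinZl//; last 2 first.
  - by apply: measurable_funX; exact: sh.1.
  - by move=> y; exact: sqr_ge0.
  rewrite -[RHS](ge0_integral_shift x (f := fun y => (p x * h y ^+ 2)%:E)).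
  - by apply: eq_integral => z _; rewrite hE (addrC z) mulrA.
  - apply/measurable_EFinP; apply: measurable_funM => //.
    by apply: measurable_funX; exact: sh.1.
  - by move=> y; rewrite lee_fin mulr_ge0 ?sqr_ge0// /p indicE.
under eq_integral do rewrite inner.
have -> : 2 * a * S - 2 * M ^+ 2 =
    dot mes (fun x => S * p x + (- (2 * M)) * q x) p + dot mes (fun x => a * q x) q.
  have -> : dot mes (fun x => a * q x) q = a * S.
    have := dot_linl a sq (@sqint0 _ _ _ mes) sq.
    have -> : dot mes (fun=> 0) q = 0.
      by rewrite /dot; under eq_Rintegral do rewrite mul0r; rewrite Rintegral_cst// mul0r.
    by rewrite addr0 => <-; apply: eq_Rintegral => x _; rewrite addr0.
  rewrite dot_linl//; last exact: sqintZ.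
  have -> : dot mes (fun x => - (2 * M) * q x) p = - (2 * M) * M.
    have := dot_linl (- (2 * M)) sq (@sqint0 _ _ _ mes) sp.
    have -> : dot mes (fun=> 0) p = 0.
      by rewrite /dot; under eq_Rintegral do rewrite mul0r; rewrite Rintegral_cst// mul0r.
    by rewrite addr0 => <-; apply: eq_Rintegral => x _; rewrite addr0.
  rewrite -/a; ring.
have s1 : sqint mes (fun x => S * p x + (- (2 * M)) * q x).
  by apply: sqint_lin => //; exact: sqintZ.
have i1 := sqint_mul s1 sp; have i2 := sqint_mul (sqintZ a sq) sq.
rewrite /dot -RintegralD// /Rintegral fineK; last first.
  have i3 := integrableD measurableT i1 i2.
  by have := integrable_fin_num measurableT i3.
apply: eq_integral => x _; congr EFin; rewrite /q.
have := indicM_id A x; rewrite -/p => pp.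
have -> : (S * p x + - (2 * M) * (p x * u x)) * p x + a * (p x * u x) * (p x * u x) =
  (p x * p x) * (S - 2 * u x * M + u x ^+ 2 * a) by ring.
by rewrite pp.
Qed.

Variables (N delta : R) (m : nat).
Hypotheses (delta0 : 0 < delta) (mdelta : m%:R * delta = 2 * N).

(** Half-open, so that the cells are disjoint and tile the half-open cube with sides from [- N] to
    [N]. *)
Definition cell (k : {ffun 'I_d -> 'I_m}) : set 'rV[R]_d := [set x | forall i,
  (`]- N + (k i)%:R * delta, - N + (k i).+1%:R * delta]%classic : set R) (x ord0 i)].

Lemma cell_box k : box_set (cell k).
Proof.
by exists (fun i => `]- N + (k i)%:R * delta, - N + (k i).+1%:R * delta]%classic) => // i;
  exact: is_ocitv.
Qed.

Lemma dot_cell k : dot mes (\1_(cell k) : _ -> R) (\1_(cell k)) = delta ^+ d.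
Proof.
have mk := box_set_measurable (cell_box k).
have mes_cell : mes (cell k) = (delta ^+ d)%:E.
  apply: (mes_prod_itv (I := fun i =>
    `]- N + (k i)%:R * delta, - N + (k i).+1%:R * delta]%classic)) => i.
    exact: measurable_itv.
  rewrite lebesgue_measure_itv/= lte_fin ltrD2l ltr_pM2r// ltr_nat ltnSn -EFinB.
  by congr EFin; rewrite -natr1; ring.
rewrite /dot; under eq_Rintegral do rewrite indicM_id.
rewrite /Rintegral (_ : (\int[mes]_x _)%E = (delta ^+ d)%:E)//.
by rewrite integral_indic// setIT; exact: mes_cell.
Qed.

Lemma cell_inj k k' x : cell k x -> cell k' x -> k = k'.
Proof.
move=> kx k'x; apply/ffunP => i; apply/val_inj => /=.
have := kx i; have := k'x i; rewrite /= !in_itv/= => /andP[h1 h2] /andP[h3 h4].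
apply/eqP; rewrite eqn_leq -[X in X && _]ltnS -[X in _ && X]ltnS.
by apply/andP; split; rewrite -(ltr_nat R) -(ltr_pM2r delta0); lra.
Qed.

Lemma cell_cover x : (forall i, (`]- N, N]%classic : set R) (x ord0 i)) ->
  exists k, cell k x.
Proof.
move=> xQ.
have nat_between (y : R) n : 0 < y <= n%:R ->
    exists i : 'I_n, (i : nat)%:R < y <= i.+1%:R.
  elim: n => [|n IH] /andP[y0 yn]; first by exfalso; lra.
  have [ny|yn'] := ltP n%:R y; first by exists ord_max; rewrite /= ny yn.
  have [|i hi] := IH; first by rewrite y0 yn'.
  by exists (lift ord_max i); rewrite lift_max.
have /choice[k kP] i : exists k : 'I_m,
    (`]- N + k%:R * delta, - N + k.+1%:R * delta]%classic : set R) (x ord0 i).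
  have [|k /andP[k1 k2]] := nat_between ((x ord0 i + N) / delta) m.
    have := xQ i; rewrite /= in_itv/= => /andP[h1 h2].
    by rewrite divr_gt0 ?ler_pdivrMr// ?mdelta; lra.
  exists k; rewrite /= in_itv/=; move: k1 k2.
  by rewrite ltr_pdivlMr// ler_pdivrMr// => h1 h2; apply/andP; split; lra.
by exists [ffun i => k i] => i; rewrite ffunE.
Qed.

(** Sum the variance identity over the cells. In the gradient term one factor 2^d comes from the
    measure of the set of admissible shifts relative to a cell, the other from [translate_bound]; a
    further factor 1/2 is given away. *)
Lemma interior_bound :
  (\int[mes]_x (\1_[set x : 'rV[R]_d | forall i, (`]- N, N]%classic : set R) (x ord0 i)] x *
     u x ^+ 2)%:E <=
   (2 ^+ d * 2 ^+ d * delta ^+ 2 * Dg +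
    (delta ^+ d)^-1 * \sum_k dot mes u (\1_(cell k)) ^+ 2)%:E)%E.
Proof.
set Q := [set x | _].
have dd0 : 0 < delta ^+ d by rewrite exprn_gt0.
have mc k := box_set_measurable (cell_box k).
have mi k : measurable_fun setT (\1_(cell k) : _ -> R) by exact: measurable_indic.
have mu := su.1.
pose q k x := \1_(cell k) x * u x.
have sq k : sqint mes (q k) by exact: indic_mul_sqint.
pose S k := dot mes (q k) (q k).
have mQ : measurable Q.
  apply: (measurable_prod_set (I := fun=> `]- N, N]%classic)) => i.
  exact: measurable_itv.
have step1 : (\int[mes]_x (\1_Q x * u x ^+ 2)%:E <= (\sum_k S k)%:E)%E.
  rewrite -sumEFin; under eq_bigr do rewrite /S dot_sqrE//.
  rewrite -ge0_integral_sum//; last 2 first.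
  - by move=> k; apply: measurable_sqrE; exact: (sq k).1.
  - by move=> k x _; rewrite lee_fin sqr_ge0.
  under [leRHS]eq_integral do rewrite sumEFin.
  apply: le_integral_EFin.
  - by apply: measurable_funM; [exact: measurable_indic|exact: measurable_funX].
  - by apply: measurable_sum => k; apply: measurable_funX; exact: (sq k).1.
  - by move=> x; rewrite mulr_ge0 ?sqr_ge0.
  - move=> x; have s0 : 0 <= \sum_k q k x ^+ 2.
      by apply: sumr_ge0 => k _; exact: sqr_ge0.
    rewrite [in leLHS]indicE; case: (boolP (x \in Q)) => [|_]; last by rewrite mul0r.
    rewrite inE mul1r => /cell_cover[k kx].
    rewrite (bigD1 k)//= {1}/q indicE mem_set// mul1r lerDl.
    by apply: sumr_ge0 => k' _; exact: sqr_ge0.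
(* Two points of one cell differ by less than [delta] in each coordinate, so all admissible shifts
   lie in this cube centred at the origin. *)
pose Z := cube (2 * delta) (const_mx (- delta)) : set 'rV[R]_d.
have dd2 : 0 < 2 * delta by rewrite mulr_gt0.
have mZ : measurable Z by exact: measurable_cube.
pose W (p : 'rV[R]_d * 'rV[R]_d) : R :=
  \sum_k \1_(cell k) p.1 * \1_(cell k) (p.1 + p.2).
have mW1 k : measurable_fun setT (fun p : 'rV[R]_d * 'rV[R]_d =>
    \1_(cell k) p.1 * \1_(cell k) (p.1 + p.2) : R).
  apply: measurable_funM; first exact: measurableT_comp.
  exact: measurableT_comp (@measurable_add R d).
have mW : measurable_fun setT W by exact: measurable_sum.
have W0 p : 0 <= W p by apply: sumr_ge0 => k _; rewrite mulr_ge0.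
have WZ x z : W (x, z) <= \1_Z z.
  rewrite /W /=.
  have [[k0 k0x]|nk] := pselect (exists k, cell k x); last first.
    rewrite big1// => k _; rewrite [X in X * _]indicE memNset ?mul0r//.
    by move=> kx; apply: nk; exists k.
  rewrite (bigD1 k0)//= [X in _ + X]big1 ?addr0 => [|k kk0]; last first.
    rewrite [X in X * _]indicE memNset ?mul0r// => kx.
    by move: kk0; rewrite (cell_inj kx k0x) eqxx.
  rewrite [X in X * _]indicE mem_set// mul1r !indicE.
  case: (boolP (x + z \in _)) => [|_]; last by rewrite ler0n.
  rewrite inE => xz; rewrite mem_set// /Z cubeE// => i.
  have := k0x i; have := xz i; rewrite /= !in_itv/= !mxE -natr1.
  by move=> /andP[h1 h2] /andP[h3 h4]; apply/andP; split; lra.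
have X_le : (\sum_k \int[mes]_x \int[mes]_z
     (\1_(cell k) x * \1_(cell k) (x + z)%R * (u (x + z)%R - u x) ^+ 2)%:E <=
    ((2 * delta) ^+ d * (2 ^+ d * delta ^+ 2 * Dg))%:E)%E.
  have mu3 : measurable_fun setT
      (fun p : 'rV[R]_d * 'rV[R]_d => (u (p.1 + p.2) - u p.1) ^+ 2).
    apply: measurable_funX; apply: measurable_funB.
      exact: measurableT_comp (@measurable_add R d).
    exact: measurableT_comp.
  pose K k (p : 'rV[R]_d * 'rV[R]_d) : R :=
    \1_(cell k) p.1 * \1_(cell k) (p.1 + p.2) * (u (p.1 + p.2) - u p.1) ^+ 2.
  have mK k : measurable_fun setT (K k) by exact: measurable_funM.
  have K0 k p : 0 <= K k p by rewrite mulr_ge0 ?sqr_ge0// mulr_ge0.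
  under eq_bigr => k _ do rewrite (@iterated_integral _ _ (K k) (mK k) (K0 k)).
  rewrite -ge0_integral_sum//; last 2 first.
  - by move=> k; exact/measurable_EFinP.
  - by move=> k p _; rewrite lee_fin.
  have -> : (\int[mes \x mes]_p \sum_k (K k p)%:E =
     \int[mes \x mes]_p (W p * (u (p.1 + p.2)%R - u p.1) ^+ 2)%:E)%E.
    by apply: eq_integral => p _; rewrite sumEFin /W mulr_suml.
  rewrite -iterated_integral; last 2 first.
  - exact: measurable_funM.
  - by move=> p; rewrite mulr_ge0 ?sqr_ge0.
  rewrite EFinM -(mes_cube (const_mx (- delta)) dd2).
  apply: (averaging_bound su sg wug mZ mW W0 WZ) => z.
  rewrite /Z cubeE// => zZ i; have := zZ i.
  by rewrite /= in_itv/= mxE => /andP[h1 h2]; rewrite ler_norml; apply/andP; split; lra.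
move: X_le; under eq_bigr => k _ do
  rewrite (double_integral (cell_box k)) dot_cell -/(S k).
rewrite sumEFin lee_fin => X_le.
apply: le_trans step1 _; rewrite lee_fin.
have sumE : \sum_k (2 * delta ^+ d * S k - 2 * dot mes u (\1_(cell k)) ^+ 2) =
    2 * delta ^+ d * \sum_k S k - 2 * \sum_k dot mes u (\1_(cell k)) ^+ 2.
  by rewrite big_split/= -mulr_sumr sumrN -mulr_sumr.
rewrite sumE in X_le.
set SS := \sum_k S k in X_le *; set MM := \sum_k _ ^+ 2 in X_le *.
have X_le2 : 2 * (delta ^+ d * SS) <=
    2 * MM + delta ^+ d * (2 ^+ d * 2 ^+ d * delta ^+ 2 * Dg).
  rewrite exprMn in X_le; lra.
have E0 : 0 <= delta ^+ d * (2 ^+ d * 2 ^+ d * delta ^+ 2 * Dg).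
  apply: mulr_ge0; first exact: ltW.
  apply: mulr_ge0; last by apply: sumr_ge0 => j _; exact: dot_ge0.
  by rewrite mulr_ge0 ?sqr_ge0// mulr_ge0 ?exprn_ge0.
rewrite -(ler_pM2l dd0) mulrDr [X in _ <= _ + X]mulrA divff ?lt0r_neq0// mul1r; lra.
Qed.

End interior.

(** * Choice of the parameters in the compactness estimate *)

Section compactness.
Context (R : realType) (d : nat) (V : 'rV[R]_d -> R) (r0 : R) (gamma : R -> R).
Hypotheses (mV : measurable_fun setT V) (V0 : forall x, 0 <= V x).
Hypothesis r0_gt0 : 0 < r0.
Hypothesis gamma01 : forall r, 0 < r <= r0 -> 0 < gamma r < 1.
Hypothesis gamma_limsup :
  limf_esup (fun r : R => (r ^- 2 * gamma r)%:E) (0 : R)^'+ = +oo%E.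
Hypothesis V_rearrangement : forall r, 0 < r <= r0 ->
  tends_to_pinfty_at_infinity
    (fun y => rearrangement V (cube r y) ((gamma r)%:E * mes (cube r y))%E).

(** The limsup is an infimum of suprema over right neighbourhoods of 0, so the supremum over the
    interval from 0 to [r0] is already infinite. *)
Lemma gamma_large (M : R) : exists2 r, 0 < r <= r0 & M < r ^- 2 * gamma r.
Proof.
pose I := [set r : R | 0 < r <= r0].
have nI : (0 : R)^'+ I.
  near=> r; apply/andP; split; first by near: r; exact: nbhs_right_gt.
  by near: r; exact: nbhs_right_le.
have : (M%:E < ereal_sup [set (r ^- 2 * gamma r)%:E | r in I])%E.
  apply: (@lt_le_trans _ _ +oo%E); first exact: ltry.
  by rewrite -gamma_limsup; apply: ereal_inf_lbound; exists I.
by move=> /ereal_sup_gt[_ [r rr <-]]; rewrite lte_fin => Mr; exists r.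
Unshelve. all: by end_near. Qed.

Lemma large_potential (r s : R) : 0 < r <= r0 -> 0 < s -> exists N : R,
  forall y, N <= enorm y ->
   ((gamma r)%:E * mes (cube r y) <= mes (cube r y `&` [set x | (s <= V x)%R]))%E.
Proof.
move=> rr s0; have r_gt0 : 0 < r by case/andP: rr.
(* The supremum in the rearrangement need not be attained; the margin 1 gives an admissible level
   strictly above [s], and lowering the level enlarges the set. *)
have [N NP] := V_rearrangement rr (s + 1); exists N => y /NP.
rewrite /rearrangement => h.
have : (s%:E < ereal_sup [set s'%:E | s' in [set s' : R | (0 < s')%R /\
    ((gamma r)%:E * mes (cube r y) <= mes (cube r y `&` [set x | (s' <= V x)%R]))%E]])%E.
  move: h; rewrite le_max => /orP[|].
    by rewrite lee_fin leNgt ltr_wpDl// ltW.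
  by apply: lt_le_trans; rewrite lte_fin ltrDl.
move=> /ereal_sup_gt[_ [s' [_ h'] <-]]; rewrite lte_fin => ss'.
apply: (le_trans h'); apply: le_measure.
- rewrite inE; apply: measurableI; first exact: measurable_cube.
  rewrite -[X in measurable X]setTI.
  have mEV : measurable_fun setT (EFin \o V) by exact/measurable_EFinP.
  have := emeasurable_fun_c_infty measurableT mEV s'%:E.
  by congr measurable; apply/seteqP; split => x [_ /=]; rewrite lee_fin.
- rewrite inE; apply: measurableI; first exact: measurable_cube.
  rewrite -[X in measurable X]setTI.
  have mEV : measurable_fun setT (EFin \o V) by exact/measurable_EFinP.
  have := emeasurable_fun_c_infty measurableT mEV s%:E.
  by congr measurable; apply/seteqP; split => x [_ /=]; rewrite lee_fin.
- by move=> x [cx /= sx]; split=> //=; rewrite (le_trans (ltW ss')).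
Qed.

Lemma coord_le_enorm (x : 'rV[R]_d) i : `|x ord0 i| <= enorm x.
Proof.
rewrite /enorm -sqrtr_sqr ler_wsqrtr// (bigD1 i)//= lerDl sumr_ge0// => j _.
exact: sqr_ge0.
Qed.

Lemma real_compactness (e : R) : 0 < e ->
  exists (I : finType) (A : I -> set 'rV[R]_d) (c : R),
    [/\ forall k, box_set (A k), 0 <= c &
    forall (u : 'rV[R]_d -> R) (g : 'I_d -> 'rV[R]_d -> R),
      sqint mes u -> (forall j, sqint mes (g j)) -> (forall j, weakd j u (g j)) ->
      sqint mes (fun x => Num.sqrt (V x) * u x) ->
      dot mes u u <= e * (\sum_j dot mes (g j) (g j) +
        dot mes (fun x => Num.sqrt (V x) * u x) (fun x => Num.sqrt (V x) * u x)) +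
        c * \sum_k dot mes u (\1_(A k)) ^+ 2].
Proof.
move=> e0; set p : R := 2 ^+ d; have p0 : 0 < p by rewrite exprn_gt0.
(* This threshold makes the coefficient of the gradient in the tail bound at most [e / 2]. *)
have [r rr gr] := gamma_large (4 * p / e).
have r_gt0 : 0 < r by case/andP: rr.
have /andP[gam0 _] := gamma01 rr; set gam := gamma r in gr gam0.
have r2 : 2 / gam * (p * r ^+ 2) <= e / 2.
  have rr0 : 0 < r ^+ 2 by rewrite exprn_gt0.
  rewrite ltr_pdivrMr// -mulrA [X in _ < X]mulrC ltr_pdivlMr// in gr.
  rewrite ler_pdivlMr// (_ : _ * 2 = 4 * p * r ^+ 2 / gam); last first.
    by field; exact: lt0r_neq0.
  rewrite ler_pdivrMr//; lra.
(* Makes the coefficient of the potential energy in the tail bound equal to [e / 2]. *)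
pose s := 4 / (gam * e); have s0 : 0 < s by rewrite divr_gt0 ?mulr_gt0.
have sE : 2 / gam * s^-1 = e / 2.
  by rewrite /s; field; apply/andP; split; exact: lt0r_neq0.
have [N0 N0P] := large_potential rr s0.
pose N := `|N0| + 1; have N_gt0 : 0 < N by rewrite ltr_wpDl.
(* Cells of side [2 * N / m] so small that the interior uses at most the other half of [e] for the
   gradient. *)
have [m m_gt0 mP] : exists2 m : nat, (0 < m)%N & p * p * (2 * N / m%:R) ^+ 2 <= e / 2.
  pose q := p * p * (2 * N) ^+ 2 * 2 / e.
  have q0 : 0 <= q.
    apply: divr_ge0; last exact: ltW.
    by rewrite mulr_ge0// mulr_ge0 ?sqr_ge0// mulr_ge0// ltW.
  exists (Num.bound q).+1 => //.
  have qm : q <= (Num.bound q).+1%:R.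
    by rewrite -natr1 ler_wpDr// ltW// archi_boundP.
  set M := (Num.bound q).+1%:R in qm *; have M1 : 1 <= M :> R by rewrite ler1n.
  have M0 : 0 < M by rewrite (lt_le_trans ltr01).
  rewrite expr_div_n mulrA ler_pdivrMr ?exprn_gt0//.
  move: qm; rewrite /q ler_pdivrMr// => qm.
  have : M * e <= M ^+ 2 * e by rewrite ler_pM2r// expr2 ler_peMl// ltW.
  lra.
pose delta := 2 * N / m%:R.
have delta0 : 0 < delta by rewrite divr_gt0 ?mulr_gt0 ?ltr0n.
have mdelta : m%:R * delta = 2 * N.
  by rewrite /delta mulrC divfK// pnatr_eq0 -lt0n.
exists ({ffun 'I_d -> 'I_m} : finType), (fun k => cell N delta k), (delta ^+ d)^-1; split.
- by move=> k; exact: cell_box.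
- by rewrite invr_ge0 exprn_ge0// ltW.
move=> u g su sg wug sv.
set Dg := \sum_j _;
pose Vu := dot mes (fun x => Num.sqrt (V x) * u x) (fun x => Num.sqrt (V x) * u x).
pose Q := [set x : 'rV[R]_d | forall i, (`]- N, N]%classic : set R) (x ord0 i)].
have mQ : measurable Q.
  apply: (measurable_prod_set (I := fun=> `]- N, N]%classic)) => i.
  exact: measurable_itv.
have TV x : (~` Q) x ->
    (gam%:E * mes (cube r x) <= mes (cube r x `&` [set y | (s <= V y)%R]))%E.
  move=> nQx; apply: N0P.
  have [i xi] : exists i, ~ (`]- N, N]%classic : set R) (x ord0 i).
    by apply/existsNP => h; exact: nQx.
  apply: le_trans (coord_le_enorm x i); rewrite leNgt; apply/negP => h.
  apply: xi; rewrite /= in_itv/=; have := ler_norm N0; have h1 := ltr0_norm.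
  have : `|x ord0 i| < N by rewrite (lt_le_trans h)// /N; have := ler_norm N0; lra.
  by rewrite ltr_norml => /andP[-> /ltW ->].
have tail := tail_bound su sg wug mV V0 sv r_gt0 gam0 s0 (measurableC mQ) TV.
have inner := interior_bound su sg wug delta0 mdelta.
rewrite -lee_fin dot_sqrE//.
apply: (@le_trans _ _ (\int[mes]_x (\1_(~` Q) x * u x ^+ 2)%:E +
    \int[mes]_x (\1_Q x * u x ^+ 2)%:E)%E).
  have mu2 : measurable_fun setT (fun x => u x ^+ 2) by apply: measurable_funX; exact: su.1.
  rewrite -integral_EFinD//.
  - rewrite le_eqVlt; apply/orP; left; apply/eqP; apply: eq_integral => x _.
    rewrite -mulrDl !indicE in_setC; case: (_ \in _);
      by rewrite ?add0r ?addr0 mul1r.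
  - by apply: measurable_funM => //; apply: measurable_indic; exact: measurableC.
  - by apply: measurable_funM => //; exact: measurable_indic.
  - by move=> x; rewrite mulr_ge0 ?sqr_ge0.
  - by move=> x; rewrite mulr_ge0 ?sqr_ge0.
apply: le_trans (leeD tail inner) _; rewrite -EFinD lee_fin -/Dg -/Vu -/p.
have Dg0 : 0 <= Dg by apply: sumr_ge0 => j _; exact: dot_ge0.
rewrite -/Vu mulrDr addrA lerD2r.
have h1 : 2 / gam * (p * r ^+ 2) * Dg <= e / 2 * Dg by rewrite ler_wpM2r.
have h2 : p * p * delta ^+ 2 * Dg <= e / 2 * Dg by rewrite ler_wpM2r.
have h3 : 2 / gam * s^-1 * Vu = e / 2 * Vu by rewrite sE.
have Vu0 : 0 <= Vu by exact: dot_ge0.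
have h4 : 0 <= e * Vu by rewrite mulr_ge0// ltW.
lra.
Qed.

End compactness.

(** * Complex-valued functions *)

(* [R[i]] carries no [R]-module structure; its alias [Rcomplex R] does. *)
Section complex_functions.
Context (R : realType) (d : nat).
Local Notation F := ('rV[R]_d -> Rcomplex R).
Implicit Types (u v w : F) (k : R) (p q : 'rV[R]_d -> R).

Definition fRe u : 'rV[R]_d -> R := fun x => complex.Re (u x).
Definition fIm u : 'rV[R]_d -> R := fun x => complex.Im (u x).

Definition fJ u : F := fun x => 'i%C * u x.

Lemma fReE k u v : fRe (k *: u + v) = (fun x => k * fRe u x + fRe v x).
Proof.
apply/funext => x; rewrite /fRe -[(k *: u + v) x]/(k *: u x + v x).
by case: (u x) => a b; case: (v x).
Qed.

Lemma fImE k u v : fIm (k *: u + v) = (fun x => k * fIm u x + fIm v x).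
Proof.
apply/funext => x; rewrite /fIm -[(k *: u + v) x]/(k *: u x + v x).
by case: (u x) => a b; case: (v x).
Qed.

Lemma fReB u v : fRe (u - v) = (fun x => fRe u x - fRe v x).
Proof.
apply/funext => x; rewrite /fRe -[(u - v) x]/(u x - v x).
by case: (u x) => a b; case: (v x).
Qed.

Lemma fImB u v : fIm (u - v) = (fun x => fIm u x - fIm v x).
Proof.
apply/funext => x; rewrite /fIm -[(u - v) x]/(u x - v x).
by case: (u x) => a b; case: (v x).
Qed.

(* In the shape [k * p x + q x] of the linearity lemmas for [dot]. *)
Lemma fRe_J u : fRe (fJ u) = (fun x => -1 * fIm u x + 0).
Proof.
apply/funext => x; rewrite /fRe /fIm /fJ; case: (u x) => a b /=.
by rewrite mul0r mul1r sub0r mulN1r addr0.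
Qed.

Lemma fIm_J u : fIm (fJ u) = fRe u.
Proof.
apply/funext => x; rewrite /fRe /fIm /fJ; case: (u x) => a b /=.
by rewrite mul0r mul1r add0r.
Qed.

Lemma fJ_lin k u v : fJ (k *: u + v) = k *: fJ u + fJ v.
Proof.
apply/funext => x; rewrite -[RHS]/(k *: (fJ u x) + fJ v x).
rewrite /fJ -[(k *: u + v) x]/(k *: u x + v x).
case: (u x) => a b; case: (v x) => a' b'; apply/eqP.
rewrite eq_complex /=; apply/andP; split; apply/eqP; ring.
Qed.

Definition csq u := sqint mes (fRe u) /\ sqint mes (fIm u).

(** Real part of the complex inner product; pairing with [fJ v] instead gives the imaginary part. *)
Definition rdot u v : R := dot mes (fRe u) (fRe v) + dot mes (fIm u) (fIm v).

Lemma L2P u : L2 u <-> csq u.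
Proof.
split=> [[mR mI Lu]|[[mR sR] [mI sI]]].
  by split; split => //; apply: le_lt_trans Lu; apply: le_integral_EFin;
    rewrite /fRe /fIm; do ?[exact: measurable_funX | move=> x; exact: sqr_ge0 |
    by apply: measurable_funD; exact: measurable_funX
    | by move=> x; rewrite /sqmod ?lerDl ?lerDr sqr_ge0 ].
split => //; rewrite /sqmod integral_EFinD.
- exact: lte_add_pinfty.
- exact: measurable_funX.
- exact: measurable_funX.
- by move=> x; exact: sqr_ge0.
- by move=> x; exact: sqr_ge0.
Qed.

Lemma csq_lin k u v : csq u -> csq v -> csq (k *: u + v).
Proof.
by move=> [? ?] [? ?]; rewrite /csq fReE fImE; split; exact: sqint_lin.
Qed.

Lemma csqB u v : csq u -> csq v -> csq (u - v).
Proof. by move=> [? ?] [? ?]; rewrite /csq fReB fImB; split; exact: sqintB. Qed.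

Lemma csq0 : csq 0.
Proof. by split; exact: sqint0. Qed.

Lemma csqJ u : csq u -> csq (fJ u).
Proof.
move=> [? ?]; rewrite /csq fRe_J fIm_J; split=> //.
by apply: sqint_lin => //; exact: sqint0.
Qed.

Lemma rdotC u v : rdot u v = rdot v u.
Proof. by rewrite /rdot dotC (dotC _ (fIm u)). Qed.

Lemma rdot_linl k u v w : csq u -> csq v -> csq w ->
  rdot (k *: u + v) w = k * rdot u w + rdot v w.
Proof.
by move=> [? ?] [? ?] [? ?]; rewrite /rdot fReE fImE !dot_linl//; ring.
Qed.

Lemma rdotBl u v w : csq u -> csq v -> csq w ->
  rdot (u - v) w = rdot u w - rdot v w.
Proof.
by move=> [? ?] [? ?] [? ?]; rewrite /rdot fReB fImB !dotBl//; ring.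
Qed.

Lemma rdot0l u : csq u -> rdot 0 u = 0.
Proof. by move=> cu; have := rdotBl csq0 csq0 cu; rewrite !subrr. Qed.

Lemma rdot_ge0 u : 0 <= rdot u u.
Proof. by rewrite addr_ge0// dot_ge0. Qed.

Lemma dot_opp p q : sqint mes p -> sqint mes q ->
  dot mes (fun x => -1 * p x + 0) q = - dot mes p q.
Proof.
move=> sp sq; rewrite dot_linl//; last exact: sqint0.
rewrite /dot; under [X in _ + X]eq_Rintegral do rewrite mul0r.
by rewrite Rintegral_cst// mul0r addr0 mulN1r.
Qed.

Lemma rdot_Jl u v : csq u -> csq v -> rdot (fJ u) v = - rdot u (fJ v).
Proof.
move=> [? ?] [? ?]; rewrite /rdot !fRe_J !fIm_J dot_opp//.
by rewrite [dot _ (fRe u) (fun x => -1 * fIm v x + 0)]dotC dot_opp//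
  [dot _ (fIm v) _]dotC opprD opprK addrC.
Qed.

Lemma rdot_JJ u v : csq u -> csq v -> rdot (fJ u) (fJ v) = rdot u v.
Proof.
move=> cu cv; have [? ?] := cu; have [? ?] := cv.
rewrite rdot_Jl//; last exact: csqJ.
have -> : fJ (fJ v) = -1 *: v + 0.
  apply/funext => x; rewrite -[RHS]/(-1 *: v x + 0) /fJ.
  by case: (v x) => a b; apply/eqP; rewrite eq_complex /=; apply/andP; split; apply/eqP; ring.
by rewrite rdotC rdot_linl//; [rewrite rdot0l// rdotC; ring|exact: csq0].
Qed.

Lemma rdot_eq0 u : csq u -> rdot u u = 0 -> {ae mes, forall x, u x = 0}.
Proof.
move=> [sr si]; rewrite /rdot => /eqP; rewrite paddr_eq0 ?dot_ge0//.
move=> /andP[/eqP /(dot_eq0_ae sr) r0 /eqP /(dot_eq0_ae si) i0].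
apply: filterS2 r0 i0 => x; rewrite /fRe /fIm; case: (u x) => a b /= -> ->.
by [].
Qed.

Lemma rdot_ae u u' v v' : csq u -> csq u' -> csq v -> csq v' ->
  {ae mes, forall x, u x = u' x} -> {ae mes, forall x, v x = v' x} ->
  rdot u v = rdot u' v'.
Proof.
move=> [[? _] [? _]] [[? _] [? _]] [[? _] [? _]] [[? _] [? _]] uu vv.
congr (_ + _); apply: dot_ae => //.
- by apply: filterS uu => x; rewrite /fRe => ->.
- by apply: filterS vv => x; rewrite /fRe => ->.
- by apply: filterS uu => x; rewrite /fIm => ->.
- by apply: filterS vv => x; rewrite /fIm => ->.
Qed.

Lemma inner_rdot u v : csq u -> csq v ->
  inner u v = Complex (rdot u v) (rdot u (fJ v)).
Proof.
move=> [sru siu] cv; have [srJ siJ] := csqJ cv; have [srv siv] := cv.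
rewrite /inner /cintegral; congr Complex.
  rewrite /rdot /dot -RintegralD//; [|exact: sqint_mul..].
  apply: eq_Rintegral => x _; rewrite /fRe /fIm; case: (u x) => a b; case: (v x) => a' b' /=.
  ring.
rewrite /rdot /dot -RintegralD//; [|exact: sqint_mul..].
apply: eq_Rintegral => x _; rewrite fRe_J fIm_J /fRe /fIm.
case: (u x) => a b; case: (v x) => a' b' /=.
ring.
Qed.

Lemma rdot_CS u v : csq u -> csq v -> rdot u v ^+ 2 <= rdot u u * rdot v v.
Proof.
move=> cu cv; apply: quadratic_ge0_disc => [|k]; first exact: rdot_ge0.
have -> : rdot u u + 2 * k * rdot u v + k ^+ 2 * rdot v v =
    rdot (k *: v + u) (k *: v + u).
  have cw : csq (k *: v + u) by exact: csq_lin.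
  rewrite rdot_linl// (rdotC v) (rdotC u (_ + _)) !rdot_linl// (rdotC v u); ring.
exact: rdot_ge0.
Qed.

Lemma csq_fast_cvg (f : nat -> F) : (forall n, csq (f n)) ->
  (forall n, rdot (f n.+1 - f n) (f n.+1 - f n) <= 8^-1 ^+ n) ->
  exists g, [/\ csq g,
    forall e, 0 < e -> exists N, forall n, (N <= n)%N ->
      rdot (f n - g) (f n - g) <= e &
    {ae mes, forall x, (fun n => fRe (f n) x) @ \oo --> fRe g x /\
                       (fun n => fIm (f n) x) @ \oo --> fIm g x}].
Proof.
move=> cf f8.
have [n|g1 [s1 e1 ae1]] := @sqint_fast_cvg R _ _ mes (fun n => fRe (f n)) (fun n => (cf n).1).
  by apply: le_trans (f8 n); rewrite /rdot fReB lerDl dot_ge0.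
have [n|g2 [s2 e2 ae2]] := @sqint_fast_cvg R _ _ mes (fun n => fIm (f n)) (fun n => (cf n).2).
  by apply: le_trans (f8 n); rewrite /rdot fImB lerDr dot_ge0.
exists (fun x => Complex (g1 x) (g2 x)); split => //.
- move=> e e0; have h0 : 0 < e / 2 by rewrite divr_gt0.
  have [N1 h1] := e1 _ h0; have [N2 h2] := e2 _ h0.
  exists (maxn N1 N2) => n; rewrite geq_max => /andP[/h1 {}h1 /h2 {}h2].
  by rewrite /rdot fReB fImB [leRHS]splitr lerD.
- by apply: filterS2 ae1 ae2 => x ? ?.
Qed.

End complex_functions.

(** * Weak derivatives of real and imaginary parts *)

Section weak_derivative.
Context (R : realType) (d : nat).
Local Notation F := ('rV[R]_d -> Rcomplex R).
Implicit Types (u v : F) (k : R) (p q : 'rV[R]_d -> R) (j : 'I_d).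

(** Ranges over all test functions, as the Sobolev space requires, whereas [weakd] sees only
    products. *)
Definition wpart j p q := forall phi, test_function phi ->
  dot mes p (fun x => 'D_(basis_vec R j) phi x) = - dot mes q phi.

Lemma weak_partialP j u v :
  weak_partial j u v <-> wpart j (fRe u) (fRe v) /\ wpart j (fIm u) (fIm v).
Proof.
have E w p : cintegral (fun x => (w x : R[i]) * (p x)%:C%C) =
    Complex (dot mes (fRe w) p) (dot mes (fIm w) p).
  rewrite /cintegral; congr Complex; apply: eq_Rintegral => x _;
    rewrite /fRe /fIm; case: (w x) => a b /=; ring.
split=> [h|[h1 h2] phi tp].
  by split=> phi tp; have := h _ tp; rewrite !E => -[].
by rewrite !E h1// h2.
Qed.

Lemma wpart_lin j k p q p' q' : sqint mes p -> sqint mes q -> sqint mes p' ->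
  sqint mes q' -> wpart j p q -> wpart j p' q' ->
  wpart j (fun x => k * p x + p' x) (fun x => k * q x + q' x).
Proof.
move=> sp sq sp' sq' w w' phi tp.
have t0 := test_function_sqint tp; have t1 := test_function_derive_sqint j tp.
by rewrite !dot_linl// w// w'//; ring.
Qed.

Lemma wpart0 j : wpart j (fun=> 0) (fun=> 0).
Proof.
move=> phi tp; rewrite /dot; under eq_Rintegral do rewrite mul0r.
under [in RHS]eq_Rintegral do rewrite mul0r.
by rewrite Rintegral_cst// mul0r oppr0.
Qed.

Lemma wpart_weakd j p q : wpart j p q -> weakd j p q.
Proof.
move=> w f sf cf; rewrite -prodf_derive//; apply: w.
exact: prodf_test.
Qed.

Lemma wpart_unique j p q q' : sqint mes q -> sqint mes q' ->
  wpart j p q -> wpart j p q' -> {ae mes, forall x, q x = q' x}.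
Proof.
move=> sq sq' w w'.
have h : {ae mes, forall x, q x - q' x = 0}.
  apply: fundamental_lemma; first exact: sqintB.
  move=> f sf cf; rewrite -/(dot mes (fun x => q x - q' x) (prodf f)).
  have tf := prodf_test sf cf.
  rewrite dotBl//; last exact: test_function_sqint.
  by apply/eqP; rewrite subr_eq0 -eqr_opp -w// -w'.
by apply: filterS h => x /eqP; rewrite subr_eq0 => /eqP.
Qed.

(** Closedness of the weak derivative: for a fixed test function both sides are continuous in L2 by
    Cauchy-Schwarz. *)
Lemma wpart_cvg j (p q : nat -> 'rV[R]_d -> R) (p0 q0 : 'rV[R]_d -> R) :
  (forall n, sqint mes (p n)) -> (forall n, sqint mes (q n)) ->
  sqint mes p0 -> sqint mes q0 -> (forall n, wpart j (p n) (q n)) ->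
  (forall e, 0 < e -> exists n,
    dot mes (fun x => p n x - p0 x) (fun x => p n x - p0 x) <= e /\
    dot mes (fun x => q n x - q0 x) (fun x => q n x - q0 x) <= e) ->
  wpart j p0 q0.
Proof.
move=> sp sq sp0 sq0 w cvg phi tp.
have t0 := test_function_sqint tp; have t1 := test_function_derive_sqint j tp.
set D := (X in dot _ p0 X = _); set c0 := dot mes p0 D; set c1 := dot mes q0 phi.
set C := dot mes D D + dot mes phi phi.
have C0 : 0 <= C by rewrite addr_ge0// dot_ge0.
have key e : 0 < e -> (c0 + c1) ^+ 2 <= 2 * e * C.
  move=> /cvg[n [h1 h2]].
  have s1 : sqint mes (fun x => p n x - p0 x) by exact: sqintB.
  have s2 : sqint mes (fun x => q n x - q0 x) by exact: sqintB.
  have E : c0 + c1 = - (dot mes (fun x => p n x - p0 x) D + dot mes (fun x => q n x - q0 x) phi).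
    by rewrite !dotBl// w// -/c0 -/c1; ring.
  rewrite E sqrrN; set a := dot _ _ D; set b := dot _ _ phi.
  have ha : a ^+ 2 <= e * dot mes D D.
    by apply: le_trans (dot_CS s1 t1) _; rewrite ler_wpM2r// dot_ge0.
  have hb : b ^+ 2 <= e * dot mes phi phi.
    by apply: le_trans (dot_CS s2 t0) _; rewrite ler_wpM2r// dot_ge0.
  have := sqr_ge0 (a - b); rewrite /C; nra.
apply/eqP; rewrite -addr_eq0 -sqrf_eq0 eq_le sqr_ge0 andbT.
apply/ler_addgt0Pr => e e0; rewrite add0r.
have C1 : 0 < 2 * (C + 1) by rewrite mulr_gt0// ltr_wpDl.
apply: le_trans (key (e / (2 * (C + 1))) (divr_gt0 e0 C1)) _.
rewrite (_ : _ * C = 2 * (e * C) / (2 * (C + 1))); last by rewrite mulrA [in RHS]mulrAC -!mulrA.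
rewrite ler_pdivrMr//.
have eC : 0 <= e * C by rewrite mulr_ge0// ltW.
lra.
Qed.

End weak_derivative.

(** * The Schrodinger form and its spectrum *)

Section form_domain.
Context (R : realType) (d : nat) (V : 'rV[R]_d -> R).
Hypotheses (mV : measurable_fun setT V) (V0 : forall x, 0 <= V x).
Local Notation F := ('rV[R]_d -> Rcomplex R).
Implicit Types (u v w : F) (k : R) (j : 'I_d) (g h : 'I_d -> F).

(** Writes the potential energy as an L2 inner product, on the same footing as the gradient
    terms. *)
Definition fsqrtV u : F := fun x => Num.sqrt (V x) *: u x.

Lemma fRe_sqrtV u : fRe (fsqrtV u) = (fun x => Num.sqrt (V x) * fRe u x).
Proof. by apply/funext => x; rewrite /fRe /fsqrtV; case: (u x). Qed.

Lemma fIm_sqrtV u : fIm (fsqrtV u) = (fun x => Num.sqrt (V x) * fIm u x).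
Proof. by apply/funext => x; rewrite /fIm /fsqrtV; case: (u x). Qed.

Lemma fsqrtV_lin k u v : fsqrtV (k *: u + v) = k *: fsqrtV u + fsqrtV v.
Proof.
apply/funext => x; rewrite -[RHS]/(k *: fsqrtV u x + fsqrtV v x) /fsqrtV.
rewrite -[(k *: u + v) x]/(k *: u x + v x).
by rewrite scalerDr !scalerA mulrC.
Qed.

Lemma fsqrtV_J u : fsqrtV (fJ u) = fJ (fsqrtV u).
Proof.
apply/funext => x; rewrite /fsqrtV /fJ; case: (u x) => a b; apply/eqP.
by rewrite eq_complex /=; apply/andP; split; apply/eqP; ring.
Qed.

Lemma measurable_sqrtV : measurable_fun setT (fun x => Num.sqrt (V x)).
Proof. exact: (measurableT_comp (continuous_measurable_fun (@sqrt_continuous R)) mV). Qed.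

Lemma weak_gradientP u g : weak_gradient u g <->
  forall j, [/\ csq (g j), wpart j (fRe u) (fRe (g j)) & wpart j (fIm u) (fIm (g j))].
Proof.
split=> h j; first by have [/L2P ? /weak_partialP[? ?]] := h j.
by have [? ? ?] := h j; split; [exact/L2P|exact/weak_partialP].
Qed.

Lemma weak_gradient_lin k u v g h : csq u -> csq v ->
  weak_gradient u g -> weak_gradient v h ->
  weak_gradient (k *: u + v) (fun j => k *: g j + h j).
Proof.
move=> [? ?] [? ?] /weak_gradientP ug /weak_gradientP vh; apply/weak_gradientP => j.
have [cg ? ?] := ug j; have [ch ? ?] := vh j; have [? ?] := cg; have [? ?] := ch.
split; first exact: csq_lin.
  by rewrite !fReE; exact: wpart_lin.
by rewrite !fImE; exact: wpart_lin.
Qed.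

Lemma weak_gradient_J u g : csq u -> weak_gradient u g ->
  weak_gradient (fJ u) (fun j => fJ (g j)).
Proof.
move=> [? ?] /weak_gradientP ug; apply/weak_gradientP => j.
have [cg ? ?] := ug j; have [? ?] := cg.
split; [exact: csqJ| |by rewrite !fIm_J].
by rewrite !fRe_J; apply: wpart_lin => //; [exact: sqint0..|exact: wpart0].
Qed.

Lemma weak_gradient_unique u g h : weak_gradient u g -> weak_gradient u h ->
  forall j, {ae mes, forall x, g j x = h j x}.
Proof.
move=> /weak_gradientP ug /weak_gradientP uh j.
have [[? ?] wr wi] := ug j; have [[? ?] wr' wi'] := uh j.
have r : {ae mes, forall x, fRe (g j) x = fRe (h j) x} by exact: wpart_unique wr wr'.
have i : {ae mes, forall x, fIm (g j) x = fIm (h j) x} by exact: wpart_unique wi wi'.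
apply: filterS2 r i => x; rewrite /fRe /fIm.
by case: (g j x) => a b; case: (h j x) => a' b' /= -> ->.
Qed.

Lemma fsqrtV_sqmod u x : sqmod (fsqrtV u x) = V x * sqmod (u x).
Proof.
rewrite /sqmod -/(fRe (fsqrtV u) x) -/(fIm (fsqrtV u) x) fRe_sqrtV fIm_sqrtV.
by rewrite !exprMn sqr_sqrtr// -mulrDr.
Qed.

Lemma form_domainP u : form_domain V u <->
  [/\ csq u, exists g, weak_gradient u g & csq (fsqrtV u)].
Proof.
split=> [[[/L2P cu ug] fin]|[cu ug cs]].
  split=> //; apply/L2P; have [[mr _] [mi _]] := cu; split.
  - by rewrite -[_ \o _]/(fRe (fsqrtV u)) fRe_sqrtV; apply: measurable_funM => //;
      exact: measurable_sqrtV.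
  - by rewrite -[_ \o _]/(fIm (fsqrtV u)) fIm_sqrtV; apply: measurable_funM => //;
      exact: measurable_sqrtV.
  - by under eq_integral do rewrite fsqrtV_sqmod.
split; first by split=> //; exact/L2P.
have [_ _] := (L2P (fsqrtV u)).2 cs.
by under eq_integral do rewrite fsqrtV_sqmod.
Qed.

(* Locked because conversion checks involving [grad] unfold [xget] and diverge. *)
Definition fgrad : F -> 'I_d -> F := locked (@grad R d).

Lemma gradP u : form_domain V u -> weak_gradient u (fgrad u).
Proof.
rewrite /fgrad -lock => /form_domainP[_ [g ug] _].
exact: (xgetPex _ (ex_intro _ g ug)).
Qed.

Lemma csq_grad u j : form_domain V u -> csq (fgrad u j).
Proof. by move=> /gradP /weak_gradientP /(_ j)[]. Qed.

(** The chosen gradient is not linear on the nose, only almost everywhere. Inside an inner product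
    it may be replaced by any weak gradient, which yields the linearity of the form. *)
Lemma rdot_grad u g j w : form_domain V u -> weak_gradient u g -> csq w ->
  rdot (fgrad u j) w = rdot (g j) w.
Proof.
move=> du ug cw; apply: rdot_ae => //; first exact: csq_grad.
- by have /weak_gradientP /(_ j)[] := ug.
- exact: weak_gradient_unique (gradP du) ug j.
- exact: nearW.
Qed.

Lemma form_domain0 : form_domain V (0 : F).
Proof.
apply/form_domainP; split; first exact: csq0.
  by exists (fun=> 0); apply/weak_gradientP => j; split; [exact: csq0|exact: wpart0..].
rewrite (_ : fsqrtV 0 = 0); first exact: csq0.
by apply/funext => x; rewrite /fsqrtV scaler0.
Qed.

Lemma form_domain_lin k u v : form_domain V u -> form_domain V v ->
  form_domain V (k *: u + v).
Proof.
move=> /form_domainP[cu [g ug] su] /form_domainP[cv [h vh] sv]; apply/form_domainP.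
split; first exact: csq_lin.
  by exists (fun j => k *: g j + h j); exact: weak_gradient_lin.
by rewrite fsqrtV_lin; exact: csq_lin.
Qed.

Lemma form_domain_J u : form_domain V u -> form_domain V (fJ u).
Proof.
move=> /form_domainP[cu [g ug] su]; apply/form_domainP.
split; first exact: csqJ.
  by exists (fun j => fJ (g j)); exact: weak_gradient_J.
by rewrite fsqrtV_J; exact: csqJ.
Qed.

Definition eform u v : R :=
  \sum_j rdot (fgrad u j) (fgrad v j) + rdot (fsqrtV u) (fsqrtV v).

Lemma eformC u v : eform u v = eform v u.
Proof.
by rewrite /eform rdotC; congr (_ + _); apply: eq_bigr => j _; exact: rdotC.
Qed.

Lemma eform_ge0 u : 0 <= eform u u.
Proof. by rewrite addr_ge0 ?rdot_ge0// sumr_ge0// => j _; exact: rdot_ge0. Qed.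

Lemma eform_gradl u v g : form_domain V u -> form_domain V v -> weak_gradient u g ->
  eform u v = \sum_j rdot (g j) (fgrad v j) + rdot (fsqrtV u) (fsqrtV v).
Proof.
move=> du dv ug; congr (_ + _); apply: eq_bigr => j _; apply: rdot_grad => //.
exact: csq_grad.
Qed.

Lemma eform_linl k u v w : form_domain V u -> form_domain V v -> form_domain V w ->
  eform (k *: u + v) w = k * eform u w + eform v w.
Proof.
move=> du dv dw; have [cu _ su] := (form_domainP u).1 du.
have [cv _ sv] := (form_domainP v).1 dv; have [cw _ sw] := (form_domainP w).1 dw.
have ug := gradP du; have vg := gradP dv.
rewrite (eform_gradl _ dw (weak_gradient_lin k cu cv ug vg)); last exact: form_domain_lin.
rewrite fsqrtV_lin rdot_linl// /eform.
move: (rdot (fsqrtV u) _) (rdot (fsqrtV v) _) => p q.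
rewrite mulrDr addrACA; congr (_ + _).
rewrite mulr_sumr -big_split/=; apply: eq_bigr => j _.
by rewrite rdot_linl//; exact: csq_grad.
Qed.

Lemma eform_Jl u v : form_domain V u -> form_domain V v ->
  eform (fJ u) v = - eform u (fJ v).
Proof.
move=> du dv; have [cu _ su] := (form_domainP u).1 du.
have [cv _ sv] := (form_domainP v).1 dv.
rewrite (eform_gradl _ dv (weak_gradient_J cu (gradP du))); last exact: form_domain_J.
rewrite [in RHS]eformC (eform_gradl _ du (weak_gradient_J cv (gradP dv)));
  last exact: form_domain_J.
rewrite !fsqrtV_J rdot_Jl// (rdotC (fJ (fsqrtV v)) (fsqrtV u)).
move: (rdot (fsqrtV u) _) => p; rewrite opprD -sumrN; congr (_ + _).
apply: eq_bigr => j _.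
by rewrite (rdot_Jl (csq_grad j du) (csq_grad j dv)) (rdotC (fJ (fgrad v j))).
Qed.

Lemma energyE u v : form_domain V u -> form_domain V v ->
  energy_form V u v = Complex (eform u v) (eform u (fJ v)).
Proof.
move=> du dv; have [cu _ su] := (form_domainP u).1 du.
have [cv _ sv] := (form_domainP v).1 dv.
have dJ := form_domain_J dv.
rewrite /energy_form [@grad R d]lock -/fgrad.
rewrite (_ : cintegral _ = inner (fsqrtV u) (fsqrtV v)); last first.
  congr cintegral; apply/funext => x; rewrite /fsqrtV.
  have := sqr_sqrtr (V0 x); set s := Num.sqrt _ => <-.
  case: (u x) => a b; case: (v x) => a' b'; apply/eqP.
  by rewrite eq_complex /=; apply/andP; split; apply/eqP; ring.
rewrite (inner_rdot su sv) -fsqrtV_J.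
have -> : \sum_j inner (fgrad u j) (fgrad v j) =
    Complex (\sum_j rdot (fgrad u j) (fgrad v j))
      (\sum_j rdot (fgrad u j) (fgrad (fJ v) j)) :> R[i].
  elim/big_rec3: _ => // j a b c _ ->.
  rewrite inner_rdot; [|exact: csq_grad..].
  rewrite [rdot _ (fgrad (fJ v) j)]rdotC (rdot_grad _ dJ (weak_gradient_J cv (gradP dv)));
    last exact: csq_grad.
  by rewrite [rdot _ (fJ _)]rdotC.
by [].
Qed.

(** * The form domain as a real vector space *)

Definition dom_pred : {pred F} := fun u => `[< form_domain V u >].

Lemma dom_predP u : reflect (form_domain V u) (u \in dom_pred).
Proof. exact: asboolP. Qed.

Lemma dom_submod_closed : submod_closed dom_pred.
Proof.
split; first by apply/dom_predP; exact: form_domain0.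
by move=> k u v /dom_predP du /dom_predP dv; apply/dom_predP; exact: form_domain_lin.
Qed.

HB.instance Definition _ := GRing.isSubmodClosed.Build R F dom_pred
  (GRing.submod_closed_semi dom_submod_closed).

(** The space to which the abstract results on forms are applied. Its elements are functions, so
    [domb] is only semidefinite. *)
Record domT := Dom { dom_val :> F; dom_valP : dom_val \in dom_pred }.
HB.instance Definition _ := [isSub for dom_val].
HB.instance Definition _ := [Choice of domT by <:].
HB.instance Definition _ := [SubChoice_isSubLmodule of domT by <:].

Lemma domTP (u : domT) : form_domain V u.
Proof. exact/dom_predP/dom_valP. Qed.

Definition domb (u v : domT) : R := rdot u v.
Definition doma (u v : domT) : R := eform u v.
Definition domJ (u : domT) : domT :=
  Dom (introT (dom_predP _) (form_domain_J (domTP u))).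

Lemma dom_csq (u : domT) : csq u.
Proof. by have /form_domainP[] := domTP u. Qed.

Lemma dom_csq_sqrtV (u : domT) : csq (fsqrtV u).
Proof. by have /form_domainP[] := domTP u. Qed.

Lemma domb_sym : sym_form domb.
Proof.
split=> [u v|w k u v]; first exact: rdotC.
exact: rdot_linl (dom_csq u) (dom_csq v) (dom_csq w).
Qed.

Lemma doma_sym : sym_form doma.
Proof.
split=> [u v|w k u v]; first exact: eformC.
exact: eform_linl (domTP u) (domTP v) (domTP w).
Qed.

Lemma domJ_lin k (u v : domT) : domJ (k *: u + v) = k *: domJ u + domJ v.
Proof. by apply: val_inj; exact: fJ_lin. Qed.

Lemma domJ_isom (u : domT) : domb (domJ u) (domJ u) = domb u u.
Proof. exact: rdot_JJ (dom_csq u) (dom_csq u). Qed.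

Lemma domb_skew (u v : domT) : domb (domJ u) v = - domb (domJ v) u.
Proof. by rewrite /domb rdotC (rdot_Jl (dom_csq v) (dom_csq u)) opprK. Qed.

Lemma doma_skew (u v : domT) : doma (domJ u) v = - doma (domJ v) u.
Proof. by rewrite /doma eformC (eform_Jl (domTP v) (domTP u)) opprK. Qed.

Lemma weak_gradient_B u v g h : csq u -> csq v ->
  weak_gradient u g -> weak_gradient v h ->
  weak_gradient (u - v) (fun j => g j - h j).
Proof.
move=> cu cv ug vh; have := weak_gradient_lin (-1) cv cu vh ug.
rewrite scaleN1r addrC; congr weak_gradient; apply/funext => j.
by rewrite scaleN1r addrC.
Qed.

Lemma fsqrtV_B u v : fsqrtV (u - v) = fsqrtV u - fsqrtV v.
Proof. by rewrite addrC -scaleN1r fsqrtV_lin scaleN1r addrC. Qed.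

Lemma doma_diff (u v : domT) g h : weak_gradient u g -> weak_gradient v h ->
  doma (u - v) (u - v) = \sum_j rdot (g j - h j) (g j - h j) +
    rdot (fsqrtV u - fsqrtV v) (fsqrtV u - fsqrtV v).
Proof.
move=> ug vh; have wB := weak_gradient_B (dom_csq u) (dom_csq v) ug vh.
have dB := domTP (u - v).
rewrite /doma (eform_gradl dB dB wB) fsqrtV_B.
have -> : \sum_j rdot (g j - h j) (fgrad (u - v) j) = \sum_j rdot (g j - h j) (g j - h j) => //.
apply: eq_bigr => j _; rewrite rdotC (rdot_grad _ dB wB) //.
by have /weak_gradientP /(_ j)[] := wB.
Qed.

Lemma measurable_fsqrtV u : csq u ->
  measurable_fun setT (fRe (fsqrtV u)) /\ measurable_fun setT (fIm (fsqrtV u)).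
Proof.
move=> [[mr _] [mi _]]; rewrite fRe_sqrtV fIm_sqrtV.
by split; apply: measurable_funM => //; exact: measurable_sqrtV.
Qed.

(** Closedness of the form. The functions, their gradients and their products with the square root
    of [V] converge separately in L2. Almost everywhere convergence identifies the last limit with
    the product of the first, and [wpart_cvg] identifies the limits of the gradients. *)
Lemma dom_complete : fast_complete (fun u : domT => doma u u + domb u u).
Proof.
move=> u u8; have ug n := gradP (domTP (u n)).
have dE m n := doma_diff (ug m) (ug n).
have u8b n : rdot (u n.+1 - u n : F) (u n.+1 - u n) <= 8^-1 ^+ n.
  by apply: le_trans (u8 n); rewrite lerDr; exact: eform_ge0.
have u8a n : doma (u n.+1 - u n) (u n.+1 - u n) <= 8^-1 ^+ n.
  by apply: le_trans (u8 n); rewrite lerDl; exact: rdot_ge0.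
have u8v n : rdot (fsqrtV (u n.+1) - fsqrtV (u n)) (fsqrtV (u n.+1) - fsqrtV (u n)) <= 8^-1 ^+ n.
  apply: le_trans (u8a n); rewrite dE lerDr sumr_ge0// => j _; exact: rdot_ge0.
have u8g j n :
    rdot (fgrad (u n.+1) j - fgrad (u n) j) (fgrad (u n.+1) j - fgrad (u n) j) <= 8^-1 ^+ n.
  apply: le_trans (u8a n); rewrite dE (bigD1 j)//= -addrA lerDl addr_ge0 ?rdot_ge0//.
  by rewrite sumr_ge0// => i _; exact: rdot_ge0.
have [u0 [cu0 cvu aeu]] := csq_fast_cvg (fun n => dom_csq (u n)) u8b.
have [w [cw cvw aew]] := csq_fast_cvg (fun n => dom_csq_sqrtV (u n)) u8v.
have /choice[g gP] j := csq_fast_cvg (fun n => csq_grad j (domTP (u n))) (u8g j).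
have wae : {ae mes, forall x, fsqrtV u0 x = w x}.
  apply: filterS2 aeu aew => x [ur ui] [wr wi].
  suff [hr hi] : fRe (fsqrtV u0) x = fRe w x /\ fIm (fsqrtV u0) x = fIm w x.
    move: hr hi; rewrite /fRe /fIm; case: (fsqrtV u0 x) => a b.
    by case: (w x) => a' b' /= -> ->.
  have vr : (fun n => fRe (fsqrtV (u n)) x) @ \oo --> fRe (fsqrtV u0) x.
    rewrite fRe_sqrtV; under eq_fun do rewrite fRe_sqrtV; exact: cvgMr ur.
  have vi : (fun n => fIm (fsqrtV (u n)) x) @ \oo --> fIm (fsqrtV u0) x.
    rewrite fIm_sqrtV; under eq_fun do rewrite fIm_sqrtV; exact: cvgMr ui.
  by split; [exact: cvg_unique vr wr|exact: cvg_unique vi wi].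
have [mvr mvi] := measurable_fsqrtV cu0.
have csv : csq (fsqrtV u0).
  split; [apply: sqint_ae mvr _ cw.1|apply: sqint_ae mvi _ cw.2];
    by apply: filterS wae => x; rewrite /fRe /fIm => ->.
have wg : weak_gradient u0 g.
  apply/weak_gradientP => j; have [cg cvg _] := gP j; split=> //.
    apply: (wpart_cvg (p := fun n => fRe (u n)) (q := fun n => fRe (fgrad (u n) j))).
    - by move=> n; have [] := dom_csq (u n).
    - by move=> n; have [] := csq_grad j (domTP (u n)).
    - by have [] := cu0.
    - by have [] := cg.
    - by move=> n; have /weak_gradientP /(_ j)[] := ug n.
    - move=> e e0; have [N1 N1P] := cvu _ e0; have [N2 N2P] := cvg _ e0.
      exists (maxn N1 N2); split; [have := N1P _ (leq_maxl N1 N2)|have := N2P _ (leq_maxr N1 N2)];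
        by apply: le_trans; rewrite /rdot fReB lerDl; exact: dot_ge0.
  apply: (wpart_cvg (p := fun n => fIm (u n)) (q := fun n => fIm (fgrad (u n) j))).
  - by move=> n; have [] := dom_csq (u n).
  - by move=> n; have [] := csq_grad j (domTP (u n)).
  - by have [] := cu0.
  - by have [] := cg.
  - by move=> n; have /weak_gradientP /(_ j)[] := ug n.
  - move=> e e0; have [N1 N1P] := cvu _ e0; have [N2 N2P] := cvg _ e0.
    exists (maxn N1 N2); split; [have := N1P _ (leq_maxl N1 N2)|have := N2P _ (leq_maxr N1 N2)];
      by apply: le_trans; rewrite /rdot fImB lerDr; exact: dot_ge0.
have du0 : form_domain V u0 by apply/form_domainP; split => //; exists g.
exists (Dom (introT (dom_predP _) du0)) => e e0.
(* The error has d + 2 parts: d partial derivatives, the potential term and the L2 norm. *)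
pose e' := e / d.+2%:R; have e'0 : 0 < e' by rewrite divr_gt0// ltr0n.
have [N0 N0P] := cvu _ e'0; have [N1 N1P] := cvw _ e'0.
have /choice[Nj NjP] j : exists N, forall n, (N <= n)%N ->
    rdot (fgrad (u n) j - g j) (fgrad (u n) j - g j) <= e'.
  by have [_ /(_ _ e'0)] := gP j.
exists (maxn N0 (maxn N1 (\max_j Nj j))) => n.
rewrite !geq_max => /and3P[/N0P n0 /N1P n1 /bigmax_leqP nj].
rewrite (doma_diff (v := Dom (introT (dom_predP _) du0)) (ug n) wg) /domb.
have h1 : \sum_j rdot (fgrad (u n) j - g j) (fgrad (u n) j - g j) <= \sum_(j < d) e'.
  by apply: ler_sum => j _; apply: NjP; exact: nj.
have h2 : rdot (fsqrtV (u n) - fsqrtV u0) (fsqrtV (u n) - fsqrtV u0) <= e'.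
  have cn := dom_csq_sqrtV (u n); have c1 := csqB cn csv; have c2 := csqB cn cw.
  apply: le_trans n1; rewrite le_eqVlt; apply/orP; left; apply/eqP.
  by apply: rdot_ae => //; apply: filterS wae => x /= h;
    rewrite -[LHS]/(fsqrtV (u n) x - fsqrtV u0 x) h.
apply: le_trans (lerD (lerD h1 h2) n0) _.
rewrite sumr_const card_ord -[e' *+ d]mulr_natr.
rewrite (_ : _ + e' = e' * d.+2%:R); last by rewrite -addn2 natrD; ring.
by rewrite /e' divfK// pnatr_eq0.
Qed.

(** * Compactness of the form domain and discreteness of the spectrum *)

Variables (r0 : R) (gamma : R -> R).
Hypothesis r0_gt0 : 0 < r0.
Hypothesis gamma01 : forall r, 0 < r <= r0 -> 0 < gamma r < 1.
Hypothesis gamma_limsup :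
  limf_esup (fun r : R => (r ^- 2 * gamma r)%:E) (0 : R)^'+ = +oo%E.
Hypothesis V_rearrangement : forall r, 0 < r <= r0 ->
  tends_to_pinfty_at_infinity
    (fun y => rearrangement V (cube r y) ((gamma r)%:E * mes (cube r y))%E).

(** The real estimate is applied to the real and the imaginary part, so there are two functionals
    per cell, with the constant [c] absorbed as [Num.sqrt c]. *)
Lemma dom_compact (e : R) : 0 < e -> exists n (phi : 'I_n -> domT -> R),
  [/\ forall i, lin_form (phi i),
      exists2 C, 0 <= C & forall i (u : domT), phi i u ^+ 2 <= C * domb u u &
      forall u : domT, domb u u <= e * doma u u + \sum_i phi i u ^+ 2].
Proof.
move=> e0; have [I [A [c [bA c0 key]]]] :=
  real_compactness mV V0 r0_gt0 gamma01 gamma_limsup V_rearrangement e0.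
pose part (b : bool) (u : F) := if b then fRe u else fIm u.
have cpart b (u : domT) : sqint mes (part b u) by have [] := dom_csq u; case: b.
have sA i := indic_box_sqint (bA i).
pose psi (p : I * bool) (u : domT) := Num.sqrt c * dot mes (part p.2 u) (\1_(A p.1)).
exists #|{: I * bool}|, (fun i => psi (enum_val i)); split.
- move=> k a u v; rewrite /psi; move: (enum_val k) => [i b].
  have -> : part b (a *: u + v : domT) = (fun x => a * part b u x + part b v x).
    by case: b; [exact: fReE|exact: fImE].
  by rewrite dot_linl//=; ring.
- exists (c * \sum_i dot mes (\1_(A i)) (\1_(A i))).
    by rewrite mulr_ge0// sumr_ge0// => i _; exact: dot_ge0.
  move=> k u; rewrite /psi; move: (enum_val k) => [i b] /=.
  rewrite exprMn sqr_sqrtr// -mulrA ler_wpM2l// mulrC.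
  apply: le_trans (dot_CS (cpart b u) (sA i)) _.
  apply: ler_pM; rewrite ?dot_ge0//.
    by case: (b); rewrite /domb /rdot ?lerDl ?lerDr dot_ge0.
  by rewrite (bigD1 i)//= lerDl sumr_ge0// => i' _; exact: dot_ge0.
- move=> u; rewrite -(@big_enum_val _ _ _ _ _ (fun p => psi p u ^+ 2))/=.
  have -> : \sum_p psi p u ^+ 2 = c * \sum_i dot mes (fRe u) (\1_(A i)) ^+ 2 +
      c * \sum_i dot mes (fIm u) (\1_(A i)) ^+ 2.
    rewrite !mulr_sumr -big_split/=.
    rewrite (eq_bigr (fun p => psi (p.1, p.2) u ^+ 2)) => [|[]//].
    rewrite -(pair_bigA _ (fun i b => psi (i, b) u ^+ 2))/=.
    by apply: eq_bigr => i _; rewrite big_bool /psi/= !exprMn sqr_sqrtr.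
  have /weak_gradientP ug := gradP (domTP u).
  have [su1 su2] := dom_csq u; have [sv1 sv2] := dom_csq_sqrtV u.
  rewrite fRe_sqrtV in sv1; rewrite fIm_sqrtV in sv2.
  have k1 : dot mes (fRe u) (fRe u) <=
      e * (\sum_j dot mes (fRe (fgrad u j)) (fRe (fgrad u j)) +
           dot mes (fRe (fsqrtV u)) (fRe (fsqrtV u))) +
      c * \sum_i dot mes (fRe u) (\1_(A i)) ^+ 2.
    rewrite fRe_sqrtV; apply: key => // j; have [[] * ] := ug j => //.
    exact: wpart_weakd.
  have k2 : dot mes (fIm u) (fIm u) <=
      e * (\sum_j dot mes (fIm (fgrad u j)) (fIm (fgrad u j)) +
           dot mes (fIm (fsqrtV u)) (fIm (fsqrtV u))) +
      c * \sum_i dot mes (fIm u) (\1_(A i)) ^+ 2.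
    rewrite fIm_sqrtV; apply: key => // j; have [[] * ] := ug j => //.
    exact: wpart_weakd.
  have -> : doma u u =
     (\sum_j dot mes (fRe (fgrad u j)) (fRe (fgrad u j)) +
           dot mes (fRe (fsqrtV u)) (fRe (fsqrtV u))) +
     (\sum_j dot mes (fIm (fgrad u j)) (fIm (fgrad u j)) +
           dot mes (fIm (fsqrtV u)) (fIm (fsqrtV u))).
    by rewrite addrACA -big_split.
  apply: le_trans (lerD k1 k2) _; lra.
Qed.

Lemma cmulE (l : R[i]) u :
  (fun x => l * u x) = complex.Re l *: u + complex.Im l *: fJ u.
Proof.
apply/funext => x; rewrite -[RHS]/(complex.Re l *: u x + complex.Im l *: fJ u x).
rewrite /fJ; case: l => p q; case: (u x) => a b; apply/eqP.
by rewrite eq_complex /=; apply/andP; split; apply/eqP; ring.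
Qed.

Lemma csqZ k u : csq u -> csq (k *: u).
Proof. by move=> cu; rewrite -[_ *: _]addr0; apply: csq_lin => //; exact: csq0. Qed.

Lemma csqD u v : csq u -> csq v -> csq (u + v).
Proof. by move=> cu cv; rewrite -[u]scale1r; exact: csq_lin. Qed.

Lemma rdot_cmul (l : R[i]) u v : csq u -> csq v ->
  rdot (fun x => l * u x) v = complex.Re l * rdot u v + complex.Im l * rdot (fJ u) v.
Proof.
move=> cu cv; have cJ := csqJ cu; rewrite cmulE rdot_linl//; last exact: csqZ.
congr (_ + _); rewrite -[_ *: fJ u]addr0 rdot_linl//; last exact: csq0.
by rewrite rdot0l// addr0.
Qed.

(** The real parts suffice: the domain is stable under [fJ], and testing with [fJ v] recovers the
    imaginary parts. *)
Lemma schrodingerP (u f : F) : schrodinger V u f <->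
  [/\ form_domain V u, csq f & forall v : domT, eform u v = rdot f v].
Proof.
split=> [[du /L2P cf h]|[du cf h]].
  split=> // v; have := h v (domTP v).
  by rewrite (energyE du (domTP v)) (inner_rdot cf (dom_csq v)) => -[].
split=> //; first exact/L2P.
move=> v dv; pose w := Dom (introT (dom_predP v) dv).
rewrite (energyE du dv) (inner_rdot cf (dom_csq w)).
by have -> := h w; have -> := h (domJ w).
Qed.

Local Notation dom_pencil := (pencil doma domb domJ).
Local Notation dom_eigvec := (eigvec doma domb domJ).

Lemma shiftedP (l : R[i]) (u : domT) f : csq f ->
  shifted (schrodinger V) l u f <->
  forall v : domT, dom_pencil (complex.Re l) (complex.Im l) u v = rdot f v.
Proof.
move=> cf; have cu := dom_csq u; have clu : csq (fun x => l * u x).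
  by rewrite cmulE; apply: csqD; apply: csqZ => //; exact: csqJ.
have E (v : domT) : rdot (fun x => f x + l * u x) v = rdot f v +
    (complex.Re l * domb u v + complex.Im l * domb (domJ u) v).
  rewrite -(rdot_cmul l cu (dom_csq v)) -[rdot f v]mul1r -(rdot_linl _ cf clu (dom_csq v)).
  by rewrite scale1r.
rewrite /shifted; split=> [/schrodingerP[_ _ h] v|h].
  by rewrite /pencil /doma h E addrK.
apply/schrodingerP; split; [exact: domTP|exact: csqD|].
by move=> v; rewrite E -h /pencil subrK.
Qed.

Lemma eigenfunctionP (l : R[i]) (u : domT) : eigenfunction (schrodinger V) l u <->
  dom_eigvec (complex.Re l) (complex.Im l) u.
Proof.
have -> : eigenfunction (schrodinger V) l u = shifted (schrodinger V) l u (0 : F).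
  rewrite /eigenfunction /shifted; congr (schrodinger V u _); apply/funext => x.
  by rewrite add0r.
split=> [/(shiftedP _ _ (csq0 R d)) h v|h]; first by rewrite h rdot0l//; exact: dom_csq.
by apply/(shiftedP _ _ (csq0 R d)) => v; rewrite h rdot0l//; exact: dom_csq.
Qed.

Lemma domb_eq0 (u : domT) : domb u u = 0 <-> ae_equal u (fun=> 0).
Proof.
split=> [|u0]; first exact: rdot_eq0 (dom_csq u).
have -> : domb u u = rdot (0 : F) 0.
  by apply: rdot_ae => //; [exact: dom_csq|exact: csq0|exact: dom_csq|exact: csq0].
by rewrite rdot0l//; exact: csq0.
Qed.

Lemma L2normE u : csq u -> L2norm u = Num.sqrt (rdot u u).
Proof.
move=> [su1 su2]; apply: (f_equal Num.sqrt).
have -> : rdot u u = \int[mes]_x (fRe u x * fRe u x + fIm u x * fIm u x).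
  by rewrite (RintegralD measurableT (sqint_mul su1 su1) (sqint_mul su2 su2)).
by apply: eq_Rintegral => x _; rewrite /sqmod !expr2.
Qed.

Lemma resolvent_or_eigvec (l : R[i]) : resolvent_set (schrodinger V) l \/
  exists u : domT, dom_eigvec (complex.Re l) (complex.Im l) u /\ domb u u != 0.
Proof.
have [_ [ue|[K K0 KP]]] := fredholm doma_sym domb_sym (fun u : domT => eform_ge0 u)
  (fun u : domT => rdot_ge0 u) domJ_lin domJ_isom domb_skew dom_complete dom_compact
  (complex.Re l) (complex.Im l); [by right|].
(* The solvability branch of [fredholm] does not itself exclude eigenvectors; their absence is what
   makes the solution unique. *)
have [ue|nue] := pselect (exists u : domT,
  dom_eigvec (complex.Re l) (complex.Im l) u /\ domb u u != 0); [by right|left].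
exists (Num.sqrt K) => f /L2P cf.
have [||v|u [ux uK]] := KP (fun v : domT => rdot f v) (rdot f f).
- move=> k v w; rewrite rdotC (rdot_linl _ (dom_csq v) (dom_csq w) cf).
  by rewrite (rdotC v) (rdotC w).
- exact: rdot_ge0.
- exact: rdot_CS cf (dom_csq v).
exists u; split; first exact/(shiftedP _ _ cf).
  rewrite (L2normE (dom_csq u)) (L2normE cf) -sqrtrM//.
  exact: ler_wsqrtr.
move=> u' su'; have du' : form_domain V u' by case: su'.
pose w := Dom (introT (dom_predP u') du').
have wx : forall v : domT, dom_pencil (complex.Re l) (complex.Im l) w v = rdot f v.
  exact/(shiftedP _ w cf).
have ewu : dom_eigvec (complex.Re l) (complex.Im l) (w - u).
  move=> v; have -> : w - u = -1 *: u + w by rewrite scaleN1r addrC.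
  rewrite /pencil domJ_lin (doma_sym.2 v) !(domb_sym.2 v).
  have := ux v; have := wx v; rewrite /pencil; lra.
have /domb_eq0 : domb (w - u) (w - u) = 0.
  by apply: contrapT => /eqP h; apply: nue; exists (w - u).
by apply: filterS => x; rewrite -[_ x]/(u' x - u x) => /eqP; rewrite subr_eq0 => /eqP.
Qed.

Lemma spectrum_eigvec (l : R[i]) : spectrum (schrodinger V) l ->
  complex.Im l = 0 /\
  exists u : domT, dom_eigvec (complex.Re l) 0 u /\ domb u u != 0.
Proof.
move=> sl; have [//|[u [eu u0]]] := resolvent_or_eigvec l.
have Im0 := eigvec_real doma_sym domb_sym domJ_isom domb_skew doma_skew eu u0.
by rewrite Im0 in eu; split=> //; exists u.
Qed.

(** Every spectral point is a real eigenvalue of finite multiplicity by the Fredholm alternative. A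
    non-isolated one would have arbitrarily many other eigenvalues within distance 1, against
    [eigenvalues_locally_finite]. *)
Lemma schrodinger_discrete : discrete_spectrum (schrodinger V).
Proof.
move=> l sl; have [Iml [u [eu u0]]] := spectrum_eigvec sl.
rewrite -Iml in eu; split; last 2 first.
- exists u; split; first exact/eigenfunctionP.
  by move/domb_eq0/eqP; rewrite (negbTE u0).
- have [[n [e [eP espan]]] _] := fredholm doma_sym domb_sym (fun u : domT => eform_ge0 u)
    (fun u : domT => rdot_ge0 u) domJ_lin domJ_isom domb_skew dom_complete dom_compact
    (complex.Re l) (complex.Im l).
  exists n, (fun i => e i : F); split; first by move=> k; exact/eigenfunctionP.
  move=> w ew; have dw : form_domain V w by case: ew.
  pose w' := Dom (introT (dom_predP w) dw).
  have [c /domb_eq0 cP] : exists c : 'I_n -> R,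
      domb (w' - \sum_i c i *: e i) (w' - \sum_i c i *: e i) = 0.
    exact/espan/(eigenfunctionP _ w').
  (* The family spans the eigenspace already over the reals, so real coefficients do. *)
  exists (fun i => (c i)%:C%C).
  have sumE : dom_val (\sum_i c i *: e i) = (fun x => \sum_i (c i)%:C%C * e i x).
    apply/funext => x; elim/big_ind2: _ => // [y f y' f' h h'|k _].
      by rewrite -[LHS]/(dom_val f x + dom_val f' x) h h'.
    rewrite -[LHS]/(c k *: e k x); case: (e k x) => a b; apply/eqP.
    by rewrite eq_complex /=; apply/andP; split; apply/eqP; ring.
  apply: filterS cP => x; rewrite -[(dom_val _) x]/(w x - dom_val (\sum_i c i *: e i) x) sumE.
  by move=> /eqP; rewrite subr_eq0 => /eqP.
apply: contrapT => niso.
pose P (x : R) := [/\ x <= complex.Re l + 1, x != complex.Re l &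
  exists v : domT, dom_eigvec x 0 v /\ domb v v != 0].
(* Non-isolation is applied with a radius not exceeding the distance from [l] to any listed
   eigenvalue, so the new one is not in the list, and not exceeding 1, so it stays below the bound
   in [P]. *)
have ext (s : seq R) : (forall x, x \in s -> P x) -> exists2 x, P x & x \notin s.
  move=> sP.
  have [e [e0 e1 es]] : exists e : R, [/\ 0 < e, e <= 1 &
      forall x, x \in s -> e <= `|x - complex.Re l|].
    elim: s sP => [|x s IH] sP; first by exists 1.
    have [y ys|e [e0 e1 es]] := IH; first by apply: sP; rewrite inE ys orbT.
    have [_ xl _] := sP _ (mem_head x s).
    have xl0 : 0 < `|x - complex.Re l| by rewrite normr_gt0 subr_eq0.
    exists (Num.min e `|x - complex.Re l|); split.
    - by rewrite lt_min e0.
    - by rewrite ge_min e1.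
    - by move=> y; rewrite inE ge_min => /orP[/eqP ->|/es ->//]; rewrite lexx orbT.
  apply: contrapT => nP; apply: niso; exists e => // m sm ml; apply: contrapT => mnl.
  have [Imm mv] := spectrum_eigvec sm.
  have ml' : `|complex.Re m - complex.Re l| < e.
    rewrite -[ltRHS]gtr0_norm// -ltr_sqr ?nnegrE// real_normK ?num_real// real_normK ?num_real//.
    apply: le_lt_trans ml; rewrite /sqmod; move: Imm Iml; case: (m) => a b; case: (l) => a' b' /=.
    by move=> -> ->; rewrite subr0 expr0n addr0.
  apply: nP; exists (complex.Re m); last by apply/negP => /es; rewrite leNgt ml'.
  split=> //; first by move: ml'; rewrite ltr_norml; lra.
  apply/eqP => h; apply: mnl; apply/eqP; rewrite eq_complex h Imm Iml !eqxx//.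
have chain n : exists s : seq R, [/\ size s = n, uniq s & forall x, x \in s -> P x].
  elim: n => [|n [s [sn us sP]]]; first by exists [::].
  have [x Px xs] := ext s sP; exists (x :: s); rewrite /= sn xs us; split=> // y.
  by rewrite inE => /orP[/eqP ->//|/sP].
have [N NP] := eigenvalues_locally_finite domJ doma_sym domb_sym
  (fun u : domT => rdot_ge0 u) dom_compact (complex.Re l + 1).
have [s [sn us sP]] := chain N.+1.
have sP' (i : 'I_N.+1) : P s`_i by apply: sP; rewrite mem_nth// sn.
have /choice[v vP] (i : 'I_N.+1) : exists v : domT, dom_eigvec s`_i 0 v /\ domb v v != 0.
  by have [_ _] := sP' i.
suff : (N.+1 <= N)%N by rewrite ltnn.
apply: (NP _ (fun i : 'I_N.+1 => s`_i) v).
- by move=> i j /eqP; rewrite nth_uniq ?sn// => /eqP/val_inj.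
- by move=> i; have [? ? ] := vP i; have [? _ _] := sP' i.
Qed.
End form_domain.

Theorem theorem4p1 (R : realType) (d : nat) (V : 'rV[R]_d -> R)
    (r0 : R) (gamma : R -> R) :
  (3 <= d)%N ->
  L1loc V ->
  (forall x, 0 <= V x) ->
  0 < r0 ->
  (forall r, 0 < r <= r0 -> 0 < gamma r < 1) ->
  limf_esup (fun r : R => (r ^- 2 * gamma r)%:E) (0 : R)^'+ = +oo%E ->
  (forall r, 0 < r <= r0 ->
    tends_to_pinfty_at_infinity
      (fun y => rearrangement V (cube r y) ((gamma r)%:E * mes (cube r y))%E)) ->
  discrete_spectrum (schrodinger V).
Proof.
move=> _ [mV _] V0 r0_gt0 gamma01 gamma_limsup V_rearrangement.
exact: (schrodinger_discrete mV V0 r0_gt0 gamma01 gamma_limsup V_rearrangement).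
Qed.
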